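(* Let $G$ be a group acting properly, with uniformly bounded stabilizers, and cellularly on a CAT(0) cube complex of finite dimension. Then $G$ cannot contain amenable subgroups of super-polynomial growth. That is, there is a length function $\ell$ on $G$, which can be taken to be the word length if $G$ is finitely generated, such that no amenable subgroup $H$ of $G$ has super-polynomial growth with respect to the restriction of $\ell$ to $H$.
   Context: A length function on a group $G$ is a map $\ell:G\to\mathbb{R}_+$ with $\ell(e)=0$, $\ell(\gamma)=\ell(\gamma^{-1})$ and $\ell(\gamma\mu)\le \ell(\gamma)+\ell(\mu)$ for all $\gamma,\mu\in G$. A group $H$ has polynomial growth with respect to a length function $\ell$ if there is a polynomial $P$ such that $|\{h\in H:\ell(h)\le r\}|\le P(r)$ for all $r\ge 0$; it has super-polynomial growth otherwise. A cube complex is a metric polyhedral complex in which each cell is isometric to a Euclidean cube $[-1/2,1/2]^n$ and the gluing maps are isometries. It is CAT(0) if the metric induced by the Euclidean metrics on the cubes is CAT(0), and finite dimensional if there is $n<\infty$ such that it has no cells of dimension greater than $n$. ''Uniformly bounded stabilizers'' means that there is a constant $c$ such that every vertex stabilizer has at most $c$ elements. Acting cellularly means by isometries mapping cells to cells. *)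

(* Defs.v *)
From HB Require Import structures.
From mathcomp Require Import all_boot all_order all_algebra.
From mathcomp Require Import boolp classical_sets functions cardinality.
From mathcomp Require Import reals constructive_ereal ereal.

Set Implicit Arguments.
Unset Strict Implicit.
Unset Printing Implicit Defensive.

Import Order.TTheory GRing.Theory Num.Theory.
Local Open Scope classical_set_scope.
Local Open Scope ring_scope.

Section Euclid.
Variable R : realType.

(* The library's norm on 'rV[R]_n is the sup norm. *)
Definition edist n (x y : 'rV[R]_n) : R :=
  Num.sqrt (\sum_(i < n) (x 0 i - y 0 i) ^+ 2).

Definition eseg n (x y : 'rV[R]_n) : set 'rV[R]_n :=
  [set z | exists2 t : R, 0 <= t <= 1 & z = (1 - t) *: x + t *: y].

Definition cube n : set 'rV[R]_n := [set x | forall i, `|x 0 i| <= 2^-1].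

(* A face of [-1/2,1/2]^n is given by a sign vector: [Some b] fixes the
   coordinate at 1/2 or -1/2, and [None] leaves it free. *)
Definition face_code n := {ffun 'I_n -> option bool}.

Definition face n (f : face_code n) : set 'rV[R]_n :=
  [set x | forall i, match f i with
                     | Some b => x 0 i = if b then 2^-1 else - 2^-1
                     | None => `|x 0 i| <= 2^-1
                     end].

Definition face_interior n (f : face_code n) : set 'rV[R]_n :=
  [set x | forall i, match f i with
                     | Some b => x 0 i = if b then 2^-1 else - 2^-1
                     | None => `|x 0 i| < 2^-1
                     end].

Definition isometric_faces m n (f : face_code m) (g : face_code n)
    (h : 'rV[R]_m -> 'rV[R]_n) : Prop :=
  h @` face f = face g /\
  (forall x y, face f x -> face f y -> edist (h x) (h y) = edist x y).

(* Metric polyhedral complexes in the sense of Bridson-Haefliger, I.7.37, with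
   cubes as cells.  The complex is the quotient of the disjoint union of the
   cubes [cube (cc_dim s)] by "having the same image under [cc_map]"; the values
   of [cc_map s] outside the cube are irrelevant.  In [cc_glue], [f] and [g] are
   the supports of [x] and [y].  Complexes are nonempty. *)
Record cube_complex := CubeComplex {
  cc_pt :> Type;
  cc_idx : Type;
  cc_dim : cc_idx -> nat;
  cc_map : forall s : cc_idx, 'rV[R]_(cc_dim s) -> cc_pt;
  cc_nonempty : inhabited cc_pt;
  cc_cover : forall p : cc_pt, exists s x, cube x /\ @cc_map s x = p;
  cc_inj : forall s (f : face_code (cc_dim s)) x y,
    face_interior f x -> face_interior f y ->
    @cc_map s x = @cc_map s y -> x = y;
  cc_glue : forall s t (f : face_code (cc_dim s)) (g : face_code (cc_dim t)) x y,
    face_interior f x -> face_interior g y ->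
    @cc_map s x = @cc_map t y ->
    exists2 h, isometric_faces f g h &
      forall z, face f z -> @cc_map s z = @cc_map t (h z)
}.

End Euclid.

Section CubeComplex.
Variables (R : realType) (X : cube_complex R).

Definition is_cell (C : set X) : Prop :=
  exists (s : cc_idx X) (f : face_code (cc_dim s)), C = @cc_map R X s @` face f.

Definition is_vertex (v : X) : Prop :=
  exists (s : cc_idx X) (f : face_code (cc_dim s)),
    (forall i, f i <> None) /\ [set v] = @cc_map R X s @` face f.

Definition finite_dimensional : Prop :=
  exists n : nat, forall s : cc_idx X, (cc_dim s <= n)%N.

(* [chain x y l]: there is a path of length [l] from [x] to [y] which is a
   concatenation of finitely many straight segments, each in a single cube. *)
Inductive chain : X -> X -> R -> Prop :=
| chain_nil x : chain x x 0
| chain_cons (s : cc_idx X) (a b : 'rV[R]_(cc_dim s)) y l :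
    cube a -> cube b -> chain (cc_map b) y l ->
    chain (cc_map a) y (edist a b + l).

Definition cc_edist (x y : X) : \bar R :=
  ereal_inf [set l%:E | l in [set l | chain x y l]].

Definition cc_dist (x y : X) : R := fine (cc_edist x y).

End CubeComplex.

Section CAT0.
Variables (R : realType) (T : Type) (d : T -> T -> R).

Definition is_metric : Prop :=
  [/\ forall x y, 0 <= d x y,
      forall x y, d x y = 0 <-> x = y,
      forall x y, d x y = d y x &
      forall x y z, d x z <= d x y + d y z].

Definition geodesic_segment (x y : T) (S : set T) : Prop :=
  exists c : R -> T,
    [/\ c 0 = x, c (d x y) = y,
        forall s t, 0 <= s <= d x y -> 0 <= t <= d x y ->
          d (c s) (c t) = `|s - t| &
        S = c @` [set t | 0 <= t <= d x y]].

Definition comparison_point (p q : T) (S : set T) (p' q' : 'rV[R]_2)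
    (x : T) (x' : 'rV[R]_2) : Prop :=
  [/\ S x, eseg p' q' x' & edist p' x' = d p x].

Definition CAT0_inequality : Prop :=
  forall (p q r : T) (Spq Sqr Srp : set T) (p' q' r' : 'rV[R]_2),
    geodesic_segment p q Spq -> geodesic_segment q r Sqr ->
    geodesic_segment r p Srp ->
    edist p' q' = d p q -> edist q' r' = d q r -> edist r' p' = d r p ->
  let cmp x x' := [\/ comparison_point p q Spq p' q' x x',
                      comparison_point q r Sqr q' r' x x' |
                      comparison_point r p Srp r' p' x x'] in
  forall x y x' y', cmp x x' -> cmp y y' -> d x y <= edist x' y'.

Definition CAT0_space : Prop :=
  [/\ is_metric, forall x y, exists S, geodesic_segment x y S &
      CAT0_inequality].

End CAT0.

Definition CAT0_cube_complex (R : realType) (X : cube_complex R) : Prop :=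
  (forall x y : X, cc_edist x y \is a fin_num) /\ CAT0_space (@cc_dist R X).

Section Groups.
Variables (R : realType) (G : groupType).

Definition is_length (l : G -> R) : Prop :=
  [/\ forall g, 0 <= l g, l 1%g = 0, forall g, l (g^-1)%g = l g &
      forall g h, l (g * h)%g <= l g + l h].

Definition bounded (f : G -> R) : Prop := exists M, forall x, `|f x| <= M.

(* Amenability of the discrete group [G]: a left-invariant mean on the bounded
   functions; the values of [m] on unbounded functions are irrelevant. *)
Definition amenable : Prop :=
  exists m : (G -> R) -> R,
    [/\ forall (a : R) f g, bounded f -> bounded g ->
          m (fun x => a * f x + g x) = a * m f + m g,
        forall f, bounded f -> (forall x, 0 <= f x) -> 0 <= m f,
        m (fun=> 1) = 1 &
        forall (g : G) f, bounded f -> m (fun x => f (g * x)%g) = m f].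

Definition polynomial_growth (H : {pred G}) (l : G -> R) : Prop :=
  exists P : {poly R}, forall r : R, 0 <= r ->
    exists2 n : nat, ([set h | h \in H /\ (l h <= r)] #<= `I_n)%card &
      n%:R <= P.[r].

Definition super_polynomial_growth (H : {pred G}) (l : G -> R) : Prop :=
  ~ polynomial_growth H l.

Definition word (S : set G) (g : G) (w : seq G) : Prop :=
  (forall a, a \in w -> S a \/ S (a^-1)%g) /\ (\prod_(a <- w) a)%g = g.

Definition generates (S : set G) : Prop := forall g, exists w, word S g w.

(* This is an infimum over the empty set, hence junk, when [g] is not in the
   subgroup generated by [S]. *)
Definition word_length (S : set G) (g : G) : R :=
  inf [set (size w)%:R | w in [set w | word S g w]].

End Groups.

Definition subgroup (G : groupType) (H : groupClosed G) : Type :=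
  {x : G | x \in H}.

HB.instance Definition _ (G : groupType) (H : groupClosed G) :=
  SubChoice.on (subgroup H).

Fact subgroup_closed (G : groupType) (H : groupClosed G) : group_closed H.
Proof.
by split=> [|x y xH yH]; [exact: gpred1 | rewrite gpredM // gpredV].
Qed.

HB.instance Definition _ (G : groupType) (H : groupClosed G) :=
  SubChoice_isSubGroup.Build G (fun x => x \in H) (subgroup H)
    (subgroup_closed H).

Section Actions.
Variables (R : realType) (G : groupType) (X : cube_complex R).
Variable act : G -> X -> X.

Definition is_action : Prop :=
  (forall x, act 1%g x = x) /\
  (forall g h x, act (g * h)%g x = act g (act h x)).

Definition cellular : Prop :=
  (forall g x y, cc_dist (act g x) (act g y) = cc_dist x y) /\
  (forall g C, is_cell C -> is_cell (act g @` C)).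

(* Properness in the sense of Bridson-Haefliger, I.8.2. *)
Definition proper_action : Prop :=
  forall x : X, exists2 r : R, 0 < r &
    let B := [set y | cc_dist x y < r] in
    finite_set [set g | (act g @` B) `&` B !=set0].

Definition uniformly_bounded_stabilizers : Prop :=
  exists c : nat, forall v : X, is_vertex v ->
    ([set g | act g v = v] #<= `I_c)%card.

End Actions.

Definition no_amenable_superpolynomial (R : realType) (G : groupType)
    (l : G -> R) : Prop :=
  ~ exists H : groupClosed G,
      amenable R (subgroup H) /\ super_polynomial_growth H l.

(* Main.v *)
(** Fix a base vertex [x0] and let [l g] be the number of hyperplanes
    separating [x0] from [g x0].  For vertices [z], [p], [q] let [t] be their
    median.  An interval contains at most polynomially many vertices at distance
    at most [r] from an end, because its elements are joins of at most [dim X]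
    join-irreducibles and there are at most [dim X] of these at each distance.
    For a finite subset [A] of an amenable subgroup [H] contained in the
    [r]-ball, join [h^-1 x0] to [h^-1 a^-1 x0] and charge the edge to the median
    with [x0].  Each orbit point is charged to few medians, and each median [t]
    separates few pairs, since [h t] lies in one of the intervals
    [[x0, a^-1 x0]] and stabilizers are bounded.  Call an edge light if few edges
    at its tail are charged to the same median: few light edges leave a
    point, few heavy ones enter it, and the invariant mean equates the average
    numbers of incoming and outgoing edges.  Hence [A] is polynomially bounded.

    The hyperplane structure comes from the CAT(0) metric as follows.  A line is
    a segment parallel to a coordinate axis of a cube.  If a line [L] has an
    interior point [m] closest to [z], then the geodesic from [m] to [z] keeps
    constant height in the carrier of the hyperplane of [L], so that [z] lies in
    the open carrier; this is impossible for a vertex.  Hence the distance to a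
    vertex [z] is monotone along [L], and its direction only depends on the
    parallelism class by continuity: this tells on which side of a hyperplane
    [z] lies.  The edges at [p] pointing towards [z] are those of the cube which
    the geodesic from [p] to [z] enters first, and all of the combinatorics of
    medians follows from this. *)

Require Import Defs.
From HB Require Import structures.
From mathcomp Require Import all_boot all_order all_algebra finmap.
From mathcomp Require Import ring lra.
From mathcomp Require Import boolp classical_sets functions cardinality.
From mathcomp Require Import reals constructive_ereal ereal.
From mathcomp Require topology normedtype derive.
Set Implicit Arguments.
Unset Strict Implicit.
Unset Printing Implicit Defensive.

(** * Medians and intervals of a wall space *)

(** A duplicate-free list in [P] that misses an element of [P] can be lengthened, so if no list
    exhausted [P], one of length [n.+1] would arise. *)
Lemma bounded_enum (T : choiceType) (P : T -> Prop) (n : nat) :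
  (forall s : seq T, uniq s -> (forall x, x \in s -> P x) -> size s <= n) ->
  exists2 s : seq T, size s <= n & forall x, P x -> x \in s.
Proof.
move=> Pn.
have [//|nex] := pselect (exists2 s : seq T, size s <= n & forall x, P x -> x \in s).
have /(_ n.+1) [s [us sP sn]] : forall k, exists s : seq T,
    [/\ uniq s, forall x, x \in s -> P x & size s = k].
  elim=> [|k [s [us sP sk]]]; first by exists [::].
  have [x Px xs] : exists2 x, P x & x \notin s.
    apply: contrapT => H; apply: nex; exists s; first exact: Pn.
    by move=> x Px; apply: contrapT => /negP xs; apply: H; exists x.
  exists (x :: s); split=> /=; [by rewrite xs|  |by rewrite sk].
  by move=> y; rewrite inE => /orP[/eqP->|/sP].
by move: (Pn s us sP); rewrite sn ltnn.
Qed.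

Definition maj (a b c : bool) := (a && b) || (a && c) || (b && c).

Section WallSpace.
Local Open Scope fset_scope.
(** A wall space in the abstract: [o x w] is the side of the wall [w] on which the vertex [x] lies,
    and [sep x q = [fset w]] means that an edge crossing [w] joins [x] to [q]. *)
Variables (V W : choiceType) (o : V -> W -> bool) (sep : V -> V -> {fset W}).
Variable N : nat.
Hypothesis sepP : forall x y w, (w \in sep x y) = (o x w != o y w).
Hypothesis edge_toward : forall x y, x != y ->
  exists q w, w \in sep x y /\ sep x q = [fset w].
Hypothesis square : forall p z q1 q2 w1 w2,
  sep p q1 = [fset w1] -> sep p q2 = [fset w2] -> w1 != w2 ->
  w1 \in sep p z -> w2 \in sep p z -> exists v, sep q1 v = [fset w2].
Hypothesis dim_bound : forall p z (ws : seq W), uniq ws ->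
  (forall w, w \in ws -> w \in sep p z /\ exists q, sep p q = [fset w]) ->
  size ws <= N.

Lemma sepC x y : sep x y = sep y x.
Proof. by apply/fsetP => w; rewrite !sepP eq_sym. Qed.

Lemma sepxx x : sep x x = fset0.
Proof. by apply/fsetP => w; rewrite sepP eqxx inE. Qed.

Lemma sep_eq0 x y : sep x y = fset0 -> x = y.
Proof.
move=> xy0; apply/eqP; apply: contraT => /edge_toward[q [w [+ _]]].
by rewrite xy0 inE.
Qed.

Lemma sep_triangle x y z : sep x z `<=` sep x y `|` sep y z.
Proof.
apply/fsubsetP => w; rewrite inE !sepP.
by case: (o x w) (o y w) (o z w) => [] [] [].
Qed.

Lemma card_sep_triangle x y z : (#|` sep x z| <= #|` sep x y| + #|` sep y z|)%N.
Proof.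
apply: leq_trans (fsubset_leq_card (sep_triangle x y z)) _.
by rewrite cardfsU leq_subr.
Qed.

Lemma adj_o p q w u : sep p q = [fset w] -> o q u = (u == w) (+) o p u.
Proof.
move=> pq; have := sepP p q u; rewrite pq inE.
by case: (u == w) (o p u) (o q u) => [] [] [].
Qed.

Lemma card_sep_step p q w z : sep p q = [fset w] -> w \in sep p z ->
  #|` sep p z| = #|` sep q z|.+1.
Proof.
move=> pq wz; rewrite (cardfsD1 w) wz add1n; congr (_.+1); congr (size _).
suff -> : sep p z `\ w = sep q z by [].
apply/fsetP => u; rewrite !inE !sepP (adj_o u pq).
have [->|] := eqVneq u w; last by [].
by move: wz; rewrite sepP; case: (o p w) (o z w) => [] [].
Qed.

(* Take an edge towards [y].  If its wall [u] does not separate [x] from [z],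
   then at its other end both [u] and an edge given by induction point towards
   [z]; they span a square, whose side at [x] is the required edge. *)
Lemma common_edge x y z w : w \in sep x y -> w \in sep x z ->
  exists q u, [/\ u \in sep x y, u \in sep x z & sep x q = [fset u]].
Proof.
have [n] := ubnP #|` sep x y|; elim: n x w => // n IHn x w.
rewrite ltnS => len wxy wxz.
have [/edge_toward[q [u [uxy xq]]]|xy] := boolP (x != y); last first.
  by move: wxy; rewrite (eqP (negbNE xy)) sepxx inE.
have [uxz|uxz] := boolP (u \in sep x z); first by exists q, u.
have wu : w != u by apply: contraNneq uxz => <-.
have [|||q2 [v [vqy vqz qq2]]] := IHn q w.
- by rewrite -ltnS -(card_sep_step xq uxy) ltnS.
- by rewrite sepP (adj_o w xq) (negPf wu) -sepP.
- by rewrite sepP (adj_o w xq) (negPf wu) -sepP.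
have vu : v != u.
  apply: contraTneq vqy => ->; move: uxy; rewrite !sepP (adj_o u xq) eqxx.
  by case: (o x u) (o y u) => [] [].
have ovx t : (v \in sep x t) = (v \in sep q t).
  by rewrite !sepP (adj_o v xq) (negPf vu).
have [||||t xt] := square (p := q) (z := z) (q1 := x) (w1 := u) _ qq2.
- by rewrite sepC.
- by rewrite eq_sym.
- move: uxz; rewrite !sepP (adj_o u xq) eqxx.
  by case: (o x u) (o z u) => [] [].
- by [].
by exists t, v; rewrite !ovx.
Qed.

(** Crossing a wall that separates [x] from both [y] and [z] does not change the majority, and
    [common_edge] supplies such a step as long as there is such a wall. When there is none, [x]
    itself is the median. *)
Lemma median_exists x y z : exists t, forall w, o t w = maj (o x w) (o y w) (o z w).
Proof.
have [n] := ubnP #|` sep x y|; elim: n x => // n IHn x; rewrite ltnS => len.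
have [[w [wxy wxz]]|no] := pselect (exists w, w \in sep x y /\ w \in sep x z).
  have [q [u [uxy uxz xq]]] := common_edge wxy wxz.
  have [|t tP] := IHn q; first by rewrite -ltnS -(card_sep_step xq uxy) ltnS.
  exists t => v; rewrite tP (adj_o v xq); have [->|//] := eqVneq v u.
  by move: uxy uxz; rewrite !sepP; case: (o x u) (o y u) (o z u) => [] [] [].
exists x => w; apply/eqP; apply: contraT => xw; case: no; exists w.
by move: xw; rewrite !sepP; case: (o x w) (o y w) (o z w) => [] [] [].
Qed.

Definition med x y z := projT1 (cid (median_exists x y z)).

Lemma medP x y z w : o (med x y z) w = maj (o x w) (o y w) (o z w).
Proof. by rewrite /med; case: cid. Qed.

Lemma med_between1 x y z : sep x (med x y z) `<=` sep x y.
Proof.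
apply/fsubsetP => w; rewrite !sepP medP.
by case: (o x w) (o y w) (o z w) => [] [] [].
Qed.

Lemma med_between2 x y z : sep x (med x y z) `<=` sep x z.
Proof.
apply/fsubsetP => w; rewrite !sepP medP.
by case: (o x w) (o y w) (o z w) => [] [] [].
Qed.

Lemma medCA x y z : med x y z = med y x z.
Proof.
apply: sep_eq0; apply/fsetP => w; rewrite sepP !medP in_fset0.
by case: (o x w) (o y w) (o z w) => [] [] [].
Qed.

(** Equality in the triangle inequality forces [sep x y] to be the disjoint union of [sep x t] and
    [sep t y]. This links the metric betweenness of the counting argument to inclusion of wall
    sets. *)
Lemma between_card x t y :
  (#|` sep x t| + #|` sep t y| == #|` sep x y|)%N = (sep x t `<=` sep x y).
Proof.
have I0 : sep x t `<=` sep x y -> sep x t `&` sep t y = fset0.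
  move=> /fsubsetP sub; apply/fsetP => w; rewrite !inE.
  apply/negP => /andP[/[dup]/sub]; rewrite !sepP.
  by case: (o x w) (o y w) (o t w) => [] [] [].
apply/idP/idP => [/eqP E|sub].
  have : sep x y = sep x t `|` sep t y.
    apply/eqP; rewrite eqEfcard sep_triangle /= -E.
    by rewrite cardfsU leq_subr.
  by move=> ->; rewrite fsubsetUl.
rewrite eqn_leq card_sep_triangle andbT.
have -> : sep x y = sep x t `|` sep t y.
  apply/eqP; rewrite eqEfsubset sep_triangle fsubUset sub /=.
  apply/fsubsetP => w; have /fsubsetP/(_ w)/implyP := sub; rewrite !sepP.
  by case: (o x w) (o y w) (o t w) => [] [] [].
by rewrite cardfsU I0// cardfs0 subn0.
Qed.

(** * Join-irreducible elements of an interval *)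

Section Interval.
Variables x z : V.

(** In the interval from [x] to [z], ordered by inclusion of [sep x], the median [med z u g] is the
    join of [u] and [g]: a wall of [sep x z] already has [z] on its far side, so the majority acts
    as a disjunction. *)
Lemma join_sep u g w : sep x u `<=` sep x z -> sep x g `<=` sep x z ->
  (w \in sep x (med z u g)) = (w \in sep x u) || (w \in sep x g).
Proof.
move=> /fsubsetP/(_ w)/implyP + /fsubsetP/(_ w)/implyP; rewrite !sepP medP.
by case: (o x w) (o u w) (o z w) (o g w) => [] [] [] [].
Qed.

Lemma joins_exists (gs : seq V) : (forall g, g \in gs -> sep x g `<=` sep x z) ->
  exists t, forall w, (w \in sep x t) = has (fun g => w \in sep x g) gs.
Proof.
elim: gs => [|g gs IH] H; first by exists x => w; rewrite sepxx.
have [|t tP] := IH; first by move=> h hgs; apply: H; rewrite inE hgs orbT.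
exists (med z g t) => w; rewrite join_sep /= ?tP//; first by apply: H; rewrite mem_head.
apply/fsubsetP => u; rewrite tP => /hasP[h hgs]; apply/fsubsetP/H.
by rewrite inE hgs orbT.
Qed.

(* The join-irreducible elements of the interval from [x]: [g] is the gate of
   the wall [w], the least vertex beyond [w]. *)
Definition gate g w := w \in sep x g /\
  forall g', sep x g' `<=` sep x g -> w \in sep x g' -> g' = g.

Lemma gate_exists t w : w \in sep x t ->
  exists2 g, gate g w & sep x g `<=` sep x t.
Proof.
have [n] := ubnP #|` sep x t|; elim: n t => // n IHn t; rewrite ltnS => len wt.
have [[g [gt wg ngt]]|no] :=
    pselect (exists g, [/\ sep x g `<=` sep x t, w \in sep x g & g != t]).
  have [|h hw hg] := IHn g _ wg; last by exists h => //; apply: fsubset_trans hg gt.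
  apply: leq_trans len; apply: fproper_ltn_card; rewrite fproperEneq gt andbT.
  apply: contra ngt => /eqP E; apply/eqP/sep_eq0/fsetP => u.
  have := congr1 (fun s => u \in s) E; rewrite !inE !sepP.
  by case: (o x u) (o g u) (o t u) => [] [] [].
exists t => //; split=> // g gt wg; apply/eqP; apply: contraT => ngt.
by case: no; exists g.
Qed.

Lemma sep_inj g h : sep x g = sep x h -> g = h.
Proof.
move=> E; apply: sep_eq0; apply/fsetP => u.
have := congr1 (fun s => u \in s) E; rewrite !inE !sepP.
by case: (o x u) (o g u) (o h u) => [] [] [].
Qed.

(** An edge from [g] towards [x] crossing a wall other than [w] would lead to a smaller vertex still
    beyond [w], against minimality. *)
Lemma gate_edge g w : gate g w ->
  exists2 q, sep g q = [fset w] & sep x q = sep x g `\ w.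
Proof.
move=> [wg gmin]; have [/edge_toward[q [u [ugx gq]]]|xg] := boolP (g != x); last first.
  by move: wg; rewrite (eqP (negbNE xg)) sepxx inE.
have E : sep x q = sep x g `\ u.
  apply/fsetP => v; rewrite !inE !sepP (adj_o v gq).
  have [->|//] := eqVneq v u; move: ugx; rewrite sepP.
  by case: (o x u) (o g u) => [] [].
suff uw : u = w by exists q; rewrite -?uw.
apply/eqP; apply: contraT => uw; have := gmin q.
rewrite E fsubsetDl !inE eq_sym uw wg => /(_ isT isT) qg.
by move: gq; rewrite qg sepxx => /fsetP/(_ u); rewrite !inE eqxx.
Qed.

(** The median of [x], [g], [h] lies below [g] and beyond [v], so it is [g] by minimality. Hence [g]
    lies below [h], and both are at the same distance from [x]. *)
Lemma gate_notin g h v : gate g v -> sep x g `<=` sep x z ->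
  #|` sep x g| = #|` sep x h| -> v \in sep x h -> g = h.
Proof.
move=> [vg gmin] gz gh vh; apply: sep_inj.
have E : med x g h = g.
  apply: gmin; first exact: med_between1.
  by move: vg vh; rewrite !sepP medP; case: (o x v) (o g v) (o h v) => [] [] [].
by apply/eqP; rewrite eqEfcard gh leqnn andbT -{1}E med_between2.
Qed.

(** Distinct gates of one level have distinct walls by [gate_notin]. At the join [t] of the gates,
    each of these walls is crossed by an edge leading towards [x], so [dim_bound] applies at [t]. *)
Lemma gates_level j (gs : seq V) : uniq gs ->
  (forall g, g \in gs -> [/\ exists w, gate g w, sep x g `<=` sep x z
     & #|` sep x g| = j]) ->
  size gs <= N.
Proof.
move=> ugs gsP.
have [ps psE psP] : exists2 ps : seq (V * W), map fst ps = gs &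
    forall p, p \in ps -> gate p.1 p.2.
  elim: gs gsP {ugs} => [|g gs IH] gsP; first by exists [::].
  have [|ps psE psP] := IH; first by move=> h hgs; apply: gsP; rewrite inE hgs orbT.
  have [[w gw] _ _] := gsP g (mem_head _ _).
  exists ((g, w) :: ps); first by rewrite /= psE.
  by move=> p; rewrite inE => /orP[/eqP->|/psP].
have mem1 p : p \in ps -> p.1 \in gs by move=> pps; rewrite -psE map_f.
have uw : uniq (map snd ps).
  rewrite map_inj_in_uniq; first by apply: (map_uniq (f := fst)); rewrite psE.
  move=> [g v] [h w] gp hp /= vw; congr pair => //.
  have [_ gz gj] := gsP _ (mem1 _ gp); have [_ hz hj] := gsP _ (mem1 _ hp).
  apply: (gate_notin (psP _ gp)) => //=; first by rewrite gj hj.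
  by rewrite vw; case: (psP _ hp).
have [|t tP] := @joins_exists gs; first by move=> g /gsP[].
rewrite -psE size_map -(size_map snd); apply: (dim_bound (p := t) (z := x) uw) => w.
move=> /mapP[[g v] gp ->] /=; have [vg gmin] := psP _ gp; rewrite /= in vg gmin.
have gin := mem1 _ gp; have [_ gz gj] := gsP _ gin; rewrite /= in gin gz gj.
have vt : v \in sep x t by rewrite tP; apply/hasP; exists g.
split; first by rewrite sepC.
have [q gq xq] := gate_edge (psP _ gp); rewrite /= in gq xq.
(* Replacing [g] by its lower neighbour [q] changes the join by the wall [v] only, since no other
   gate of this level lies beyond [v]. *)
have [|t' t'P] := @joins_exists (q :: rem g gs).
  move=> h; rewrite inE => /orP[/eqP->|/mem_rem/gsP[]//].
  by rewrite xq; apply: fsubset_trans gz; apply: fsubsetDl.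
exists t'; apply/fsetP => u; rewrite in_fset1.
have -> : (u \in sep t t') = ((u \in sep x t) != (u \in sep x t')).
  by rewrite !sepP; case: (o x u) (o t u) (o t' u) => [] [] [].
rewrite tP t'P /= (perm_has _ (perm_to_rem gin)) /= xq !inE.
have [->|uv /=] := eqVneq u v; last by rewrite eqxx.
rewrite vg /=; apply/negP/negP; apply/hasPn => h hrem; apply/negP => vh.
have [_ hz hj] := gsP _ (mem_rem hrem).
have gh : g = h by apply: (gate_notin (psP _ gp)) => //=; rewrite gj hj.
by move: hrem; rewrite -gh mem_rem_uniq// inE eqxx.
Qed.

Lemma gates_enum k : exists2 s : seq V, size s <= N * k &
  forall g w, gate g w -> sep x g `<=` sep x z -> #|` sep x g| <= k -> g \in s.
Proof.
elim: k => [|k [s ss sP]].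
  exists [::] => // g w [wg _] _; rewrite leqn0 cardfs_eq0 => /eqP E.
  by rewrite E inE in wg.
have [s' ss' s'P] := @bounded_enum _ (fun g => [/\ exists w, gate g w,
  sep x g `<=` sep x z & #|` sep x g| = k.+1]) N (@gates_level k.+1).
exists (s' ++ s); first by rewrite size_cat mulnS leq_add.
move=> g w gw gz; rewrite mem_cat leq_eqVlt => /orP[/eqP gk|gk].
  by rewrite s'P//; split => //; exists w.
by rewrite (sP g w)// orbT.
Qed.

(** For each wall crossed by an edge from [t] towards [x], take a gate below [t] beyond it;
    [dim_bound] allows at most [N] such walls. If the join [u] of these gates were not [t], an edge
    from [t] towards [u] would cross such a wall, yet [u] already lies beyond it. *)
Lemma join_of_gates t : exists2 gs : seq V, size gs <= N &
  (forall w, (w \in sep x t) = has (fun g => w \in sep x g) gs) /\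
  (forall g, g \in gs -> (exists w, gate g w) /\ sep x g `<=` sep x t).
Proof.
pose ws := [seq w <- enum_fset (sep x t) | `[< exists q, sep t q = [fset w] >]].
have wsN : size ws <= N.
  apply: (dim_bound (p := t) (z := x)); first by rewrite filter_uniq// fset_uniq.
  by move=> w; rewrite mem_filter => /andP[/asboolP ? ?]; rewrite sepC.
have [gs gsN [gsws gsP]] : exists2 gs : seq V, size gs <= size ws &
    (forall w, w \in ws -> exists2 g, g \in gs & w \in sep x g) /\
    (forall g, g \in gs -> (exists w, gate g w) /\ sep x g `<=` sep x t).
  have : forall w, w \in ws -> w \in sep x t by move=> w; rewrite mem_filter => /andP[].
  elim: ws {wsN} => [|w ws IH] wst; first by exists [::].
  have [|gs gsN [gsws gsP]] := IH; first by move=> v vws; apply: wst; rewrite inE vws orbT.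
  have [g gw gt] := gate_exists (wst w (mem_head _ _)).
  exists (g :: gs); first exact: gsN.
  split=> [v|h]; rewrite inE => /orP[/eqP->|].
  - by exists g; [exact: mem_head|case: gw].
  - by move=> /gsws[h hgs vh]; exists h => //; rewrite inE hgs orbT.
  - by split=> //; exists w.
  - exact: gsP.
exists gs; first exact: leq_trans wsN.
split=> // w.
have [u uP] : exists u, forall w, (w \in sep x u) = has (fun g => w \in sep x g) gs.
  elim: gs {gsN gsws} gsP => [|g gs IH] H; first by exists x => v; rewrite sepxx.
  have [|u uP] := IH; first by move=> h hgs; apply: H; rewrite inE hgs orbT.
  exists (med t g u) => v.
  have /fsubsetP/(_ v)/implyP := (H g (mem_head _ _)).2.
  have /implyP : v \in sep x u -> v \in sep x t.
    rewrite uP => /hasP[h hgs]; apply/fsubsetP.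
    by apply: (H h _).2; rewrite inE hgs orbT.
  rewrite /= -uP !sepP medP.
  by case: (o x v) (o g v) (o t v) (o u v) => [] [] [] [].
rewrite -uP; have [tu|/edge_toward[q [v [vtu tq]]]] := eqVneq t u; first by rewrite tu.
have ut : sep x u `<=` sep x t.
  apply/fsubsetP => v'; rewrite uP => /hasP[g /gsP[_ /fsubsetP]]; exact.
have : v \in ws.
  rewrite mem_filter; apply/andP; split; first by apply/asboolP; exists q.
  have /fsubsetP/(_ v)/implyP := ut; move: vtu; rewrite !sepP.
  by case: (o x v) (o t v) (o u v) => [] [] [].
move=> /gsws[g ggs vg]; have vu : v \in sep x u by rewrite uP; apply/hasP; exists g.
have /fsubsetP/(_ v vu) := ut; move: vtu vu; rewrite !sepP.
by case: (o x v) (o t v) (o u v) => [] [] [].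
Qed.

(** The vertices in question are joins of at most [N] out of at most [N * k] gates. Adding [x], the
    empty join, to the list allows for fewer factors, whence the base [(N * k).+1]. *)
Lemma interval_enum k : exists2 s : seq V, size s <= (N * k).+1 ^ N &
  forall t, sep x t `<=` sep x z -> #|` sep x t| <= k -> t \in s.
Proof.
have [I sI IP] := gates_enum k.
have H n : exists2 s : seq V, size s <= (N * k).+1 ^ n &
    forall t (gs : seq V), size gs <= n -> (forall g, g \in gs -> g \in I) ->
      (forall g, g \in gs -> sep x g `<=` sep x z) ->
      (forall w, (w \in sep x t) = has (fun g => w \in sep x g) gs) -> t \in s.
  elim: n => [|n [s ss sP]].
    exists [:: x] => // t gs; rewrite leqn0 size_eq0 => /eqP-> _ _ tP.
    by rewrite inE; apply/eqP/sep_inj/fsetP => w; rewrite tP sepxx.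
  exists [seq med z u g | u <- s, g <- x :: I].
    by rewrite size_allpairs expnSr leq_mul.
  move=> t [|g gs] sgs gI gz tP.
    have -> : t = med z x x.
      apply: sep_inj; apply/fsetP => w.
      by rewrite join_sep ?sepxx ?fsub0set// tP inE.
    apply/allpairsP; exists (x, x); split=> //=; last exact: mem_head.
    by apply: (sP x [::]) => // w; rewrite sepxx.
  have [|u uP] := @joins_exists gs.
    by move=> h hgs; apply: gz; rewrite inE hgs orbT.
  have uz : sep x u `<=` sep x z.
    apply/fsubsetP => w; rewrite uP => /hasP[h hgs]; apply/fsubsetP/gz.
    by rewrite inE hgs orbT.
  have -> : t = med z u g.
    apply: sep_inj; apply/fsetP => w; rewrite join_sep ?(gz g (mem_head _ _))//.
    by rewrite tP /= -uP orbC.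
  apply/allpairsP; exists (u, g); split=> //=; last by rewrite inE gI ?mem_head ?orbT.
  by apply: (sP u gs) => // h hgs; [apply: gI|apply: gz]; rewrite inE hgs orbT.
have [s ss sP] := H N.
exists s => // t tz tk; have [gs gsN [tP gsP]] := join_of_gates t.
apply: (sP t gs) => // g /gsP[[w gw] gt].
  apply: (IP g w gw); first exact: fsubset_trans tz.
  exact: leq_trans (fsubset_leq_card gt) tk.
exact: fsubset_trans tz.
Qed.

End Interval.
End WallSpace.

Import Order.TTheory GRing.Theory Num.Theory.

(** * Counting with an invariant mean *)

Lemma card_fibers_le (I : finType) (V : eqType) (P : pred I) (f : I -> V)
    (s : seq V) (k : nat) :
  (forall i, P i -> f i \in s) ->
  (forall v, #|[pred i | P i & f i == v]| <= k) -> #|P| <= size s * k.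
Proof.
elim: s P => [|v s IH] P Ps Pk.
  by rewrite leqn0; apply/eqP/eq_card0 => i; apply/negP => /Ps.
rewrite -(cardID [pred i | f i == v] P) mulSn leq_add//.
  by rewrite (leq_trans _ (Pk v))//; apply/subset_leq_card/fintype.subsetP => i.
apply: (leq_trans _ (IH [pred i | P i & f i != v] _ _)).
- by apply/subset_leq_card/fintype.subsetP => i; rewrite !inE andbC.
- by move=> i /= /andP[/Ps]; rewrite inE => /orP[->//|].
move=> u; apply: leq_trans (Pk u); apply/subset_leq_card/fintype.subsetP => i.
by rewrite !inE => /andP[/andP[-> _] ->].
Qed.

Section Mean.
Local Open Scope ring_scope.
Variables (R : realType) (G : groupType) (m : (G -> R) -> R).
Hypothesis m_linear : forall (a : R) f g, bounded f -> bounded g ->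
  m (fun x => a * f x + g x) = a * m f + m g.
Hypothesis m_ge0 : forall f, bounded f -> (forall x, 0 <= f x) -> 0 <= m f.
Hypothesis m1 : m (fun=> 1) = 1.

Lemma bounded_cst (a : R) : bounded ((fun=> a) : G -> R).
Proof. by exists `|a|. Qed.

Lemma bounded_sum (I : finType) (f : I -> G -> R) : (forall i, bounded (f i)) ->
  bounded (fun x => \sum_i f i x).
Proof.
move=> /choice[M MP]; exists (\sum_i M i) => x.
by apply: le_trans (ler_norm_sum _ _ _) _; apply: ler_sum => i _; apply: MP.
Qed.

Lemma mean0 : m (fun=> 0) = 0.
Proof.
have := m_linear 1 (bounded_cst 0) (bounded_cst 0).
under eq_fun do rewrite mulr0 addr0.
by rewrite mul1r => /eqP; rewrite addrC -subr_eq subrr => /eqP.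
Qed.

Lemma mean_cst a : m (fun=> a) = a.
Proof.
have := m_linear a (bounded_cst 1) (bounded_cst 0).
under eq_fun do rewrite mulr1 addr0.
by rewrite m1 mean0 mulr1 addr0.
Qed.

Lemma mean_add f g : bounded f -> bounded g ->
  m (fun x => f x + g x) = m f + m g.
Proof.
move=> bf bg; have := m_linear 1 bf bg; rewrite mul1r => <-.
by congr m; apply/funext => x; rewrite mul1r.
Qed.

Lemma mean_sum (I : finType) (f : I -> G -> R) : (forall i, bounded (f i)) ->
  m (fun x => \sum_i f i x) = \sum_i m (f i).
Proof.
move=> bf.
suff H (s : seq I) : bounded (fun x => \sum_(i <- s) f i x) /\
    m (fun x => \sum_(i <- s) f i x) = \sum_(i <- s) m (f i) by case: (H (index_enum I)).
elim: s => [|i s [bs IH]].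
  under eq_fun do rewrite big_nil.
  by rewrite big_nil mean0; split=> //; apply: bounded_cst.
under eq_fun do rewrite big_cons.
rewrite big_cons mean_add// IH; split=> //.
have [M MP] := bf i; have [K KP] := bs; exists (M + K) => x.
by apply: le_trans (ler_normD _ _) _; apply: lerD.
Qed.

Lemma mean_le f C : bounded f -> (forall x, f x <= C) -> m f <= C.
Proof.
move=> bf fC; have := m_linear (-1) bf (bounded_cst C).
rewrite mean_cst mulN1r => E; rewrite -subr_ge0 addrC -E; apply: m_ge0.
  have [M MP] := bf; exists (M + `|C|) => x; rewrite mulN1r.
  by apply: le_trans (ler_normD _ _) _; rewrite normrN lerD2r.
by move=> x; rewrite mulN1r addrC subr_ge0.
Qed.

End Mean.

(** * Charging pairs of group elements to medians *)

Section Counting.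
Variables (R : realType) (G : groupType) (V : choiceType).
Variables (act : G -> V -> V) (d : V -> V -> nat) (med : V -> V -> V -> V).
Variables (x0 : V) (c r B : nat).
Hypothesis act1 : forall x, act 1%g x = x.
Hypothesis actM : forall g h x, act (g * h)%g x = act g (act h x).
Hypothesis dC : forall x y, d x y = d y x.
Hypothesis d_act : forall g x y, d (act g x) (act g y) = d x y.
Let btw x t y := d x t + d t y == d x y.
Hypothesis med_btw : forall x y z,
  [/\ btw x (med x y z) y, btw x (med x y z) z & btw y (med x y z) z].
Hypothesis stab : forall v (s : seq G), uniq s ->
  (forall g, g \in s -> act g v = v) -> size s <= c.
Hypothesis interval : forall x z, exists2 s : seq V, size s <= B &
  forall t, btw x t z -> d x t <= r -> t \in s.

Hypothesis B_gt0 : 0 < B.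

Lemma btwC x t y : btw x t y = btw y t x.
Proof. by rewrite /btw addnC (dC x t) (dC t y) (dC x y). Qed.

Lemma stab_gt0 : 0 < c.
Proof. by apply: (@stab x0 [:: 1%g]) => // g; rewrite inE => /eqP->. Qed.

(** Composing with the inverse of one such element embeds them into the stabilizer of [t]. *)
Lemma transporter_card (I : finType) (h : I -> G) (P : pred I) (t u : V) :
  injective h -> (forall i, P i -> act (h i) t = u) -> #|P| <= c.
Proof.
move=> hinj hP; have [i0 Pi0|P0] := pickP P; last by rewrite eq_card0.
pose s := [seq ((h i0)^-1 * h i)%g | i <- enum P].
suff : size s <= c by rewrite size_map -cardE.
apply: (@stab t); first by rewrite map_inj_uniq ?enum_uniq// => i j /monoid.mulgI/hinj.
move=> g /mapP[i]; rewrite mem_enum => Pi ->.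
by rewrite actM (hP i Pi) -(hP i0 Pi0) -actM monoid.mulVg act1.
Qed.

Section Family.
Variables (I : finType) (a : I -> G).
Hypothesis ainj : injective a.
Hypothesis ar : forall i, d x0 (act (a i) x0) <= r.

(* The pair [(h, i)] stands for an edge from [p h] to [p (a i * h)], charged to
   the median [tt h i]; it is light if at most [lam] of the edges leaving [p h]
   are charged to the same median, and heavy otherwise. *)
Let p (h : G) := act h^-1 x0.
Let tt h i := med x0 (p h) (p (a i * h)).
Let cnt h t := #|[pred i | tt h i == t]|.

Lemma d_step h i : d (p h) (p (a i * h)) <= r.
Proof.
rewrite /p -(d_act h) -!actM monoid.mulgV act1 monoid.invgM monoid.mulgA.
rewrite monoid.mulgV monoid.mul1g.
by rewrite -(d_act (a i)) -actM monoid.mulgV act1 dC.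
Qed.

Lemma ttP h i : [/\ btw (p h) (tt h i) x0, d (p h) (tt h i) <= r,
  btw (p (a i * h)) (tt h i) x0, d (p (a i * h)) (tt h i) <= r &
  btw (p h) (tt h i) (p (a i * h))].
Proof.
have [b1 b2 b3] := med_btw x0 (p h) (p (a i * h)); have := d_step h i.
rewrite -/(tt h i) in b1 b2 b3 * => dr; split=> //.
- by rewrite btwC.
- by apply: leq_trans dr; rewrite -(eqP b3) leq_addr.
- by rewrite btwC.
- by apply: leq_trans dr; rewrite -(eqP b3) dC leq_addl.
Qed.

(** The medians charged from [p h] lie between [p h] and [x0] within distance [r] of [p h], so they
    take at most [B] values, and each value accounts for at most [lam] light edges. *)
Lemma light_card h lam :
  #|[pred i | cnt h (tt h i) <= lam]| <= B * lam.
Proof.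
have [s sB sP] := interval (p h) x0.
apply: (@leq_trans (size s * lam)); last by rewrite leq_mul2r sB orbT.
apply: (@card_fibers_le _ _ _ (tt h)).
  by move=> i _; have [? ? _ _ _] := ttP h i; apply: sP.
move=> t; have [/existsP[i /andP[/= il /eqP it]]|no] :=
    boolP [exists i, (cnt h (tt h i) <= lam) && (tt h i == t)].
  apply: leq_trans il; rewrite it; apply/subset_leq_card/fintype.subsetP => j.
  by rewrite !inE => /andP[].
rewrite eq_card0// => i; apply: contraNF no => H; apply/existsP; exists i.
by move: H; rewrite inE.
Qed.

(** Double counting of the pairs [(i, j)] such that the [i]-th and the [j]-th edge from the tail
    [hh i] are both charged to [t]. A heavy [i] has more than [lam] partners. For fixed [j], the
    element [hh i] moves [t] into the interval from [x0] to [(a j)^-1 x0], near [x0]; this leaves at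
    most [B] images, each obtained from at most [c] indices. *)
Lemma incoming_card h' t lam :
  #|[pred i | (lam < cnt ((a i)^-1 * h')%g (tt ((a i)^-1 * h')%g i)) &
      tt ((a i)^-1 * h')%g i == t]| * lam <= #|I| * (B * c).
Proof.
set K := [pred i | _ & _]; pose hh i := ((a i)^-1 * h')%g.
have hinj : injective hh by move=> i j /monoid.mulIg/monoid.invg_inj/ainj.
have -> : #|I| * (B * c) = \sum_(j : I) B * c by rewrite sum_nat_const.
apply: (@leq_trans (\sum_(j : I) #|[pred i | K i & tt (hh i) j == t]|)).
  have -> : \sum_(j : I) #|[pred i | K i & tt (hh i) j == t]| =
      \sum_(i in K) cnt (hh i) t.
    under eq_bigr do rewrite -sum1_card.
    rewrite (exchange_big_dep (mem K)) /=; last by move=> i j _ /andP[].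
    apply: eq_bigr => i iK; rewrite /cnt -sum1_card; apply: eq_bigl => j.
    by rewrite !inE; move: iK; rewrite !inE => ->.
  rewrite -sum_nat_const; apply: leq_sum => i; rewrite !inE => /andP[lt /eqP <-].
  exact: ltnW.
apply: leq_sum => j _; have [s sB sP] := interval x0 (act (a j)^-1 x0).
apply: (@leq_trans (size s * c)); last by rewrite leq_mul2r sB orbT.
apply: (@card_fibers_le _ _ _ (fun i => act (hh i) t)) => [i|u].
  move=> /andP[_ /eqP <-]; have [_ b2 _ _ b5] := ttP (hh i) j.
  have E : act (hh i) (p (hh i)) = x0 by rewrite /p -actM monoid.mulgV act1.
  apply: sP; last by rewrite -{1}E d_act.
  move: b5; rewrite /btw -(d_act (hh i)) E -[d (tt _ _) _](d_act (hh i)).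
  rewrite -[d (p _) (p _)](d_act (hh i)) E /p -!actM monoid.invgM monoid.mulgA.
  by rewrite monoid.mulgV monoid.mul1g.
by apply: (@transporter_card _ hh _ t u hinj) => i /andP[_ /eqP].
Qed.

(** The medians of the edges entering [p h'] lie between [p h'] and [x0] within distance [r] of
    [p h']: at most [B] values, each treated by [incoming_card]. *)
Lemma heavy_card h' lam :
  #|[pred i | lam < cnt ((a i)^-1 * h')%g (tt ((a i)^-1 * h')%g i)]| * lam
    <= B * (#|I| * (B * c)).
Proof.
have [s sB sP] := interval (p h') x0.
have [->|lam0] := eqVneq lam 0; first by rewrite muln0.
set M := #|I| * (B * c) %/ lam.
suff H : #|[pred i | lam < cnt ((a i)^-1 * h')%g (tt ((a i)^-1 * h')%g i)]| <= size s * M.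
  apply: (@leq_trans (B * M * lam)).
    by rewrite leq_mul2r (leq_trans H)// ?leq_mul2r ?sB !orbT.
  by rewrite -mulnA leq_mul2l leq_divM orbT.
apply: (@card_fibers_le _ _ _ (fun i => tt ((a i)^-1 * h')%g i)) => [i _|t].
  have [_ _ + + _] := ttP ((a i)^-1 * h')%g i.
  by rewrite monoid.mulgA monoid.mulgV monoid.mul1g => ? ?; apply: sP.
by rewrite /M leq_divRL ?lt0n// incoming_card.
Qed.

End Family.

Local Open Scope ring_scope.
Variable m : (G -> R) -> R.
Hypothesis m_linear : forall (a : R) f g, bounded f -> bounded g ->
  m (fun x => a * f x + g x) = a * m f + m g.
Hypothesis m_ge0 : forall f, bounded f -> (forall x, 0 <= f x) -> 0 <= m f.
Hypothesis m1 : m (fun=> 1) = 1.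
Hypothesis m_inv : forall (g : G) f, bounded f -> m (fun x => f (g * x)%g) = m f.

(** On average over [h], at most [B * lam] of the edges leaving [p h] are light. By invariance the
    heavy ones may be counted where they enter, and there they are at most half of [#|I|]. Hence
    [#|I| <= 2 * (B * lam)]. *)
Lemma family_card (I : finType) (a : I -> G) : injective a ->
  (forall i, (d x0 (act (a i) x0) <= r)%N) -> (#|I| <= 4 * c * B ^ 3)%N.
Proof.
move=> ainj ar.
pose p h := act h^-1 x0; pose tt h i := med x0 (p h) (p (a i * h)%g).
pose cnt h t := #|[pred i | tt h i == t]|.
(* With this threshold the bound of [heavy_card], divided by [lam], is [#|I| / 2]. *)
pose lam := (2 * B * (B * c))%N.
pose phi i h : R := (cnt h (tt h i) <= lam)%N%:R.
pose psi i h : R := (lam < cnt h (tt h i))%N%:R.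
have bb (b : G -> bool) : bounded (fun h => (b h)%:R : R).
  by exists 1 => x; case: (b x); rewrite ?normr1// normr0.
have bN (f : I -> G -> bool) h : \sum_i ((f i h)%:R : R) = #|[pred i | f i h]|%:R.
  by rewrite -sum1_card natr_sum [RHS]big_mkcond; apply: eq_bigr => i _; rewrite inE; case: (f i h).
have E : #|I|%:R = m (fun h => \sum_i phi i h) + m (fun h => \sum_i psi i ((a i)^-1 * h)%g).
  rewrite !(mean_sum m_linear); try by move=> i; apply: bb.
  rewrite -big_split /= -sum1_card natr_sum; apply: eq_bigr => i _.
  have -> : m (fun h => psi i ((a i)^-1 * h)%g) = m (psi i).
    by rewrite -(m_inv (a i)^-1%g (bb (fun h => (lam < cnt h (tt h i))%N))).
  rewrite -(mean_add m_linear); try exact: bb.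
  rewrite -m1; congr m; apply/funext => h; rewrite /phi /psi ltnNge.
  by case: (_ <= _)%N; rewrite ?addr0 ?add0r.
have le1 : m (fun h => \sum_i phi i h) <= (B * lam)%:R.
  apply: (mean_le m_linear m_ge0 m1) => [|h]; first by apply: bounded_sum => i; apply: bb.
  by rewrite (bN (fun i h => (cnt h (tt h i) <= lam)%N)) ler_nat; apply: light_card.
have le2 : (2 * m (fun h => \sum_i psi i ((a i)^-1 * h)%g) <= #|I|%:R).
  rewrite mulrC -ler_pdivlMr ?ltr0n//.
  apply: (mean_le m_linear m_ge0 m1) => [|h]; first by apply: bounded_sum => i; apply: bb.
  rewrite (bN (fun i h => lam < cnt ((a i)^-1 * h)%g (tt ((a i)^-1 * h)%g i))%N).
  rewrite ler_pdivlMr ?ltr0n// -natrM ler_nat.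
  have := @heavy_card _ a ainj ar h lam.
  rewrite -/p -/tt -/cnt /lam; set K := #|_|; have := stab_gt0.
  move: B_gt0 K => B0 K c0 H.
  rewrite -(@leq_pmul2r (B * (B * c))) ?muln_gt0 ?B0 ?c0//.
  have -> : (K * 2 * (B * (B * c)) = K * (2 * B * (B * c)))%N by ring.
  by have -> : (#|I| * (B * (B * c)) = B * (#|I| * (B * c)))%N by ring.
have : (#|I|%:R : R) <= (4 * c * B ^ 3)%:R.
  have -> : (4 * c * B ^ 3)%N = (2 * (B * lam))%N by rewrite /lam; ring.
  rewrite natrM; lra.
by rewrite ler_nat.
Qed.

End Counting.

Local Open Scope classical_set_scope.
Local Open Scope ring_scope.

(** * Isometries of cubes are signed permutations *)

Section L2.
Variables (R : realType) (I : finType) (P : pred I).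
Implicit Types u v : I -> R.

Definition l2 u : R := Num.sqrt (\sum_(i | P i) u i ^+ 2).

Lemma sumsq_ge0 u : 0 <= \sum_(i | P i) u i ^+ 2.
Proof. by apply: sumr_ge0 => i _; apply: sqr_ge0. Qed.

Lemma l2_ge0 u : 0 <= l2 u. Proof. exact: sqrtr_ge0. Qed.

Lemma sqr_l2 u : l2 u ^+ 2 = \sum_(i | P i) u i ^+ 2.
Proof. by rewrite sqr_sqrtr// sumsq_ge0. Qed.

Lemma sumsq_eq0 u : \sum_(i | P i) u i ^+ 2 = 0 -> forall i, P i -> u i = 0.
Proof.
move=> /psumr_eq0P H i Pi; apply/eqP; rewrite -sqrf_eq0; apply/eqP/H => // j _.
exact: sqr_ge0.
Qed.

Lemma cauchy_schwarz u v :
  (\sum_(i | P i) u i * v i) ^+ 2 <=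
  (\sum_(i | P i) u i ^+ 2) * (\sum_(i | P i) v i ^+ 2).
Proof.
set A := \sum_(i | P i) u i ^+ 2; set B := \sum_(i | P i) v i ^+ 2.
set C := \sum_(i | P i) _.
have [B0|B0] := eqVneq B 0.
  suff -> : C = 0 by rewrite B0 mulr0 expr0n.
  by apply: big1 => i Pi; rewrite (sumsq_eq0 B0 Pi) mulr0.
have Bp : 0 < B by rewrite lt_def B0 sumsq_ge0.
have : 0 <= \sum_(i | P i) (B * u i - C * v i) ^+ 2.
  by apply: sumr_ge0 => i _; apply: sqr_ge0.
have -> : \sum_(i | P i) (B * u i - C * v i) ^+ 2 = B * (A * B - C ^+ 2).
  transitivity (\sum_(i | P i) (B ^+ 2 * u i ^+ 2 + (- (2 * B * C)) * (u i * v i)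
    + C ^+ 2 * v i ^+ 2)); first by apply: eq_bigr => i _; ring.
  by rewrite !big_split /= -!mulr_sumr -/A -/B -/C; ring.
by rewrite pmulr_rge0// subr_ge0.
Qed.

Lemma l2_triangle u v : l2 (fun i => u i + v i) <= l2 u + l2 v.
Proof.
rewrite -(@ler_pXn2r _ 2)// ?nnegrE ?addr_ge0 ?l2_ge0//.
rewrite sqrrD !sqr_l2.
have -> : \sum_(i | P i) (u i + v i) ^+ 2 = \sum_(i | P i) u i ^+ 2 +
   (\sum_(i | P i) u i * v i) *+ 2 + \sum_(i | P i) v i ^+ 2.
  by rewrite -sumrMnl -!big_split; apply: eq_bigr => i _; rewrite sqrrD.
rewrite lerD2r lerD2l lerMn2r /=; apply: le_trans (ler_norm _) _.
rewrite -(@ler_pXn2r _ 2)// ?nnegrE ?mulr_ge0 ?l2_ge0//.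
by rewrite real_normK ?num_real// exprMn !sqr_l2 cauchy_schwarz.
Qed.

Lemma l2N u : l2 (fun i => - u i) = l2 u.
Proof. by congr Num.sqrt; apply: eq_bigr => i _; rewrite sqrrN. Qed.

Lemma eq_l2 u v : (forall i, P i -> u i = v i) -> l2 u = l2 v.
Proof. by move=> uv; congr Num.sqrt; apply: eq_bigr => i /uv ->. Qed.

Lemma l2_dist u v : `|l2 u - l2 v| <= l2 (fun i => u i - v i).
Proof.
have H w t : l2 w - l2 t <= l2 (fun i => w i - t i).
  rewrite lerBlDr; apply: le_trans (l2_triangle _ _).
  by rewrite le_eqVlt; apply/orP; left; apply/eqP/eq_l2 => i _; rewrite subrK.
rewrite ler_norml lerNl opprB H andbT.
by apply: le_trans (H v u) _; rewrite -l2N le_eqVlt; apply/orP; left; apply/eqP/eq_l2 => i _; rewrite opprB.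
Qed.

End L2.

Section Edist.
Variable R : realType.

Lemma edistE n (x y : 'rV[R]_n) : edist x y = l2 xpredT (fun i => x 0 i - y 0 i).
Proof. by []. Qed.

Lemma edist_ge0 n (x y : 'rV[R]_n) : 0 <= edist x y. Proof. exact: sqrtr_ge0. Qed.

Lemma sqr_edist n (x y : 'rV[R]_n) : edist x y ^+ 2 = \sum_(i < n) (x 0 i - y 0 i) ^+ 2.
Proof. exact: sqr_l2. Qed.

Lemma edistC n (x y : 'rV[R]_n) : edist x y = edist y x.
Proof. by rewrite !edistE -l2N; apply: eq_l2 => i _; rewrite opprB. Qed.

Lemma edistxx n (x : 'rV[R]_n) : edist x x = 0.
Proof.
by apply/eqP; rewrite -sqrf_eq0 sqr_edist; apply/eqP/big1 => i _; rewrite subrr expr0n.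
Qed.

Lemma edist_triangle n (y x z : 'rV[R]_n) : edist x z <= edist x y + edist y z.
Proof.
rewrite !edistE; apply: le_trans (l2_triangle _ _ _).
by rewrite le_eqVlt; apply/orP; left; apply/eqP/eq_l2 => i _; rewrite addrA subrK.
Qed.

Lemma coord_le_edist n (x y : 'rV[R]_n) i : `|x 0 i - y 0 i| <= edist x y.
Proof.
rewrite -(@ler_pXn2r _ 2)// ?nnegrE ?edist_ge0// sqr_edist real_normK ?num_real//.
by rewrite (bigD1 i)//= lerDl sumr_ge0// => j _; apply: sqr_ge0.
Qed.

Lemma edist_eq0 n (x y : 'rV[R]_n) : edist x y = 0 -> x = y.
Proof.
move=> xy0; apply/rowP => i; apply/eqP; rewrite -subr_eq0 -normr_le0 -xy0.
exact: coord_le_edist.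
Qed.

Definition interp n (u : R) (a b : 'rV[R]_n) : 'rV[R]_n := (1 - u) *: a + u *: b.

Lemma edist_interp n (u v : R) (a b : 'rV[R]_n) :
  edist (interp u a b) (interp v a b) = `|u - v| * edist a b.
Proof.
apply/eqP; rewrite -(@eqrXn2 _ 2)// ?mulr_ge0 ?edist_ge0// exprMn.
rewrite real_normK ?num_real// !sqr_edist mulr_sumr; apply/eqP/eq_bigr => i _.
by rewrite /interp !mxE; ring.
Qed.

Lemma interp0 n (a b : 'rV[R]_n) : interp 0 a b = a.
Proof. by rewrite /interp subr0 scale1r scale0r addr0. Qed.

Lemma interp1 n (a b : 'rV[R]_n) : interp 1 a b = b.
Proof. by rewrite /interp subrr scale1r scale0r add0r. Qed.

Lemma interp_norm_le (u a b c : R) : 0 <= u <= 1 -> `|a| <= c -> `|b| <= c ->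
  `|(1 - u) * a + u * b| <= c.
Proof.
move=> /andP[u0 u1] ac bc; apply: le_trans (ler_normD _ _) _.
rewrite !normrM (ger0_norm u0) ger0_norm ?subr_ge0//.
have -> : c = (1 - u) * c + u * c by ring.
by apply: lerD; apply: ler_wpM2l; rewrite ?subr_ge0.
Qed.

Lemma cube_interp n (u : R) (a b : 'rV[R]_n) : 0 <= u <= 1 -> cube a -> cube b ->
  cube (interp u a b).
Proof. by move=> u01 ca cb i; rewrite !mxE; apply: interp_norm_le. Qed.

(** The triangle inequality in the plane, for bounds rather than norms; it adds up displacements in
    height and in the transverse direction along a path. *)
Lemma minkowski2 (a b c d l l' : R) : 0 <= l -> 0 <= l' ->
  a ^+ 2 + b ^+ 2 <= l ^+ 2 -> c ^+ 2 + d ^+ 2 <= l' ^+ 2 ->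
  (a + c) ^+ 2 + (b + d) ^+ 2 <= (l + l') ^+ 2.
Proof.
move=> l0 l'0 H H'.
have ll' : 0 <= l * l' by apply: mulr_ge0.
suff : a * c + b * d <= l * l' by nra.
have [ac0|ac0] := lerP (a * c + b * d) 0; first exact: le_trans ll'.
rewrite -(@ler_pXn2r _ 2)// ?nnegrE ?(ltW ac0)//.
have H1 : (a * c + b * d) ^+ 2 <= (a ^+ 2 + b ^+ 2) * (c ^+ 2 + d ^+ 2).
  have := sqr_ge0 (a * d - b * c); nra.
apply: (le_trans H1); rewrite exprMn; apply: ler_pM => //.
  by rewrite addr_ge0 ?sqr_ge0.
by rewrite addr_ge0 ?sqr_ge0.
Qed.

End Edist.

Section Faces.
Variable R : realType.

Definition sgb (b : bool) : R := if b then 1 else - 1.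

Lemma sgbK b (x : R) : sgb b * (sgb b * x) = x.
Proof. by case: b; rewrite /sgb; ring. Qed.

Lemma sgbM b c (x : R) : sgb b * (sgb c * x) = sgb (b == c) * x.
Proof. by case: b c => [] []; rewrite /sgb /=; ring. Qed.

Lemma sgbN b : sgb (~~ b) = - sgb b.
Proof. by case: b; rewrite /sgb /= ?opprK. Qed.

Lemma norm_sgb b (x : R) : `|sgb b * x| = `|x|.
Proof. by case: b; rewrite /sgb ?mul1r ?mulN1r ?normrN. Qed.

Lemma sqr_sgb b : sgb b ^+ 2 = 1.
Proof. by case: b; rewrite /sgb; ring. Qed.

Lemma inv2_gt0 : 0 < 2^-1 :> R. Proof. by rewrite invr_gt0 ltr0n. Qed.

Section Isometry.
Variables (m n : nat).

Definition mkpt (f : face_code m) (c : 'I_m -> R) : 'rV[R]_m :=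
  \row_i match f i with Some b => if b then 2^-1 else - 2^-1 | None => c i end.

Lemma mkpt_face (f : face_code m) c : (forall i, `|c i| <= 2^-1) -> face f (mkpt f c).
Proof. by move=> H i; rewrite mxE; case: (f i). Qed.

Lemma mkpt_free (f : face_code m) c i : f i = None -> mkpt f c 0 i = c i.
Proof. by rewrite mxE => ->. Qed.

Lemma face_edist (f : face_code m) (x y : 'rV[R]_m) : face f x -> face f y ->
  edist x y ^+ 2 = \sum_(i < m | f i == None) (x 0 i - y 0 i) ^+ 2.
Proof.
move=> fx fy; rewrite sqr_edist [RHS]big_mkcond; apply: eq_bigr => i _.
by have := fx i; have := fy i; case: (f i) => [b|] //= -> ->; rewrite subrr expr0n.
Qed.

Lemma face_coord (f : face_code m) (x : 'rV[R]_m) i : face f x -> `|x 0 i| <= 2^-1.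
Proof.
by move=> /(_ i); case: (f i) => [[]|//] ->; rewrite ?normrN ger0_norm// ltW// inv2_gt0.
Qed.

Lemma face_cube (f : face_code m) (x : 'rV[R]_m) : face f x -> cube x.
Proof. by move=> fx i; apply: face_coord fx. Qed.

End Isometry.

Lemma face_diam m (f : face_code m) (x y : 'rV[R]_m) : face f x -> face f y ->
  edist x y ^+ 2 <= #|[pred i | f i == None]|%:R.
Proof.
move=> fx fy; rewrite (face_edist fx fy) -sum1_card natr_sum; apply: ler_sum => i _.
have := face_coord i fx; have := face_coord i fy; rewrite !ler_norml.
by move=> /andP[? ?] /andP[? ?]; nra.
Qed.

Section SignedPerm.
Variables (m n : nat) (f : face_code m) (g : face_code n).
Variable h : 'rV[R]_m -> 'rV[R]_n.
Hypothesis hP : isometric_faces f g h.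

Let A := [pred i | f i == None].
Let B := [pred j | g j == None].

Lemma isom_face x : face f x -> face g (h x).
Proof. by move=> fx; case: hP => <- _; exists x. Qed.

Lemma isom_dist x y : face f x -> face f y ->
  \sum_(j | B j) (h x 0 j - h y 0 j) ^+ 2 = \sum_(i | A i) (x 0 i - y 0 i) ^+ 2.
Proof.
move=> fx fy; rewrite -(face_edist fx fy) -(face_edist (isom_face fx) (isom_face fy)).
by case: hP => _ ->.
Qed.

Definition corner k (f' : face_code k) (e : 'I_k -> bool) := mkpt f' (fun i => sgb (e i) * 2^-1).

Lemma corner_face k (f' : face_code k) e : face f' (corner f' e).
Proof. by apply: mkpt_face => i; rewrite norm_sgb ger0_norm// ltW// inv2_gt0. Qed.

Lemma corner_antipode k (f' : face_code k) e :
  edist (corner f' e) (corner f' (fun i => ~~ e i)) ^+ 2 = #|[pred i | f' i == None]|%:R.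
Proof.
rewrite (face_edist (corner_face _ _) (corner_face _ _)) -sum1_card natr_sum.
apply: eq_bigr => i /eqP fi; rewrite /corner !mkpt_free// sgbN.
transitivity (sgb (e i) ^+ 2); last exact: sqr_sgb.
by field.
Qed.

(** The squared diameter of a face is its dimension, attained by antipodal corners. *)
Lemma isom_card : #|A| = #|B|.
Proof.
apply/eqP; rewrite eqn_leq; apply/andP; split; rewrite -(ler_nat R).
  pose e := fun _ : 'I_m => true; rewrite -(corner_antipode f e).
  have [_ <-] := hP; try exact: corner_face.
  by apply: face_diam; apply: isom_face; apply: corner_face.
pose e := fun _ : 'I_n => true; rewrite -(corner_antipode g e).
have [hf hd] := hP.
have := corner_face g e; have := corner_face g (fun i => ~~ e i).
rewrite -hf => -[x fx <-] [y fy <-]; rewrite hd//.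
exact: face_diam.
Qed.

(** Each of the [#|B|] coordinates contributes at most 1 to the squared distance of the images of
    antipodal corners, which is [#|A| = #|B|]. So each contributes exactly 1, which only the values
    [1/2] and [-1/2] do. *)
Lemma corner_image e j : B j -> `|h (corner f e) 0 j| = 2^-1 /\
  h (corner f (fun i => ~~ e i)) 0 j = - h (corner f e) 0 j.
Proof.
set p := h _; set q := h _ => Bj.
have gp : face g p by apply/isom_face/corner_face.
have gq : face g q by apply/isom_face/corner_face.
have pq : \sum_(j | B j) (1 - (p 0 j - q 0 j) ^+ 2) = 0.
  rewrite sumrB isom_dist; try exact: corner_face.
  rewrite -face_edist; try exact: corner_face.
  have -> : \sum_(j | B j) (1 : R) = #|B|%:R by rewrite -sum1_card natr_sum.
  by rewrite corner_antipode -isom_card subrr.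
have /(_ j Bj) : forall j, B j -> 1 - (p 0 j - q 0 j) ^+ 2 = 0.
  apply: psumr_eq0P pq => k _; have := face_coord k gp; have := face_coord k gq.
  by rewrite !ler_norml => /andP[? ?] /andP[? ?]; nra.
have := face_coord j gp; have := face_coord j gq.
rewrite !ler_norml => /andP[q1 q2] /andP[p1 p2] E.
have /eqP : (1 - (p 0 j - q 0 j)) * (1 + (p 0 j - q 0 j)) = 0 by rewrite -E; ring.
rewrite mulf_eq0 => /orP[] /eqP E'.
  have -> : p 0 j = 2^-1 by lra.
  by split; [rewrite ger0_norm// ltW// inv2_gt0|lra].
have -> : p 0 j = - 2^-1 by lra.
by split; [rewrite normrN ger0_norm// ltW// inv2_gt0|lra].
Qed.

Let ctr := mkpt f (fun=> 0).

Lemma ctr_face : face f ctr.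
Proof. by apply: mkpt_face => i; rewrite normr0 ltW// inv2_gt0. Qed.

(** The centre has squared distance [#|B| / 4] from every corner. Averaging over the images of two
    antipodal corners, which are opposite in the coordinates of [B], leaves no room for a nonzero
    coordinate. *)
Lemma ctr_image j : B j -> h ctr 0 j = 0.
Proof.
move: j; pose e := fun _ : 'I_m => true.
have dc (e' : 'I_m -> bool) : \sum_(j | B j) (h ctr 0 j - h (corner f e') 0 j) ^+ 2 = #|B|%:R / 4.
  rewrite isom_dist; [|exact: ctr_face|exact: corner_face].
  rewrite -isom_card -sum1_card natr_sum mulr_suml; apply: eq_bigr => i /eqP fi.
  rewrite /ctr /corner !mkpt_free//.
  transitivity (sgb (e' i) ^+ 2 / 4); last by rewrite sqr_sgb.
  by field.
have E : \sum_(j | B j) h ctr 0 j ^+ 2 = 0.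
  transitivity (2^-1 * (\sum_(j | B j) (h ctr 0 j - h (corner f e) 0 j) ^+ 2 +
     \sum_(j | B j) (h ctr 0 j - h (corner f (fun i => ~~ e i)) 0 j) ^+ 2 -
     \sum_(j | B j) 2^-1)); last first.
    by rewrite !dc sumr_const -[2^-1 *+ _]mulr_natr; field.
  rewrite -big_split -sumrB mulr_sumr; apply: eq_bigr => j Bj /=.
  have [p1 ->] := corner_image e Bj.
  have : h (corner f e) 0 j ^+ 2 = 2^-1 ^+ 2 by rewrite -p1 real_normK ?num_real.
  nra.
by move=> j Bj; apply: (sumsq_eq0 E Bj).
Qed.

(** The centre goes to the centre, so norms are preserved, and polarization gives inner products. *)
Lemma isom_inner z z' : face f z -> face f z' ->
  \sum_(j | B j) h z 0 j * h z' 0 j = \sum_(i | A i) z 0 i * z' 0 i.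
Proof.
move=> fz fz'.
have sq x : face f x -> \sum_(j | B j) h x 0 j ^+ 2 = \sum_(i | A i) x 0 i ^+ 2.
  move=> fx; transitivity (\sum_(i | A i) (x 0 i - ctr 0 i) ^+ 2); last first.
    by apply: eq_bigr => i /eqP fi; rewrite /ctr mkpt_free// subr0.
  rewrite -(isom_dist fx ctr_face); apply: eq_bigr => j Bj.
  by rewrite ctr_image// subr0.
have pol k (P : pred 'I_k) (x y : 'rV[R]_k) : \sum_(i | P i) x 0 i * y 0 i =
   2^-1 * (\sum_(i | P i) x 0 i ^+ 2 + \sum_(i | P i) y 0 i ^+ 2 -
     \sum_(i | P i) (x 0 i - y 0 i) ^+ 2).
  rewrite -big_split -sumrB mulr_sumr; apply: eq_bigr => i _ /=.
  move: (x 0 i) (y 0 i) => a b.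
  have -> : a ^+ 2 + b ^+ 2 - (a - b) ^+ 2 = 2 * (a * b) by ring.
  by rewrite mulKf ?pnatr_eq0.
by rewrite (pol _ B) (pol _ A) !sq// isom_dist.
Qed.

(* Corners go to corners, and flipping the [i]-th coordinate of a corner flips
   exactly one coordinate [j] of its image, as the distance is 1.  Subtracting the
   inner products with these two corners recovers the [j]-th coordinate. *)
Lemma signed_coord i : f i = None -> exists j b, g j = None /\
  forall z, face f z -> h z 0 j = sgb b * z 0 i.
Proof.
move=> fi.
pose e := fun _ : 'I_m => true; pose e' := fun k : 'I_m => k != i.
pose p := h (corner f e); pose p' := h (corner f e').
have cd k : k != i -> f k = None -> corner f e 0 k = corner f e' 0 k.
  by move=> ki fk; rewrite /corner !mkpt_free// /e' ki.
have ci : corner f e 0 i - corner f e' 0 i = 1.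
  by rewrite /corner !mkpt_free// /e /e' eqxx /sgb /=; field.
have pp' : \sum_(j | B j) (p 0 j - p' 0 j) ^+ 2 = 1.
  rewrite isom_dist; try exact: corner_face.
  rewrite (bigD1 i) /=; last by rewrite fi.
  rewrite ci big1 ?addr0 ?expr1n// => k /andP[/eqP fk ki].
  by rewrite (cd _ ki fk) subrr expr0n.
have pd j : B j -> p 0 j != p' 0 j -> (p 0 j - p' 0 j) = 2 * p 0 j.
  move=> Bj; have [+ _] := corner_image e Bj; have [+ _] := corner_image e' Bj.
  rewrite -/p -/p' => /eqP; rewrite eqr_norml => /andP[/orP[] /eqP-> _] /eqP;
  rewrite eqr_norml => /andP[/orP[] /eqP-> _]; rewrite ?eqxx// => _; ring.
have [j Bj pj] : exists2 j, B j & p 0 j != p' 0 j.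
  apply: contrapT => no; have : (1 : R) = 0; last by move/eqP; rewrite oner_eq0.
  rewrite -pp'; apply: big1 => j Bj; apply/eqP; rewrite sqrf_eq0 subr_eq0.
  by apply: contraT => pj; case: no; exists j.
have pj1 : (p 0 j - p' 0 j) ^+ 2 = 1.
  rewrite (pd j Bj pj); have [+ _] := corner_image e Bj; rewrite -/p => /eqP.
  by rewrite eqr_norml => /andP[/orP[] /eqP-> _]; field.
have only k : B k -> k != j -> p 0 k = p' 0 k.
  move=> Bk kj; have : \sum_(l | B l && (l != j)) (p 0 l - p' 0 l) ^+ 2 = 0.
    by apply: (addrI 1); rewrite -{1}pj1 addr0 -pp' [RHS](bigD1 j).
  by move/sumsq_eq0 => /(_ k); rewrite Bk kj => /(_ isT)/eqP; rewrite subr_eq0 => /eqP.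
exists j, (0 < p 0 j); split; first exact/eqP.
move=> z fz.
have E : h z 0 j * (2 * p 0 j) = z 0 i.
  have := isom_inner fz (corner_face f e); have := isom_inner fz (corner_face f e').
  rewrite -/p -/p' => E1 E2.
  have : \sum_(j | B j) h z 0 j * (p 0 j - p' 0 j) =
      \sum_(i | A i) z 0 i * (corner f e 0 i - corner f e' 0 i).
    by under eq_bigr do rewrite mulrBr; under [RHS]eq_bigr do rewrite mulrBr;
       rewrite !sumrB E1 E2.
  rewrite (bigD1 j)//= big1 ?addr0; last by move=> k /andP[Bk kj]; rewrite (only k)// subrr mulr0.
  rewrite (bigD1 i) /=; last by rewrite fi.
  rewrite [X in _ = _ + X]big1 ?addr0; last by move=> k /andP[/eqP fk ki]; rewrite (cd k)// subrr mulr0.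
  by rewrite ci mulr1 (pd j).
rewrite -E; have [+ _] := corner_image e Bj; rewrite -/p => /eqP.
rewrite eqr_norml => /andP[/orP[] /eqP-> _]; rewrite /sgb.
  by rewrite inv2_gt0; field.
by rewrite oppr_gt0 ltNge (ltW inv2_gt0) /=; field.
Qed.

End SignedPerm.

Lemma isometric_faces_inv m n (f : face_code m) (g : face_code n) (h : 'rV[R]_m -> 'rV[R]_n) :
  isometric_faces f g h -> exists2 h', isometric_faces g f h' &
    forall x, face f x -> h' (h x) = x.
Proof.
move=> [hf hd].
have : forall y, exists x, face g y -> face f x /\ h x = y.
  move=> y; have [gy|ngy] := pselect (face g y); last by exists 0.
  by move: gy; rewrite -hf => -[x fx xy]; exists x.
move=> /choice[h' h'P]; exists h'; last first.
  move=> x fx; have [|fh hh] := h'P (h x); first by rewrite -hf; exists x.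
  by apply: edist_eq0; rewrite -hd// hh edistxx.
split.
  apply/seteqP; split=> [_ [y gy <-]|x fx]; first by case: (h'P y gy).
  exists (h x); first by rewrite -hf; exists x.
  have [|fh hh] := h'P (h x); first by rewrite -hf; exists x.
  by apply: edist_eq0; rewrite -hd// hh edistxx.
move=> x y gx gy; have [fx hx] := h'P x gx; have [fy hy] := h'P y gy.
by rewrite -hd// hx hy.
Qed.

Lemma signed_coord_inv m n (f : face_code m) (g : face_code n) (h : 'rV[R]_m -> 'rV[R]_n) :
  isometric_faces f g h -> forall j, g j = None ->
  exists i b, f i = None /\ forall z, face f z -> h z 0 j = sgb b * z 0 i.
Proof.
move=> hP j gj; have [h' h'P hK] := isometric_faces_inv hP.
have [i [b [fi E]]] := signed_coord h'P gj; exists i, b; split=> // z fz.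
by rewrite -{2}(hK z fz) E ?sgbK//; apply: isom_face hP _ fz.
Qed.

End Faces.

(** * Lines and hyperplanes *)

Section Supports.
Variables (R : realType) (n : nat).
Implicit Types x z : 'rV[R]_n.

(** For [x] in the cube, the code of the face that has [x] in its interior. *)
Definition supp x : face_code n :=
  [ffun i => if x 0 i == 2^-1 then Some true
             else if x 0 i == - 2^-1 then Some false else None].

Definition free x i := `|x 0 i| < 2^-1.

Definition upd x i (a : R) : 'rV[R]_n := \row_k if k == i then a else x 0 k.

Lemma suppP x i : cube x -> (supp x i == None) = free x i.
Proof.
move=> /(_ i); rewrite ffunE /free lt_neqAle => ->; rewrite andbT eqr_norml.
rewrite (ltW (inv2_gt0 R)) andbT; case: (eqVneq (x 0 i) _) => //= _.
by case: ifP.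
Qed.

Lemma free_supp x i : cube x -> free x i -> supp x i = None.
Proof. by move=> cx; rewrite -suppP// => /eqP. Qed.

Lemma supp_interior x : cube x -> face_interior (supp x) x.
Proof.
move=> cx i; have := suppP i cx; rewrite ffunE; case: (eqVneq (x 0 i)) => [->//|_].
by case: (eqVneq (x 0 i)) => [->//|_] /esym; rewrite eqxx.
Qed.

Lemma interior_face (f : face_code n) x : face_interior f x -> face f x.
Proof. by move=> H i; have := H i; case: (f i) => // /ltW. Qed.

Lemma supp_face x : cube x -> face (supp x) x.
Proof. by move=> cx; apply/interior_face/supp_interior. Qed.

Lemma face_supp_fixed x z i : cube x -> face (supp x) z -> ~~ free x i -> z 0 i = x 0 i.
Proof.
move=> cx fz nf; have := fz i; have := supp_face cx i; have := suppP i cx.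
by rewrite (negPf nf); case: (supp x i) => // b _ -> ->.
Qed.

Lemma face_suppI x z : cube x -> cube z ->
  (forall i, ~~ free x i -> z 0 i = x 0 i) -> face (supp x) z.
Proof.
move=> cx cz H i; have := supp_face cx i; have := suppP i cx.
by case E : (supp x i) => [b|] //= /esym nf <-; apply: H; rewrite nf.
Qed.

Lemma updE x i a k : upd x i a 0 k = if k == i then a else x 0 k.
Proof. by rewrite mxE. Qed.

Lemma upd_id x i : upd x i (x 0 i) = x.
Proof. by apply/rowP => k; rewrite updE; case: eqP => // ->. Qed.

Lemma upd_upd x i a b : upd (upd x i a) i b = upd x i b.
Proof. by apply/rowP => k; rewrite !updE; case: eqP. Qed.

Lemma cube_upd x i a : cube x -> `|a| <= 2^-1 -> cube (upd x i a).
Proof. by move=> cx ca k; rewrite updE; case: eqP. Qed.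

Lemma face_upd x z i a : cube x -> face (supp x) z -> free x i -> `|a| <= 2^-1 ->
  face (supp x) (upd z i a).
Proof.
move=> cx fz fi ca; apply: face_suppI => //.
  by apply: cube_upd ca; apply: face_cube fz.
move=> k nk; rewrite updE; case: eqP => [ki|_]; last exact: face_supp_fixed nk.
by rewrite -ki (negPf nk) in fi.
Qed.

Lemma sqr_edist_upd x z i a b : edist (upd x i a) (upd z i b) ^+ 2 =
  edist (upd x i 0) (upd z i 0) ^+ 2 + (a - b) ^+ 2.
Proof.
rewrite !sqr_edist (bigD1 i)//= [X in _ = X + _](bigD1 i)//= !updE eqxx.
rewrite subrr expr0n /= add0r addrC; congr (_ + _).
by apply: eq_bigr => k /negPf ki; rewrite !updE ki.
Qed.

Lemma edist_upd x z i a : edist (upd x i a) (upd z i a) = edist (upd x i 0) (upd z i 0).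
Proof.
apply/eqP; rewrite -(@eqrXn2 _ 2)// ?edist_ge0// sqr_edist_upd subrr expr0n.
by rewrite addr0.
Qed.

Lemma edist_upd1 x i a b : edist (upd x i a) (upd x i b) = `|a - b|.
Proof.
apply/eqP; rewrite -(@eqrXn2 _ 2)// ?edist_ge0// sqr_edist_upd edistxx expr0n.
by rewrite add0r real_normK ?num_real.
Qed.

End Supports.

(** * Lines, parallelism and the lifting of paths *)

Section Lines.
Variables (R : realType) (X : cube_complex R).

(** The isometry of [cc_glue] in coordinates: by [signed_coord] and its inverse, the free
    coordinates of [x] and [y] correspond up to sign. It sends [x] to [y] because [h x] and [y] lie
    in the same open face, where [cc_map] is injective. *)
Lemma glue s t (x : 'rV[R]_(cc_dim s)) (y : 'rV[R]_(cc_dim t)) :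
  cube x -> cube y -> @cc_map R X s x = @cc_map R X t y ->
  exists h, [/\ h x = y,
   forall z, face (supp x) z -> face (supp y) (h z) /\
     @cc_map R X s z = @cc_map R X t (h z),
   forall z z', face (supp x) z -> face (supp x) z' -> edist (h z) (h z') = edist z z',
   forall i, free x i -> exists j b, free y j /\
     forall z, face (supp x) z -> h z 0 j = sgb R b * z 0 i &
   forall j, free y j -> exists i b, free x i /\
     forall z, face (supp x) z -> h z 0 j = sgb R b * z 0 i].
Proof.
move=> cx cy xy.
have [h hP hmap] := cc_glue (supp_interior cx) (supp_interior cy) xy.
have fwd i : free x i -> exists j b, free y j /\
     forall z, face (supp x) z -> h z 0 j = sgb R b * z 0 i.
  move=> /(free_supp cx) /(signed_coord hP)[j [b [gj E]]].
  by exists j, b; rewrite -suppP// gj.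
have bwd j : free y j -> exists i b, free x i /\
     forall z, face (supp x) z -> h z 0 j = sgb R b * z 0 i.
  move=> /(free_supp cy) /(signed_coord_inv hP)[i [b [fi E]]].
  by exists i, b; rewrite -suppP// fi.
have hf z : face (supp x) z -> face (supp y) (h z) by exact: isom_face.
exists h; split=> //; last by case: hP.
- apply: (cc_inj (f := supp y)); last by rewrite -hmap//; apply: supp_face.
    move=> j; have := suppP j cy; have := hf _ (supp_face cx) j.
    case: (supp y j) => // _ /esym /bwd[i [b [fi ->]]]; last exact: supp_face.
    by rewrite norm_sgb.
  exact: supp_interior.
- by move=> z fz; split; [exact: hf|exact: hmap].
Qed.

Definition clamp (u : R) : R := Num.max (- 2^-1) (Num.min 2^-1 u).

Lemma clamp_id u : `|u| <= 2^-1 -> clamp u = u.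
Proof.
by rewrite ler_norml => /andP[? ?]; rewrite /clamp min_r// max_r.
Qed.

Lemma clamp_le u : `|clamp u| <= 2^-1.
Proof.
have h0 := inv2_gt0 R.
rewrite ler_norml /clamp le_max lexx /= ge_max ge_min lexx /= andbT; lra.
Qed.

Lemma sclamp_le b u : `|sgb R b * clamp u| <= 2^-1.
Proof. by rewrite norm_sgb clamp_le. Qed.

(* The maximal segment through [x] in the direction of the [i]-th coordinate,
   parametrized by height.  Clamping makes two such segments that agree on
   [-1/2,1/2] equal as functions. *)
Definition line s (x : 'rV[R]_(cc_dim s)) i b : R -> X :=
  fun u => @cc_map R X s (upd x i (sgb R b * clamp u)).

Definition is_line (L : R -> X) := exists s x i b, cube x /\ L = @line s x i b.

Lemma line_upd s (x : 'rV[R]_(cc_dim s)) i b a : line (upd x i a) i b = line x i b.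
Proof. by apply/funext => u; rewrite /line upd_upd. Qed.

Lemma line_point s (x : 'rV[R]_(cc_dim s)) i b : cube x ->
  line x i b (sgb R b * x 0 i) = @cc_map R X s x.
Proof. by move=> cx; rewrite /line clamp_id ?norm_sgb// sgbK upd_id. Qed.

Lemma line_glue s t (x : 'rV[R]_(cc_dim s)) (y : 'rV[R]_(cc_dim t)) h i j b0 :
  cube x -> cube y ->
  (forall z, face (supp x) z -> face (supp y) (h z) /\
     @cc_map R X s z = @cc_map R X t (h z)) ->
  (forall z z', face (supp x) z -> face (supp x) z' -> edist (h z) (h z') = edist z z') ->
  (forall j, free y j -> exists i b, free x i /\
     forall z, face (supp x) z -> h z 0 j = sgb R b * z 0 i) ->
  free x i -> free y j -> (forall z, face (supp x) z -> h z 0 j = sgb R b0 * z 0 i) ->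
  forall z b, face (supp x) z -> line z i b = line (h z) j (b == b0).
Proof.
move=> cx cy hf hd bwd fi fj hj z b fz; apply/funext => u; rewrite /line.
set a := sgb R b * clamp u; have fa := face_upd cx fz fi (sclamp_le b u).
rewrite -/a in fa; have [fha ->] := hf _ fa; congr cc_map; apply/rowP => k.
rewrite updE; case: eqP => [->|/eqP kj]; first by rewrite hj// updE eqxx /a sgbM eq_sym.
have [fk|nfk] := boolP (free y k); last first.
  by rewrite (face_supp_fixed cy fha)// (face_supp_fixed cy (hf _ fz).1).
have [i' [b' [fi' E]]] := bwd k fk; rewrite !E// updE.
(* If a second coordinate [k] also followed the coordinate [i], moving the latter by [1/2] would
   move the image by [1/2] in two coordinates, farther than an isometry permits. *)
case: eqP => // ii'; exfalso.
pose p := upd x i 0; pose q := upd x i 2^-1.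
have h0 := inv2_gt0 R.
have fp : face (supp x) p by apply: face_upd => //; [exact: supp_face|rewrite normr0 ltW].
have fq : face (supp x) q by apply: face_upd => //; [exact: supp_face|rewrite gtr0_norm].
have := hd _ _ fp fq; rewrite edist_upd1 sub0r normrN gtr0_norm// => Epq.
have : edist (h p) (h q) ^+ 2 = 2^-1 ^+ 2 by rewrite Epq.
rewrite sqr_edist (bigD1 j)//= (bigD1 k)//= !hj// !E// ii' !updE eqxx.
rewrite -!mulrBr !exprMn !sqr_sgb !mul1r sub0r !sqrrN => H.
have : 0 <= \sum_(l < cc_dim t | (l != j) && (l != k)) (h p 0 l - h q 0 l) ^+ 2.
  by apply: sumr_ge0 => l _; apply: sqr_ge0.
nra.
Qed.

Lemma line_rep s t (x : 'rV[R]_(cc_dim s)) (y : 'rV[R]_(cc_dim t)) i b :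
  cube x -> cube y -> @cc_map R X s x = @cc_map R X t y -> free x i ->
  exists j c, [/\ free y j, line x i b = line y j c & sgb R c * y 0 j = sgb R b * x 0 i].
Proof.
move=> cx cy xy fi; have [h [hx hf hd fwd bwd]] := glue cx cy xy.
have [j [b0 [fj hj]]] := fwd i fi; exists j, (b == b0); split=> //.
  by rewrite (line_glue cx cy hf hd bwd fi fj hj)// ?hx//; apply: supp_face.
by rewrite -hx hj ?sgbM; [case: b b0 {hj} => [] []|exact: supp_face].
Qed.

(** Lets a line be rewritten in any cube through one of its interior points, such as the cube of the
    next segment of a path. *)
Lemma line_at L u t (y : 'rV[R]_(cc_dim t)) : is_line L -> `|u| < 2^-1 ->
  cube y -> L u = @cc_map R X t y ->
  exists j c, [/\ free y j, L = line y j c & sgb R c * y 0 j = u].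
Proof.
move=> [s [x [i [b [cx ->]]]]] u2 cy E.
rewrite /line clamp_id ?(ltW u2)// in E.
have cx' : cube (upd x i (sgb R b * u)) by apply: cube_upd; rewrite ?norm_sgb// ltW.
have [|j [c [fj LE cE]]] := line_rep b cx' cy E (i := i).
  by rewrite /free updE eqxx norm_sgb.
by exists j, c; split=> //; [rewrite -LE line_upd|rewrite cE updE eqxx sgbK].
Qed.

Lemma is_line_line s (x : 'rV[R]_(cc_dim s)) i b : cube x -> is_line (line x i b).
Proof. by move=> cx; exists s, x, i, b. Qed.
Hint Resolve is_line_line : core.

Lemma chain_ge0 (p q : X) l : chain p q l -> 0 <= l.
Proof. by elim=> // *; rewrite addr_ge0 ?edist_ge0. Qed.

Lemma chain_seg s (a b : 'rV[R]_(cc_dim s)) : cube a -> cube b ->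
  chain (@cc_map R X s a) (cc_map b) (edist a b).
Proof.
by move=> ca cb; rewrite -[edist a b]addr0; apply: chain_cons => //; apply: chain_nil.
Qed.

(* Paths in the space of lines, that is, in the (immersed) hyperplane; the length
   ignores the coordinate along the line. *)
Inductive bchain : (R -> X) -> (R -> X) -> R -> Prop :=
| bchain_nil L : is_line L -> bchain L L 0
| bchain_cons s (a b : 'rV[R]_(cc_dim s)) i c L l :
    cube a -> cube b -> bchain (line b i c) L l ->
    bchain (line a i c) L (edist (upd a i 0) (upd b i 0) + l).

(** Parallelism; its classes are the oriented hyperplanes. *)
Definition conn L L' := exists l, bchain L L' l.

Lemma bchain_chain L L' l : bchain L L' l -> forall u, chain (L u) (L' u) l.
Proof.
elim=> [M _ u|s a b i c M k ca cb _ IH u]; first exact: chain_nil.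
by rewrite -(edist_upd a b i (sgb R c * clamp u)); apply: chain_cons (IH u);
  apply: cube_upd => //; apply: sclamp_le.
Qed.

Lemma bchain_line L L' l : bchain L L' l -> is_line L /\ is_line L'.
Proof. by elim=> // *; split; [auto|tauto]. Qed.

Lemma bchain_cat L L' L'' l l' : bchain L L' l -> bchain L' L'' l' -> bchain L L'' (l + l').
Proof.
move=> H; elim: H l' => [M _|s a b i c M k ca cb _ IH] l' H'; first by rewrite add0r.
by rewrite -addrA; apply: bchain_cons => //; apply: IH.
Qed.

Lemma bchain_seg s (a b : 'rV[R]_(cc_dim s)) i c : cube a -> cube b ->
  bchain (line a i c) (line b i c) (edist (upd a i 0) (upd b i 0)).
Proof.
move=> ca cb; rewrite -[edist _ _]addr0; apply: bchain_cons => //.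
by apply: bchain_nil; auto.
Qed.

Lemma bchain_rev L L' l : bchain L L' l -> bchain L' L l.
Proof.
elim=> [M ?|s a b i c M k ca cb _ IH]; first exact: bchain_nil.
by rewrite addrC edistC; apply: bchain_cat IH _; apply: bchain_seg.
Qed.

Lemma conn_refl L : is_line L -> conn L L.
Proof. by exists 0; apply: bchain_nil. Qed.

Lemma conn_sym L L' : conn L L' -> conn L' L.
Proof. by move=> [l H]; exists l; apply: bchain_rev. Qed.

Lemma conn_trans L L' L'' : conn L L' -> conn L' L'' -> conn L L''.
Proof. by move=> [l H] [l' H']; exists (l + l'); apply: bchain_cat H'. Qed.

Lemma conn_seg s (a b : 'rV[R]_(cc_dim s)) i c : cube a -> cube b ->
  conn (line a i c) (line b i c).
Proof. by move=> ca cb; eexists; apply: bchain_seg. Qed.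

Definition flip (L : R -> X) : R -> X := fun u => L (- u).

Lemma clampN u : clamp (- u) = - clamp u.
Proof.
have h0 := inv2_gt0 R; rewrite /clamp.
have [u1|/ltW u1] := leP 2^-1 u.
  have E : - u <= 2^-1 by lra.
  have E1 : - u <= - 2^-1 by lra.
  have E2 : - 2^-1 <= 2^-1 :> R by lra.
  by rewrite (min_r E) (max_l E1) (max_r E2).
have [u2|/ltW u2] := leP u (- 2^-1).
  have E : 2^-1 <= - u by lra.
  have E2 : - 2^-1 <= 2^-1 :> R by lra.
  by rewrite (min_l E) (max_r E2) opprK.
have E : - u <= 2^-1 by lra.
have E1 : - 2^-1 <= - u by lra.
by rewrite (min_r E) (max_r E1).
Qed.

Lemma flip_line s (x : 'rV[R]_(cc_dim s)) i b : flip (line x i b) = line x i (~~ b).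
Proof. by apply/funext => u; rewrite /flip /line clampN sgbN mulrN mulNr. Qed.

Lemma flipK L : flip (flip L) = L.
Proof. by apply/funext => u; rewrite /flip opprK. Qed.

Lemma is_line_flip L : is_line L -> is_line (flip L).
Proof. by move=> [s [x [i [b [cx ->]]]]]; rewrite flip_line; auto. Qed.

Lemma conn_flip L L' : conn L L' -> conn (flip L) (flip L').
Proof.
move=> [l]; elim=> [M ?|s a b i c M k ca cb _ IH]; first exact/conn_refl/is_line_flip.
by apply: conn_trans IH; rewrite !flip_line; apply: conn_seg.
Qed.

(* A path that starts at the interior height [u] of [L] and is too short to leave
   the open carrier projects to a path of lines. *)
Lemma lift (p q : X) l : chain p q l -> forall L u, is_line L -> p = L u ->
  `|u| + l < 2^-1 ->
  exists L1 u1 k, [/\ q = L1 u1, bchain L L1 k, `|u1| < 2^-1, 0 <= k &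
    k ^+ 2 + (u1 - u) ^+ 2 <= l ^+ 2].
Proof.
elim=> [x|s a b y k ca cb bc IH] L u lL pL ul.
  exists L, u, 0; split=> //; [exact: bchain_nil|by rewrite addr0 in ul|].
  by rewrite subrr expr0n addr0.
have k0 := chain_ge0 bc; have e0 := edist_ge0 a b.
have u2 : `|u| < 2^-1 by lra.
have [i [c [fi LE uE]]] := line_at lL u2 ca (esym pL).
pose u' := sgb R c * b 0 i.
have u'E : (u' - u) ^+ 2 = (a 0 i - b 0 i) ^+ 2.
  by rewrite /u' -uE -mulrBr exprMn sqr_sgb mul1r -sqrrN opprB.
have u'u : `|u'| <= `|u| + edist a b.
  rewrite -(subrK u u'); apply: le_trans (ler_normD _ _) _; rewrite addrC lerD2l.
  rewrite /u' -uE -mulrBr norm_sgb distrC; exact: coord_le_edist.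
have [||L1 [u1 [k1 [qE bL u1h k10 kE]]]] := IH (line b i c) u' (is_line_line _ _ cb).
- by rewrite line_point.
- by lra.
exists L1, u1, (edist (upd a i 0) (upd b i 0) + k1); split=> //.
- by rewrite LE; apply: bchain_cons.
- by rewrite addr_ge0 ?edist_ge0.
have -> : u1 - u = (u' - u) + (u1 - u') by ring.
apply: minkowski2 => //; rewrite u'E -sqr_edist_upd !upd_id //.
Qed.

End Lines.

(** * The CAT(0) metric *)

Section Metric.
Variables (R : realType) (X : cube_complex R).
Hypothesis hX : CAT0_cube_complex X.
Local Notation d := (@cc_dist R X).

Lemma dist_edist (p q : X) : cc_edist p q = (d p q)%:E.
Proof. by rewrite /cc_dist fineK//; apply: hX.1. Qed.

Lemma dist_le_chain (p q : X) l : chain p q l -> d p q <= l.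
Proof. by move=> pq; rewrite -lee_fin -dist_edist; apply: ereal_inf_lbound; exists l. Qed.

Lemma dist_approx (p q : X) k : 0 < k -> exists2 l, chain p q l & l < d p q + k.
Proof.
move=> k0; have := lb_ereal_inf_adherent k0 (hX.1 p q).
move=> [_ [l pq <-]]; rewrite -/(cc_edist p q) dist_edist -EFinD lte_fin.
by exists l.
Qed.

Let metric : is_metric d. Proof. by case: hX => _ []. Qed.

Lemma dist_ge0 p q : 0 <= d p q. Proof. by case: metric. Qed.
Lemma dist_eq0 p q : d p q = 0 -> p = q. Proof. by case: metric => _ H _ _ /H. Qed.
Lemma distxx p : d p p = 0. Proof. by case: metric => _ H _ _; apply/H. Qed.
Lemma distC p q : d p q = d q p. Proof. by case: metric. Qed.
Lemma dist_triangle q p r : d p r <= d p q + d q r. Proof. by case: metric. Qed.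

Lemma dist_seg s (a b : 'rV[R]_(cc_dim s)) : cube a -> cube b ->
  d (@cc_map R X s a) (cc_map b) <= edist a b.
Proof. by move=> ca cb; apply/dist_le_chain/chain_seg. Qed.

Lemma geodesic_exists p q : exists c : R -> X, [/\ c 0 = p, c (d p q) = q &
  forall s t, 0 <= s <= d p q -> 0 <= t <= d p q -> d (c s) (c t) = `|s - t|].
Proof. by case: hX => _ [_ /(_ p q)[S [c [? ? ? _]]] _]; exists c. Qed.

Lemma segment_exists p q : exists2 S, geodesic_segment d p q S & S p /\ S q.
Proof.
have [c [c0 c1 cd]] := geodesic_exists p q.
exists (c @` [set t | 0 <= t <= d p q]); first by exists c.
by split; [exists 0|exists (d p q)]; rewrite //= ?lexx ?dist_ge0.
Qed.

(** The comparison inequality concerns points of a given segment. A point dividing the distance from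
    [p] to [r] lies on one: the concatenation [f] of geodesics from [p] to [x] and from [x] to
    [r]. *)
Lemma segment_through p r x lam : 0 <= lam <= 1 ->
  d p x = lam * d p r -> d x r = (1 - lam) * d p r ->
  exists2 S, geodesic_segment d p r S & S x.
Proof.
move=> /andP[l0 l1] px xr.
have [c [c0 c1 cd]] := geodesic_exists p x; have [e [e0 e1 ed]] := geodesic_exists x r.
pose f t := if t <= d p x then c t else e (t - d p x).
have D0 := dist_ge0 p r; have px0 := dist_ge0 p x; have xr0 := dist_ge0 x r.
have sum : d p x + d x r = d p r by rewrite px xr; ring.
have fr : f (d p r) = r.
  rewrite /f; case: leP => [H|H]; last by rewrite -sum addrAC subrr add0r.
  have E : d x r = 0 by lra.
  have -> : d p r = d p x by lra.
  by rewrite c1; apply: dist_eq0.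
have fd s t : 0 <= s -> s <= t -> t <= d p r -> d (f s) (f t) = t - s.
  move=> s0 st tD; rewrite /f; case: (leP t (d p x)) => tx.
    rewrite (le_trans st tx) cd ?s0 ?(le_trans st tx) ?(le_trans s0 st) ?tx//.
    by rewrite distrC ger0_norm// subr_ge0.
  case: leP => sx; last first.
    rewrite ed; [|apply/andP; split; lra..].
    by rewrite distrC ger0_norm; lra.
  have dsx : d (c s) x = d p x - s.
    rewrite -[X in d _ X]c1 cd ?s0 ?sx ?px0 ?lexx//.
    by rewrite distrC ger0_norm// subr_ge0.
  have dps : d p (c s) = s.
    by rewrite -[X in d X _]c0 cd ?s0 ?sx ?px0 ?lexx// sub0r normrN ger0_norm.
  have dxt : d x (e (t - d p x)) = t - d p x.
    rewrite -[X in d X _]e0 ed; [|apply/andP; split; lra..].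
    by rewrite sub0r normrN ger0_norm; lra.
  have dtr : d (e (t - d p x)) r = d p r - t.
    rewrite -[X in d _ X]e1 ed; [|apply/andP; split; lra..].
    by rewrite distrC ger0_norm; lra.
  have := dist_triangle x (c s) (e (t - d p x)).
  have := dist_triangle (c s) p r; have := dist_triangle (e (t - d p x)) (c s) r.
  lra.
exists (f @` [set t | 0 <= t <= d p r]); last first.
  by exists (d p x); rewrite /= /f ?lexx ?c1//; apply/andP; split; lra.
exists f; split=> //; first by rewrite /f px0.
move=> s t /andP[s0 sD] /andP[t0 tD]; case: (leP s t) => [st|/ltW st].
  by rewrite fd// distrC ger0_norm// subr_ge0.
by rewrite distC fd// ger0_norm// subr_ge0.
Qed.

Definition vec2 (a b : R) : 'rV[R]_2 := \row_(i < 2) if i == ord0 then a else b.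

Lemma edist_vec2 a b a' b' :
  edist (vec2 a b) (vec2 a' b') = Num.sqrt ((a - a') ^+ 2 + (b - b') ^+ 2).
Proof. by rewrite /edist !big_ord_recl big_ord0 addr0 !mxE. Qed.

Lemma sqrt_sqr_eq (x y : R) : 0 <= y -> x = y ^+ 2 -> Num.sqrt x = y.
Proof. by move=> y0 ->; rewrite sqrtr_sqr ger0_norm. Qed.

Lemma eseg_right n (a b : 'rV[R]_n) : eseg a b b.
Proof. by exists 1; rewrite ?lexx ?ler01// subrr scale0r scale1r add0r. Qed.

(** Stewart's theorem, an equality in the plane. The comparison triangle is placed at [(0, 0)],
    [(D, 0)] and [(u, v)], with [u] given by the law of cosines. *)
Lemma stewart p q r x lam : 0 <= lam <= 1 ->
  d p x = lam * d p r -> d x r = (1 - lam) * d p r ->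
  d q x ^+ 2 <= (1 - lam) * d q p ^+ 2 + lam * d q r ^+ 2
                - lam * (1 - lam) * d p r ^+ 2.
Proof.
move=> l01 px xr; have [Dz|Dn] := eqVneq (d p r) 0.
  have pr := dist_eq0 Dz; have xp : p = x by apply: dist_eq0; rewrite px Dz mulr0.
  by rewrite -pr -xp distxx; nra.
have Dp : 0 < d p r by rewrite lt_def Dn dist_ge0.
set D := d p r in Dp *; set a := d q p; set b := d q r.
have a0 : 0 <= a := dist_ge0 _ _; have b0 : 0 <= b := dist_ge0 _ _.
have Dab : D <= a + b by rewrite /a distC; apply: dist_triangle.
have aDb : a <= D + b by rewrite /a /b distC [d q r]distC; apply: dist_triangle.
have bDa : b <= a + D by apply: dist_triangle.
pose u := (a ^+ 2 + D ^+ 2 - b ^+ 2) / (2 * D).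
have uE : 2 * D * u = a ^+ 2 + D ^+ 2 - b ^+ 2.
  by rewrite /u mulrC divfK// mulf_neq0 ?pnatr_eq0 ?gt_eqF.
have ua : u ^+ 2 <= a ^+ 2.
  have : (2 * D) ^+ 2 * u ^+ 2 <= (2 * D) ^+ 2 * a ^+ 2.
    rewrite -!exprMn uE -subr_ge0.
    (* Heron's factorization: the factors are nonnegative by the triangle inequalities, so that [v]
       is the root of a nonnegative number. *)
    have -> : (2 * D * a) ^+ 2 - (a ^+ 2 + D ^+ 2 - b ^+ 2) ^+ 2 =
      ((a + D - b) * (b + D - a)) * ((a + b - D) * (a + b + D)) by ring.
    by apply: mulr_ge0; apply: mulr_ge0; lra.
  by rewrite ler_pM2l// exprn_gt0// mulr_gt0.
pose v := Num.sqrt (a ^+ 2 - u ^+ 2).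
have vE : v ^+ 2 = a ^+ 2 - u ^+ 2 by rewrite sqr_sqrtr// subr_ge0.
have [S1 S1P S1x] := segment_through l01 px xr.
have [S2 S2P [S2r S2q]] := segment_exists r q.
have [S3 S3P _] := segment_exists q p.
have [_ [_ _ cat]] := hX.
have := @cat p r q S1 S2 S3 (vec2 0 0) (vec2 D 0) (vec2 u v) S1P S2P S3P.
rewrite !edist_vec2 -/D -/a [d r q]distC -/b.
have e1 : Num.sqrt ((0 - D) ^+ 2 + (0 - 0) ^+ 2) = D.
  by apply: sqrt_sqr_eq; [exact: ltW|ring].
have e2 : Num.sqrt ((D - u) ^+ 2 + (0 - v) ^+ 2) = b.
  by apply: sqrt_sqr_eq => //; rewrite sub0r sqrrN vE; lra.
have e3 : Num.sqrt ((u - 0) ^+ 2 + (v - 0) ^+ 2) = a.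
  by apply: sqrt_sqr_eq => //; rewrite !subr0 vE; lra.
move=> /(_ e1 e2 e3 x q (vec2 (lam * D) 0) (vec2 u v)).
move=> /(_ _ _)/wrap[].
- apply: Or31; split=> //.
    by exists lam => //; apply/rowP => i; rewrite /vec2 !mxE; case: ifP => _; ring.
  rewrite edist_vec2 px -/D; apply: sqrt_sqr_eq; last by ring.
  by apply: mulr_ge0; [case/andP: l01|exact: ltW].
- apply: Or32; split=> //; first exact: eseg_right.
  by rewrite edist_vec2 e2 distC.
rewrite edist_vec2 => H; have := dist_ge0 x q => dxq.
have H2 : d x q ^+ 2 <= (lam * D - u) ^+ 2 + (0 - v) ^+ 2.
  rewrite -[leRHS]sqr_sqrtr ?addr_ge0 ?sqr_ge0//.
  by rewrite ler_pXn2r ?nnegrE ?sqrtr_ge0.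
rewrite distC; apply: le_trans H2 _; rewrite sub0r sqrrN vE.
nra.
Qed.

End Metric.

(** * Local structure *)

Lemma fin_lower_bound (R : realType) (I : finType) (P : pred I) (f : I -> R) :
  (forall i, P i -> 0 < f i) -> exists2 g, 0 < g <= 1 & forall i, P i -> g <= f i.
Proof.
move=> f0.
suff [g g01 H] : exists2 g, 0 < g <= 1 & forall i, i \in enum I -> P i -> g <= f i.
  by exists g => // i; apply: H; rewrite mem_enum.
elim: (enum I) => [|i s [g /andP[g0 g1] H]]; first by exists 1; rewrite ?ltr01 ?lexx.
have [Pi|nPi] := boolP (P i).
  exists (Num.min g (f i)).
    by rewrite lt_min g0 f0// ge_min g1.
  move=> j; rewrite inE => /orP[/eqP-> _|/H{}H /H gj]; first by rewrite ge_min lexx orbT.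
  by rewrite ge_min gj.
exists g; first by rewrite g0.
move=> j; rewrite inE => /orP[/eqP->|]; [by rewrite (negPf nPi)|exact: H].
Qed.

Section Star.
Variables (R : realType) (X : cube_complex R).

(* The point [m] is at distance at least [g] from the faces not containing it. *)
Definition gap (m : X) (g : R) := forall t (v : 'rV[R]_(cc_dim t)), cube v ->
  @cc_map R X t v = m -> forall j, free v j -> `|v 0 j| <= 2^-1 - g.

(** One representative is enough, as gluing maps preserve free coordinates up to sign. *)
Lemma gapI m g s (x : 'rV[R]_(cc_dim s)) : cube x -> @cc_map R X s x = m ->
  (forall j, free x j -> `|x 0 j| <= 2^-1 - g) -> gap m g.
Proof.
move=> cx <- xg t v cv vx j fj; have [h [hv hf _ _ bwd]] := glue cx cv (esym vx).
have [i [b [fi E]]] := bwd j fj.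
by rewrite -hv E ?norm_sgb ?xg//; apply: supp_face.
Qed.

Lemma half_norm n (v : 'rV[R]_n) j : cube v -> ~~ free v j -> `|v 0 j| = 2^-1.
Proof. by move=> /(_ j) vj; rewrite /free -leNgt => H; apply/eqP; rewrite eq_le vj. Qed.

Lemma half_norm_eq (a b : R) : `|a| = 2^-1 -> `|b| = 2^-1 -> `|a - b| < 1 -> a = b.
Proof.
have h0 := inv2_gt0 R.
move=> /eqP; rewrite eqr_norml => /andP[/orP[] /eqP-> _] /eqP;
rewrite eqr_norml => /andP[/orP[] /eqP-> _] //; rewrite ltr_norml => /andP[? ?]; lra.
Qed.

(** If [v] is free in direction [j], its coordinate is at least [g] away from that of [y]; otherwise
    the two coordinates differ by 0 or 1. It follows that [v] lies in the face supporting [y], so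
    that [glue] carries [v] along when [y] is represented in another cube. *)
Lemma gap_fixed m g t (v y : 'rV[R]_(cc_dim t)) j : g <= 1 -> gap m g ->
  cube v -> @cc_map R X t v = m -> cube y -> edist y v < g -> ~~ free y j ->
  y 0 j = v 0 j.
Proof.
move=> g1 gm cv vm cy yv nf; have := le_lt_trans (coord_le_edist y v j) yv => dj.
have yj := half_norm cy nf.
have [fv|nfv] := boolP (free v j); last first.
  by apply: half_norm_eq => //; [exact: half_norm|exact: lt_le_trans g1].
have := gm _ _ cv vm j fv; have := lerB_dist (y 0 j) (v 0 j); rewrite yj; lra.
Qed.

(** By [gap_fixed] in both directions, [v] and [v'] have the same support, and [cc_map] is injective
    on open faces. *)
Lemma gap_uniq m g t (v v' : 'rV[R]_(cc_dim t)) : g <= 1 -> gap m g ->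
  cube v -> cube v' -> @cc_map R X t v = m -> @cc_map R X t v' = m ->
  edist v v' < g -> v = v'.
Proof.
move=> g1 gm cv cv' vm vm' vv'; apply: (cc_inj (f := supp v)); last by rewrite vm.
  exact: supp_interior.
move=> j; have := suppP j cv; have := supp_face cv j.
have v'v : edist v' v < g by rewrite edistC.
case E : (supp v j) => [b|] /= H1 /esym H2.
  by rewrite -H1; apply/esym/(gap_fixed g1 gm cv' vm' cv vv'); rewrite H2.
apply: contraT => nf; have := gap_fixed g1 gm cv vm cv' v'v nf => vj.
by move: nf; rewrite vj -/(free v j) H2.
Qed.

Section Near.
Variables (m : X) (g u0 : R) (D : (R -> X) -> Prop).
Hypotheses (g1 : g <= 1) (gm : gap m g).
Hypothesis D_height : forall t (v : 'rV[R]_(cc_dim t)) j b, cube v ->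
  @cc_map R X t v = m -> D (line v j b) -> sgb R b * v 0 j = u0.
Hypothesis D_uniq : forall t (v : 'rV[R]_(cc_dim t)) j b k c, cube v ->
  @cc_map R X t v = m -> D (line v j b) -> D (line v k c) -> (j, b) = (k, c).

(** [D] singles out at most one oriented direction at [m], and [u0] is the height of [m] along it;
    [D] is empty in [dist_rep] and the direction of an edge in [toward]. If [D] selects no direction
    at [v], the height is 0 and [r] accounts for the whole distance. *)
Definition near_at t (y v : 'rV[R]_(cc_dim t)) (e r : R) :=
  [/\ cube v, @cc_map R X t v = m,
     forall j b, D (line v j b) -> sgb R b * y 0 j - u0 = e,
     (forall j b, ~ D (line v j b)) -> e = 0 &
     edist y v ^+ 2 = e ^+ 2 + r ^+ 2].

(* Near [m] the complex is a cone; the point [q] lies at height [e] in the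
   direction singled out by [D] and at distance [r] in the orthogonal ones. *)
Definition near (q : X) (e r : R) := 0 <= r /\
  forall t (y : 'rV[R]_(cc_dim t)), cube y -> @cc_map R X t y = q ->
  exists v, near_at y v e r.

(** One representative determines the others, because [v] lies in the face supporting [y] and is
    moved by the gluing isometry. If the direction of [D] is not free at [y], then [y] agrees with
    [v] there, and the height vanishes in every cube. *)
Lemma near_rep s (y v : 'rV[R]_(cc_dim s)) e r : cube y -> near_at y v e r ->
  0 <= r -> e ^+ 2 + r ^+ 2 < g ^+ 2 -> 0 <= g -> near (cc_map y) e r.
Proof.
move=> cy [cv vm De Dn yv] r0 erg g0; split=> // t y2 cy2 y2y.
have yvg : edist y v < g by rewrite -(@ltr_pXn2r _ 2) ?nnegrE ?edist_ge0// yv.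
have fv : face (supp y) v.
  by apply: face_suppI => // j nf; apply/esym/(gap_fixed g1 gm cv vm cy yvg nf).
have [h [hy hf hd fwd bwd]] := glue cy cy2 (esym y2y).
have [fhv hvm] := hf v fv.
have trans i j b0 : free y i -> free y2 j ->
    (forall z, face (supp y) z -> h z 0 j = sgb R b0 * z 0 i) ->
    forall b, line v i b = line (h v) j (b == b0).
  by move=> fi fj hj b; apply: (line_glue cy cy2 hf hd bwd fi fj hj).
have chv : cube (h v) by apply: face_cube fhv.
have hvm' : cc_map (h v) = m by rewrite -hvm.
have fy := supp_face cy.
have e0 j b : D (line v j b) -> ~~ free y j -> e = 0.
  move=> Dj nf; rewrite -(De j b Dj) (gap_fixed g1 gm cv vm cy yvg nf).
  by rewrite (D_height cv vm Dj) subrr.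
have en : (forall j b, D (line v j b) -> ~~ free y j) -> e = 0.
  move=> H; have [[j [b Dj]]|no] := pselect (exists j b, D (line v j b)).
    exact: e0 Dj (H _ _ Dj).
  by apply: Dn => j b Dj; apply: no; exists j, b.
exists (h v); split=> //.
- move=> j2 b2 Dj2; have [fj2|nf] := boolP (free y2 j2).
    have [i [b0 [fi E]]] := bwd j2 fj2; have := trans i j2 b0 fi fj2 E (b2 == b0).
    have -> : ((b2 == b0) == b0) = b2 by case: b2 b0 {Dj2 E} => [] [].
    move=> LE; rewrite -LE in Dj2.
    by rewrite -hy E// sgbM; apply: De Dj2.
  rewrite -(face_supp_fixed cy2 fhv nf) (D_height chv hvm' Dj2) subrr.
  apply/esym/en => j b Dj; apply/negP => fj.
  have [j' [b0 [fj' E]]] := fwd j fj; have := trans j j' b0 fj fj' E b => LE.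
  rewrite LE in Dj; have [jj' _] := D_uniq chv hvm' Dj Dj2.
  by rewrite -jj' fj' in nf.
- move=> no; apply: en => j b Dj; apply/negP => fj.
  have [j' [b0 [fj' E]]] := fwd j fj; have := trans j j' b0 fj fj' E b => LE.
  by apply: (no j' (b == b0)); rewrite -LE.
by rewrite -hy hd.
Qed.

(** Both ends are measured from the same [v]: the heights differ by the change of one coordinate,
    the radii by at most the change of the others. The bound [k] on the distance from [m] keeps the
    step inside the cone. *)
Lemma near_step s (a b : 'rV[R]_(cc_dim s)) e r k : cube a -> cube b ->
  near (cc_map a) e r -> 0 <= k -> e ^+ 2 + r ^+ 2 <= k ^+ 2 ->
  k + edist a b < g ->
  exists e' r', [/\ near (cc_map b) e' r',
    (e' - e) ^+ 2 + (r' - r) ^+ 2 <= edist a b ^+ 2 &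
    e' ^+ 2 + r' ^+ 2 <= (k + edist a b) ^+ 2].
Proof.
move=> ca cb [r0 /(_ s a ca erefl)[v [cv vm De Dn av]]] k0 erk kg.
have ab0 := edist_ge0 a b.
have avk : edist a v <= k.
  by rewrite -(@ler_pXn2r _ 2) ?nnegrE ?edist_ge0// av.
have bvk : edist b v <= k + edist a b.
  by have := edist_triangle a b v; rewrite [edist b a]edistC; lra.
have bvk2 : edist b v ^+ 2 <= (k + edist a b) ^+ 2.
  by rewrite ler_pXn2r ?nnegrE ?edist_ge0// addr_ge0.
have kg2 : (k + edist a b) ^+ 2 < g ^+ 2.
  by rewrite ltr_pXn2r ?nnegrE ?addr_ge0//; lra.
have g0 : 0 <= g by lra.
have [[j [b0 Dj]]|no] := pselect (exists j b, D (line v j b)); last first.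
  have no' j b0 : ~ D (line v j b0) by move=> Dj; apply: no; exists j, b0.
  have e0 := Dn no'; have rE : r = edist a v.
    by apply/eqP; rewrite -(@eqrXn2 _ 2) ?edist_ge0// av e0 expr0n add0r.
  exists 0, (edist b v); split.
  - apply: (near_rep cb (v := v)) => //; rewrite ?expr0n ?add0r ?edist_ge0//.
      by split=> //; [move=> j b0 /no'|rewrite expr0n add0r].
    exact: le_lt_trans kg2.
  - rewrite e0 subrr expr0n add0r -[leLHS]real_normK ?num_real//.
    rewrite ler_pXn2r ?nnegrE ?edist_ge0// rE ler_norml.
    have := edist_triangle a b v; have := edist_triangle b a v.
    by rewrite [edist b a]edistC => ? ?; apply/andP; split; lra.
  - by rewrite expr0n add0r.
pose P := fun k : 'I_(cc_dim s) => k != j.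
have split_dist (y : 'rV[R]_(cc_dim s)) : edist y v ^+ 2 =
    (sgb R b0 * y 0 j - u0) ^+ 2 + l2 P (fun k => y 0 k - v 0 k) ^+ 2.
  rewrite sqr_edist (bigD1 j)//= sqr_l2 -(D_height cv vm Dj) -mulrBr exprMn.
  by rewrite sqr_sgb mul1r.
have eE := De j b0 Dj.
have rE : r = l2 P (fun k => a 0 k - v 0 k).
  apply/eqP; rewrite -(@eqrXn2 _ 2) ?l2_ge0//; apply/eqP.
  by apply: (addrI (e ^+ 2)); rewrite -av split_dist eE.
exists (sgb R b0 * b 0 j - u0), (l2 P (fun k => b 0 k - v 0 k)); split.
- apply: (near_rep cb (v := v)) => //; rewrite -?split_dist ?l2_ge0//.
    split=> //; last by move=> /(_ j b0 Dj).
    by move=> j' b' Dj'; have [-> ->] := D_uniq cv vm Dj' Dj.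
  exact: le_lt_trans kg2.
- rewrite -eE opprD addrACA subrr addr0 -mulrBr exprMn sqr_sgb mul1r.
  rewrite edistC sqr_edist (bigD1 j)//= lerD2l -sqr_l2 rE.
  rewrite -[leLHS]real_normK ?num_real// ler_pXn2r ?nnegrE ?l2_ge0//.
  apply: le_trans (l2_dist _ _ _) _; rewrite le_eqVlt; apply/orP; left.
  by apply/eqP/eq_l2 => i _; rewrite opprB addrA subrK.
by rewrite -split_dist.
Qed.

(** Summing [near_step] by [minkowski2] shows that height and radius form a 1-Lipschitz map to the
    plane along paths that stay within [g] of [m]. *)
Lemma near_chain p q l : chain p q l -> forall e r k, near p e r ->
  0 <= k -> e ^+ 2 + r ^+ 2 <= k ^+ 2 -> k + l < g ->
  exists e' r', [/\ near q e' r',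
    (e' - e) ^+ 2 + (r' - r) ^+ 2 <= l ^+ 2 &
    e' ^+ 2 + r' ^+ 2 <= (k + l) ^+ 2].
Proof.
elim=> [x|s a b y l' ca cb bq IH] e r k np k0 erk kg.
  by exists e, r; rewrite !subrr expr0n !addr0; split.
have l'0 := chain_ge0 bq; have ab0 := edist_ge0 a b.
have [|e1 [r1 [n1 d1 k1]]] := near_step ca cb np k0 erk; first by lra.
have [|||e2 [r2 [n2 d2 k2]]] := IH e1 r1 (k + edist a b) n1 => //; try lra.
exists e2, r2; split=> //; last by rewrite addrA.
have -> : e2 - e = (e1 - e) + (e2 - e1) by ring.
have -> : r2 - r = (r1 - r) + (r2 - r1) by ring.
exact: minkowski2.
Qed.

End Near.
End Star.

(** * Distances near a point *)

Section LocalGeometry.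
Variables (R : realType) (X : cube_complex R).
Hypothesis hX : CAT0_cube_complex X.
Local Notation d := (@cc_dist R X).

(** By [near_chain] without a distinguished direction, a path from [m] to [q] is at least as long as
    the radius of [q]. The factor [1/2] makes the points [v] found for paths of different precision
    coincide, by [gap_uniq]. *)
Lemma dist_rep (m q : X) g t (y : 'rV[R]_(cc_dim t)) :
  g <= 1 -> gap m g -> d m q < g / 2 -> cube y -> cc_map y = q ->
  exists v, [/\ cube v, @cc_map R X t v = m & edist y v = d m q].
Proof.
move=> g1 gm mq cy yq; have d0 := dist_ge0 hX m q.
pose D := fun _ : R -> X => False.
have base : near m 0 D m 0 0.
  split=> // s z cz zm; exists z; split=> //.
  by rewrite edistxx expr0n addr0.
have approx l : chain m q l -> l < g -> exists v, [/\ cube v,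
    @cc_map R X t v = m & edist y v <= l].
  move=> mql lg; have l0 := chain_ge0 mql.
  have [||||e [r [[r0 nq] _ erl]]] :=
    near_chain (D := D) (u0 := 0) g1 gm _ _ mql base (lexx 0).
  - by move=> ? ? ? ? ? ? [].
  - by move=> ? ? ? ? ? ? ? ? [].
  - by rewrite expr0n addr0.
  - by rewrite add0r.
  have [v [cv vm _ _ yv]] := nq t y cy yq; exists v; split=> //.
  rewrite -(@ler_pXn2r _ 2) ?nnegrE ?edist_ge0// yv.
  by rewrite add0r in erl.
have [|l0 ml0 ll0] := dist_approx hX m q (k := g / 2 - d m q); first by lra.
have [|v [cv vm yv]] := approx l0 ml0; first by lra.
exists v; split=> //; apply/eqP; rewrite eq_le; apply/andP; split; last first.
  by rewrite -vm -yq edistC; apply: dist_seg.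
apply/ler_addgt0Pr => k k0; have k0' : 0 < Num.min k (g / 2 - d m q) by rewrite lt_min k0; lra.
have [l ml ll] := dist_approx hX m q k0'.
have lk : l < d m q + k by apply: lt_le_trans ll _; rewrite lerD2l ge_min lexx.
have lg : l < g / 2.
  have : Num.min k (g / 2 - d m q) <= g / 2 - d m q by rewrite ge_min lexx orbT.
  lra.
have [|w [cw wm yw]] := approx l ml; first by lra.
suff -> : v = w by lra.
apply: (gap_uniq g1 gm) => //; have := edist_triangle y v w; rewrite [edist v y]edistC; lra.
Qed.

(** The transverse coordinates are constant along [L], so one [g] serves all its points, up to the
    distance from the ends. *)
Lemma line_gap (L : R -> X) : is_line L -> exists2 g, 0 < g <= 1 &
  forall u, `|u| < 2^-1 -> forall g', g' <= g -> g' <= 2^-1 - `|u| -> gap (L u) g'.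
Proof.
move=> [s [x [i [b [cx ->]]]]].
have [|g g01 gP] := @fin_lower_bound R _ (fun j => free x j) (fun j => 2^-1 - `|x 0 j|).
  by move=> j fj; rewrite subr_gt0.
exists g => // u u2 g' g'g g'u; rewrite /line clamp_id ?(ltW u2)//.
apply: (gapI (x := upd x i (sgb R b * u))) => //.
  by apply: cube_upd => //; rewrite norm_sgb ltW.
move=> j; rewrite /free updE; case: eqP => [_ _|_ fj]; first by rewrite norm_sgb; lra.
by have := gP j fj; lra.
Qed.

(** By [dist_rep] the distance is realized in the cube of the line by some representative of [L u],
    and [gap_uniq] identifies it with the one on the line. *)
Lemma line_local_geodesic (L : R -> X) u0 : is_line L -> `|u0| < 2^-1 ->
  exists2 e, 0 < e <= 2^-1 - `|u0| &
  forall u v, `|u - u0| < e -> `|v - u0| < e -> d (L u) (L v) = `|u - v|.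
Proof.
move=> lL u02; have [g /andP[g0 g1] gP] := line_gap lL.
pose g' := Num.min g ((2^-1 - `|u0|) / 2).
have g'0 : 0 < g' by rewrite lt_min g0 /=; lra.
have g'g : g' <= g by rewrite ge_min lexx.
have g'u : g' <= (2^-1 - `|u0|) / 2 by rewrite ge_min lexx orbT.
exists (g' / 8); first by apply/andP; split; lra.
move=> u v uu vv.
have near0 w : `|w - u0| < g' / 8 -> `|w| <= `|u0| + g' / 8.
  by move=> ww; rewrite -(subrK u0 w); apply: le_trans (ler_normD _ _) _; lra.
have uv : `|u - v| < g' / 4.
  have -> : u - v = (u - u0) - (v - u0) by ring.
  by apply: le_lt_trans (ler_normB _ _) _; lra.
have u1 := near0 u uu; have v1 := near0 v vv.
have gu : gap (L u) g' by apply: gP => //; lra.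
have [s [x [i [b [cx LE]]]]] := lL.
have cu w : `|w| < 2^-1 -> cube (upd x i (sgb R b * w)).
  by move=> ww; apply: cube_upd => //; rewrite norm_sgb ltW.
have LwE w : `|w| < 2^-1 -> L w = cc_map (upd x i (sgb R b * w)).
  by move=> ww; rewrite LE /line clamp_id// ltW.
have cu1 : cube (upd x i (sgb R b * u)) by apply: cu; lra.
have cv1 : cube (upd x i (sgb R b * v)) by apply: cu; lra.
have Lu : L u = cc_map (upd x i (sgb R b * u)) by apply: LwE; lra.
have Lv : L v = cc_map (upd x i (sgb R b * v)) by apply: LwE; lra.
have euv : edist (upd x i (sgb R b * u)) (upd x i (sgb R b * v)) = `|u - v|.
  by rewrite edist_upd1 -mulrBr norm_sgb.
have duv : d (L u) (L v) <= `|u - v| by rewrite Lu Lv -euv; apply: dist_seg.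
have [||w [cw wu ew]] := dist_rep _ gu _ cv1 (esym Lv); try lra.
rewrite -ew; suff -> : w = upd x i (sgb R b * u) by rewrite edistC.
apply: (gap_uniq _ gu) => //; first by lra.
by have := edist_triangle (upd x i (sgb R b * v)) w (upd x i (sgb R b * u));
  rewrite [edist w (upd x i (sgb R b * v))]edistC ew [edist (upd x i (sgb R b * v)) _]edistC euv; lra.
Qed.

End LocalGeometry.

(** * Sides of a hyperplane *)

Module Lipschitz.
Import topology normedtype derive.
Import numFieldNormedType.Exports.
Section Lipschitz.
Variables (R : realType) (f : R -> R) (K : R).
Hypothesis lip : forall x y, `|f x - f y| <= K * `|x - y|.

Lemma lipschitz_continuous : continuous f.
Proof.
move=> x; apply/cvgrPdist_lt => e e0.
have K0 : 0 < `|K| + 1 by rewrite ltr_wpDl.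
near=> t; apply: le_lt_trans (lip _ _) _.
apply: (@le_lt_trans _ _ ((`|K| + 1) * `|x - t|)).
  by rewrite ler_wpM2r// (le_trans (ler_norm K))// lerDl.
rewrite mulrC -ltr_pdivlMr//; near: t.
by apply: (@cvgrPdist_lt _ _ _ _ _ id x).1 => //; rewrite divr_gt0.
Unshelve. all: by end_near.
Qed.

Lemma lipschitz_min a b : a <= b -> exists2 c, a <= c <= b &
  forall t, a <= t <= b -> f c <= f t.
Proof.
move=> ab; have [|c + H] := @EVT_min R f a b ab.
  exact: continuous_subspaceT lipschitz_continuous.
by rewrite in_itv /= => cab; exists c => // t tab; apply: H; rewrite in_itv.
Qed.

Lemma lipschitz_max a b : a <= b -> exists2 c, a <= c <= b &
  forall t, a <= t <= b -> f t <= f c.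
Proof.
move=> ab; have [|c + H] := @EVT_max R f a b ab.
  exact: continuous_subspaceT lipschitz_continuous.
by rewrite in_itv /= => cab; exists c => // t tab; apply: H; rewrite in_itv.
Qed.

Lemma lipschitz_sign a b : a <= b -> (forall t, a <= t <= b -> f t != 0) ->
  (f a < 0) = (f b < 0).
Proof.
move=> ab f0; apply: contrapT => /eqP ne.
have cf := @continuous_subspaceT _ _ `[a, b]%classic _ lipschitz_continuous.
have [|c] := @IVT R f a b 0 ab cf; last by rewrite in_itv /= => /f0 /eqP.
have [/andP[fa fb]|/andP[fb fa]] : f a <= 0 <= f b \/ f b <= 0 <= f a.
  by case: (ltP (f a) 0) ne => [/ltW|] fa; case: (ltP (f b) 0) => [/ltW|] fb // _;
    [left|right]; apply/andP.
- by rewrite ge_min le_max fa fb orbT.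
- by rewrite ge_min le_max fa fb orbT.
Qed.

End Lipschitz.
End Lipschitz.

Section Sides.
Variables (R : realType) (X : cube_complex R).
Hypothesis hX : CAT0_cube_complex X.
Local Notation d := (@cc_dist R X).

(* Walking along the geodesic to [z] in steps of length [e], the lifted height
   cannot change, since otherwise [L] would contain a point closer to [z].  As
   only finitely many lines pass through a point, one line can be used for
   approximations by paths of all precisions. *)
Lemma no_interior_min (L : R -> X) u0 z : is_line L -> `|u0| < 2^-1 ->
  (forall u, `|u| <= 2^-1 -> d (L u0) z <= d (L u) z) ->
  exists2 L', conn L L' & L' u0 = z.
Proof.
move=> + u02; set e := (2^-1 - `|u0|) / 2; have e0 : 0 < e by rewrite /e; lra.
have [n] : exists n : nat, d (L u0) z <= n%:R * e.
  exists (Num.truncn (d (L u0) z / e)).+1; rewrite -ler_pdivrMr//.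
  by rewrite ltW// truncnS_gt.
elim: n L => [|n IH] L Dn lL Lmin.
  exists L; first exact: conn_refl.
  apply: (dist_eq0 hX); apply/eqP; rewrite eq_le dist_ge0// andbT.
  by rewrite mul0r in Dn.
set m := L u0 in Dn Lmin *; set D := d m z in Dn Lmin *.
have D0 : 0 <= D by apply: dist_ge0.
pose t := Num.min e D; have tD : t <= D by rewrite ge_min lexx orbT.
have te : t <= e by rewrite ge_min lexx.
have t0 : 0 <= t by rewrite le_min ltW.
have [c [c0 c1 cd]] := geodesic_exists hX m z.
pose q := c t.
have mq : d m q = t.
  by rewrite -c0 cd ?lexx ?t0 ?D0 ?tD// sub0r normrN ger0_norm.
have qz : d q z = D - t.
  rewrite -[X in d _ X]c1 cd ?lexx ?t0 ?D0 ?tD//.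
  by rewrite distrC ger0_norm// subr_ge0.
have [s [x [cx xq]]] := cc_cover q.
pose good (p : 'I_(cc_dim s) * bool) k := exists l, [/\ bchain L (line x p.1 p.2) l,
  0 <= l & l ^+ 2 + (sgb R p.2 * x 0 p.1 - u0) ^+ 2 <= (t + k) ^+ 2].
have approx k : 0 < k -> k <= e -> exists p, good p k.
  move=> k0 ke; have [l mql lk] := dist_approx hX m q k0.
  have l0 := chain_ge0 mql.
  have [|L1 [u1 [k1 [qE bL u1h k10 kE]]]] := lift mql lL erefl.
    by move: ke te; rewrite /e mq in lk *; lra.
  have [_ lL1] := bchain_line bL.
  have [i [b [fi LE uE]]] := line_at lL1 u1h cx (etrans (esym qE) (esym xq)).
  exists (i, b), k1; rewrite /= -LE uE; split=> //; apply: le_trans kE _.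
  by rewrite ler_pXn2r ?nnegrE ?addr_ge0 ?(ltW k0)// -mq ltW.
have [[i b] ib] : exists p, forall k, 0 < k -> good p k.
  apply: contrapT => no.
  have /choice[kf kfP] : forall p, exists k, 0 < k /\ ~ good p k.
    move=> p; apply: contrapT => H; apply: no; exists p => k k0.
    by apply: contrapT => ng; apply: H; exists k.
  have [p _|k /andP[k0 k1] kmin] := @fin_lower_bound R _ xpredT kf; first by case: (kfP p).
  have [||p [l [bl l0 le]]] := approx (Num.min k e).
  - by rewrite lt_min k0.
  - by rewrite ge_min lexx orbT.
  case: (kfP p) => kp; apply; exists l; split=> //; apply: le_trans le _.
  rewrite ler_pXn2r ?nnegrE ?addr_ge0 ?le_min ?(ltW k0) ?(ltW e0) ?(ltW kp)//.
  by rewrite lerD2l ge_min kmin.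
set L1 := line x i b in ib; set u1 := sgb R b * x 0 i in ib.
rewrite /good /= -/L1 -/u1 in ib.
have lL1 : is_line L1 by apply: is_line_line.
have L1u1 : L1 u1 = q by rewrite /L1 line_point.
have u1h : `|u1| <= 2^-1 by rewrite norm_sgb.
have bound u l : bchain L L1 l -> d (L u) (L1 u) <= l.
  by move=> bl; apply: (dist_le_chain hX); apply: bchain_chain.
(* The point [L1 u1 = q] is at distance [D - t] from [z], so for [l < t] the point [L u1] would be
   closer to [z] than [m]. *)
have tl l : bchain L L1 l -> t <= l.
  move=> bl; have := Lmin u1 u1h; have := dist_triangle hX q (L u1) z.
  by have := bound u1 l bl; rewrite L1u1 qz -/D; lra.
have u10 : u1 = u0.
  apply/eqP; rewrite -subr_eq0 -sqrf_eq0; apply/negPn/negP => ne.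
  set E := (u1 - u0) ^+ 2 in ne.
  have Ep : 0 < E by rewrite lt_def ne sqr_ge0.
  (* Small enough for [(t + k) ^+ 2 < t ^+ 2 + E], which is incompatible with [t <= l]. *)
  pose k := Num.min 1 (E / (2 * (2 * t + 1))).
  have k0 : 0 < k by rewrite lt_min ltr01 divr_gt0// mulr_gt0//; lra.
  have kE : k * (2 * (2 * t + 1)) <= E.
    by rewrite -ler_pdivlMr ?ge_min ?lexx ?orbT// mulr_gt0//; lra.
  have k1 : k <= 1 by rewrite ge_min lexx.
  have [l [bl l0 le]] := ib k k0; have := tl l bl; rewrite -/E in le => tl'.
  have : t ^+ 2 <= l ^+ 2 by rewrite ler_pXn2r ?nnegrE.
  nra.
rewrite u10 in L1u1.
have L1min u : `|u| <= 2^-1 -> d (L1 u0) z <= d (L1 u) z.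
  move=> u2; rewrite L1u1 qz; apply/ler_addgt0Pr => k k0.
  have [l [bl l0 le]] := ib k k0.
  have lk : l <= t + k.
    rewrite -(@ler_pXn2r _ 2) ?nnegrE ?addr_ge0 ?(ltW k0)//.
    by apply: le_trans le; rewrite lerDl sqr_ge0.
  have := Lmin u u2; have := dist_triangle hX (L1 u) (L u) z.
  by have := bound u l bl; lra.
have [|L' L1L' L'z] := IH L1 _ lL1 L1min.
  rewrite L1u1 qz; move: Dn; rewrite -natr1 mulrDl mul1r /t.
  case: (leP e D) => ?; first by lra.
  by move=> _; rewrite subrr mulr_ge0// ltW.
exists L' => //; apply: conn_trans L1L'.
by have [l [bl _ _]] := ib 1 ltr01; exists l.
Qed.

(** Around an interior point the line is geodesic, so [stewart] at the midpoint of a short segment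
    shows that one of its ends is farther from [z]. *)
Lemma no_interior_max (L : R -> X) u0 z : is_line L -> `|u0| < 2^-1 ->
  exists2 u, `|u| <= 2^-1 & d (L u0) z < d (L u) z.
Proof.
move=> lL u02; have [e /andP[e0 eu] H] := line_local_geodesic hX lL u02.
have ha : `|u0 - e / 2 - u0| = e / 2 by rewrite addrAC subrr sub0r normrN gtr0_norm ?divr_gt0.
have hb : `|u0 + e / 2 - u0| = e / 2 by rewrite addrAC subrr add0r gtr0_norm ?divr_gt0.
have h0 : `|u0 - u0| < e by rewrite subrr normr0.
have ea : `|u0 - e / 2 - u0| < e by rewrite ha; lra.
have eb : `|u0 + e / 2 - u0| < e by rewrite hb; lra.
have na : `|u0 - e / 2| <= 2^-1.
  by apply: le_trans (ler_normB _ _) _; rewrite [X in _ + X]gtr0_norm ?divr_gt0//; lra.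
have nb : `|u0 + e / 2| <= 2^-1.
  by apply: le_trans (ler_normD _ _) _; rewrite [X in _ + X]gtr0_norm ?divr_gt0//; lra.
have dab : d (L (u0 - e / 2)) (L (u0 + e / 2)) = e.
  rewrite H//; have -> : u0 - e / 2 - (u0 + e / 2) = - e by lra.
  by rewrite normrN gtr0_norm.
have h01 : (0 <= 2^-1 :> R) && (2^-1 <= 1 :> R) by apply/andP; split; lra.
have d1 : d (L (u0 - e / 2)) (L u0) = 2^-1 * d (L (u0 - e / 2)) (L (u0 + e / 2)).
  by rewrite dab H// ha; lra.
have d2 : d (L u0) (L (u0 + e / 2)) = (1 - 2^-1) * d (L (u0 - e / 2)) (L (u0 + e / 2)).
  by rewrite dab H// distrC hb; lra.
have := @stewart _ _ hX _ z _ _ _ h01 d1 d2; rewrite dab => S.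
have [la|la] := ltP (d (L u0) z) (d (L (u0 - e / 2)) z); first by exists (u0 - e / 2).
have [lb|lb] := ltP (d (L u0) z) (d (L (u0 + e / 2)) z); first by exists (u0 + e / 2).
exfalso; move: S la lb; rewrite ![d z _](distC hX).
set x := d (L u0) z; set a := d (L (u0 - _)) z; set b := d (L (u0 + _)) z.
have a0 : 0 <= a by apply: dist_ge0. have b0 : 0 <= b by apply: dist_ge0.
nra.
Qed.

(* The point [z] is not in the open carrier of the hyperplane of [L]. *)
Definition offc (L : R -> X) z := forall L' u, conn L L' -> `|u| < 2^-1 -> L' u <> z.

Lemma offc_conn L L' z : conn L L' -> offc L z -> offc L' z.
Proof. by move=> LL' H L'' u L'L''; apply: H; apply: conn_trans L'L''. Qed.

Lemma clamp_lip (u v : R) : `|clamp u - clamp v| <= `|u - v|.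
Proof.
wlog uv : u v / u <= v.
  move=> H; case: (leP u v) => [/H//|/ltW/H]; by rewrite distrC [leRHS]distrC.
have h0 := inv2_gt0 R.
have cl (w : R) : [\/ w <= - 2^-1 /\ clamp w = - 2^-1,
    [/\ - 2^-1 <= w, w <= 2^-1 & clamp w = w] | 2^-1 <= w /\ clamp w = 2^-1].
  have [w1|/ltW w1] := lerP w (- 2^-1).
    have w2 : w <= 2^-1 by lra.
    by apply: Or31; split=> //; rewrite /clamp (min_r w2) max_l.
  have [w2|/ltW w2] := lerP w 2^-1.
    by apply: Or32; split=> //; rewrite clamp_id// ler_norml w1.
  by apply: Or33; split=> //; rewrite /clamp (min_l w2) max_r//; lra.
rewrite distrC [leRHS]distrC (ger0_norm (_ : 0 <= v - u)) ?subr_ge0//.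
rewrite ler_norml; apply/andP.
by case: (cl u) => [[? ->]|[? ? ->]|[? ->]]; case: (cl v) => [[? ->]|[? ? ->]|[? ->]]; split; lra.
Qed.

Lemma line_lip (L : R -> X) u v : is_line L -> d (L u) (L v) <= `|u - v|.
Proof.
move=> [s [x [i [b [cx ->]]]]]; apply: le_trans (clamp_lip u v).
rewrite -(norm_sgb b) mulrBr -(edist_upd1 x i); apply: (dist_seg hX).
  exact/cube_upd/sclamp_le.
exact/cube_upd/sclamp_le.
Qed.

Lemma dist_lip p q z : `|d p z - d q z| <= d p q.
Proof.
rewrite ler_norml; have := dist_triangle hX q p z; have := dist_triangle hX p q z.
by rewrite [d q p](distC hX) => ? ?; apply/andP; split; lra.
Qed.

Lemma line_dist_lip (L : R -> X) z : is_line L ->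
  forall u v, `|d (L u) z - d (L v) z| <= 1 * `|u - v|.
Proof. by move=> lL u v; rewrite mul1r; apply: le_trans (dist_lip _ _ _) (line_lip _ _ lL). Qed.

Lemma interior_cases (c : R) : - 2^-1 <= c <= 2^-1 ->
  [\/ `|c| < 2^-1, c = - 2^-1 | c = 2^-1].
Proof.
move=> /andP[c1 c2]; have [->|n1] := eqVneq c (- 2^-1); first exact: Or32.
have [->|n2] := eqVneq c 2^-1; first exact: Or33.
by apply: Or31; rewrite ltr_norml !lt_neqAle n2 c2 eq_sym n1 c1.
Qed.

Lemma half_le : - 2^-1 <= 2^-1 :> R.
Proof. by have := inv2_gt0 R; lra. Qed.

Lemma line_min (L : R -> X) z : is_line L -> offc L z ->
  (forall u, `|u| <= 2^-1 -> d (L (- 2^-1)) z <= d (L u) z) \/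
  (forall u, `|u| <= 2^-1 -> d (L 2^-1) z <= d (L u) z).
Proof.
move=> lL off; have [c cI cmin] := Lipschitz.lipschitz_min (line_dist_lip z lL) half_le.
have cm u : `|u| <= 2^-1 -> d (L c) z <= d (L u) z by rewrite ler_norml; apply: cmin.
have [ch|cE|cE] := interior_cases cI; [|by left; rewrite cE in cm|by right; rewrite cE in cm].
by have [L' LL' /(off _ _ LL' ch)] := no_interior_min lL ch cm.
Qed.

Lemma line_max (L : R -> X) z : is_line L ->
  (forall u, `|u| <= 2^-1 -> d (L u) z <= d (L (- 2^-1)) z) \/
  (forall u, `|u| <= 2^-1 -> d (L u) z <= d (L 2^-1) z).
Proof.
move=> lL; have [c cI cmax] := Lipschitz.lipschitz_max (line_dist_lip z lL) half_le.
have cm u : `|u| <= 2^-1 -> d (L u) z <= d (L c) z by rewrite ler_norml; apply: cmax.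
have [ch|cE|cE] := interior_cases cI; [|by left; rewrite cE in cm|by right; rewrite cE in cm].
have [u u2] := no_interior_max z lL ch; rewrite ltNge => /negP; case; exact: cm.
Qed.

Lemma norm_half : `|2^-1| = 2^-1 :> R. Proof. by rewrite gtr0_norm// inv2_gt0. Qed.

(** If the two distances agreed, both ends would attain the minimum and the maximum over [L]; the
    distance would be constant and the midpoint an interior minimum. *)
Lemma ends_neq (L : R -> X) z : is_line L -> offc L z ->
  d (L 2^-1) z <> d (L (- 2^-1)) z.
Proof.
move=> lL off E.
have mn u : `|u| <= 2^-1 -> d (L 2^-1) z <= d (L u) z.
  by case: (line_min lL off) => H /H; rewrite ?E.
have mx u : `|u| <= 2^-1 -> d (L u) z <= d (L 2^-1) z.
  by case: (line_max z lL) => H /H; rewrite ?E.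
have z2 : `|0 : R| < 2^-1 by rewrite normr0 inv2_gt0.
have [|L' LL' /(off _ _ LL' z2)//] := @no_interior_min L 0 z lL z2.
by move=> u u2; apply: le_trans (mn u u2); apply: mx; rewrite ltW.
Qed.

(** The minimum over [L] is attained at an end, and not at [- 2^-1]. *)
Lemma toward_of_interior (L : R -> X) z u : is_line L -> offc L z ->
  `|u| <= 2^-1 -> d (L u) z < d (L (- 2^-1)) z -> d (L 2^-1) z < d (L (- 2^-1)) z.
Proof.
move=> lL off u2 ul; have [/(_ u u2)|/(_ u u2)] := line_min lL off; first by lra.
by move=> H; apply: le_lt_trans H ul.
Qed.

(** Otherwise [L u] would be an interior maximum. *)
Lemma interior_of_toward (L : R -> X) z u : is_line L ->
  `|u| < 2^-1 -> d (L 2^-1) z < d (L (- 2^-1)) z -> d (L u) z < d (L (- 2^-1)) z.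
Proof.
move=> lL u2 lt; have h2 : `|- 2^-1| <= 2^-1 :> R by rewrite normrN norm_half.
have [mx|/(_ _ h2)] := line_max z lL; last by lra.
rewrite ltNge; apply/negP => ge; have [v v2] := no_interior_max z lL u2.
by rewrite ltNge => /negP; apply; apply: le_trans (mx v v2) ge.
Qed.

Definition side (z : X) (L : R -> X) : bool := d (L 2^-1) z < d (L (- 2^-1)) z.

(** Sliding the line from [a] to [b] changes the difference of the end distances continuously, and
    [ends_neq] keeps it from vanishing. *)
Lemma side_seg z s (a b : 'rV[R]_(cc_dim s)) i c : cube a -> cube b ->
  offc (line a i c) z -> side z (line a i c) = side z (line b i c).
Proof.
move=> ca cb off.
(* Clamping makes [x w] a point of the cube for every real [w], so that [F] is Lipschitz on all of
   [R]. *)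
pose x (w : R) := interp (clamp w + 2^-1) a b.
have c01 w : 0 <= clamp w + 2^-1 <= 1.
  by have := clamp_le w; rewrite ler_norml => /andP[? ?]; apply/andP; split; lra.
have cx w : cube (x w) by apply: cube_interp.
pose F w := d (line (x w) i c 2^-1) z - d (line (x w) i c (- 2^-1)) z.
have elip w w' u : d (line (x w) i c u) (line (x w') i c u) <= edist a b * `|w - w'|.
  have cs := sclamp_le c u.
  apply: le_trans (dist_seg hX (cube_upd i (cx w) cs) (cube_upd i (cx w') cs)) _.
  rewrite edist_upd; apply: (@le_trans _ _ (edist (x w) (x w'))).
    rewrite -(@ler_pXn2r _ 2) ?nnegrE ?edist_ge0//.
    have := sqr_edist_upd (x w) (x w') i (x w 0 i) (x w' 0 i).
    by rewrite !upd_id => ->; rewrite lerDl sqr_ge0.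
  rewrite edist_interp mulrC; apply: ler_wpM2l; first exact: edist_ge0.
  have -> : clamp w + 2^-1 - (clamp w' + 2^-1) = clamp w - clamp w' by ring.
  exact: clamp_lip.
have Flip w w' : `|F w - F w'| <= (2 * edist a b) * `|w - w'|.
  have -> : F w - F w' = (d (line (x w) i c 2^-1) z - d (line (x w') i c 2^-1) z) -
     (d (line (x w) i c (- 2^-1)) z - d (line (x w') i c (- 2^-1)) z) by rewrite /F; ring.
  apply: le_trans (ler_normB _ _) _; rewrite -mulrA mulr_natl mulr2n.
  by apply: lerD; apply: le_trans (dist_lip _ _ _) (elip _ _ _).
have F0 w : - 2^-1 <= w <= 2^-1 -> F w != 0.
  move=> _; rewrite subr_eq0; apply/eqP/ends_neq; first exact: is_line_line.
  exact: offc_conn (conn_seg i c ca (cx w)) off.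
have := Lipschitz.lipschitz_sign Flip half_le F0.
have xa : x (- 2^-1) = a by rewrite /x clamp_id ?normrN ?norm_half// addNr interp0.
have xb : x 2^-1 = b.
  rewrite /x clamp_id ?norm_half//; have -> : 2^-1 + 2^-1 = 1 :> R by lra.
  exact: interp1.
by rewrite /F xa xb !subr_lt0.
Qed.

Lemma side_conn z L L' : conn L L' -> offc L z -> side z L = side z L'.
Proof.
move=> [l]; elim=> // s a b i c M k ca cb _ IH off.
by rewrite -IH ?(side_seg ca cb off)//; apply: offc_conn off; apply: conn_seg.
Qed.

Lemma side_flip z L : is_line L -> offc L z -> side z (flip L) = ~~ side z L.
Proof.
move=> lL off; rewrite /side /flip opprK -leNgt lt_neqAle.
by case: eqP => // E; case: (ends_neq lL off).
Qed.

End Sides.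

(** * Edges and vertices *)

Section Edges.
Variables (R : realType) (X : cube_complex R).
Hypothesis hX : CAT0_cube_complex X.
Local Notation d := (@cc_dist R X).

Definition is_corner n (v : 'rV[R]_n) := cube v /\ forall k, ~~ free v k.

Lemma corner_val n (v : 'rV[R]_n) k : is_corner v -> `|v 0 k| = 2^-1.
Proof. by move=> [cv nf]; apply: half_norm. Qed.

Lemma corner_valP n (v : 'rV[R]_n) k : is_corner v -> v 0 k = 2^-1 \/ v 0 k = - 2^-1.
Proof.
move=> /corner_val - /(_ k)/eqP; rewrite eqr_norml => /andP[/orP[] /eqP-> _].
  by left.
by right.
Qed.

Lemma corner_upd n (v : 'rV[R]_n) k a : is_corner v -> `|a| = 2^-1 -> is_corner (upd v k a).
Proof.
move=> [cv nf] a2; split; first by apply: cube_upd; rewrite ?a2.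
by move=> j; rewrite /free updE; case: eqP => _; [rewrite a2 ltxx|exact: nf].
Qed.

Lemma corner_vertex s (v : 'rV[R]_(cc_dim s)) : is_corner v -> is_vertex (@cc_map R X s v).
Proof.
move=> [cv nf]; exists s, (supp v); split.
  by move=> i si; have := nf i; rewrite -suppP// si.
apply/seteqP; split=> [_ ->|_ [y fy <-]].
  by exists v => //; apply: supp_face.
suff -> : y = v by [].
by apply/rowP => i; apply: face_supp_fixed fy (nf i).
Qed.

(** By [line_rep], a free coordinate of [x] would give one to a corner representing the same
    vertex. *)
Lemma vertex_corner s (x : 'rV[R]_(cc_dim s)) : is_vertex (@cc_map R X s x) ->
  cube x -> is_corner x.
Proof.
move=> [t [f [fN E]]] cx; split=> // i; apply/negP => fi.
have : [set cc_map x] (cc_map x) by [].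
rewrite E => -[y fy yx]; have cy : cube y by apply: face_cube fy.
have [j [c [fj _ _]]] := line_rep true cx cy (esym yx) fi.
have := fy j; case: (f j) (fN j) => [b _ yj|//]; move: fj; rewrite /free yj.
by case: b {yj}; rewrite ?normrN norm_half ltxx.
Qed.

Lemma vertexP p : is_vertex p ->
  exists s (v : 'rV[R]_(cc_dim s)), is_corner v /\ @cc_map R X s v = p.
Proof.
move=> vp; have [s [x [cx xp]]] := cc_cover p; exists s, x; split=> //.
by apply: vertex_corner; rewrite ?xp.
Qed.

(** A line through a point at interior height makes a coordinate free there, and a vertex has
    none. *)
Lemma vertex_offc z (L : R -> X) : is_vertex z -> offc L z.
Proof.
move=> vz L' u [l /bchain_line[_ lL']] u2 L'u.
have [s [v [cv vz']]] := vertexP vz.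
have [j [c [fj _ _]]] := line_at lL' u2 cv.1 (etrans L'u (esym vz')).
by have := cv.2 j; rewrite fj.
Qed.

Definition is_edge (E : R -> X) :=
  exists s (v : 'rV[R]_(cc_dim s)) i b, is_corner v /\ E = line v i b.

Lemma edge_line E : is_edge E -> is_line E.
Proof. by move=> [s [v [i [b [[cv _] ->]]]]]; apply: is_line_line. Qed.

Lemma edge_end E u : is_edge E -> `|u| = 2^-1 -> is_vertex (E u).
Proof.
move=> [s [v [i [b [cv ->]]]]] u2; rewrite /line clamp_id ?u2//.
by apply/corner_vertex/corner_upd; rewrite ?norm_sgb.
Qed.

Lemma normN_half : `|- 2^-1| = 2^-1 :> R. Proof. by rewrite normrN norm_half. Qed.

(** An interior point of an edge has a single free coordinate, so a line through it at interior
    height is the edge in one of its two orientations. *)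
Lemma edge_offc E L u : is_edge E -> `|u| < 2^-1 -> ~ conn L E -> ~ conn L (flip E) ->
  offc L (E u).
Proof.
move=> [s [v [i [b [[cv nf] ->]]]]] u2 nc nr L' u' LL' u'2.
rewrite {1}/line clamp_id ?(ltW u2)// => LE'.
have [l bl] := LL'; have [_ lL'] := bchain_line bl.
have cu : cube (upd v i (sgb R b * u)) by apply: cube_upd; rewrite ?norm_sgb// ltW.
have [j [c [fj LE _]]] := line_at lL' u'2 cu LE'.
have ji : j = i.
  apply/eqP; apply: contraT => /negPf ji; move: fj; rewrite /free updE ji.
  by have := nf j; rewrite /free => /negPf->.
rewrite ji line_upd in LE; rewrite LE in LL'.
have [cb|/negPf cb] := eqVneq c b; first by apply: nc; rewrite -cb.
have cN : c = ~~ b by move: cb; case: (c) (b) => [] [].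
by apply: nr; rewrite flip_line -cN.
Qed.

(** A point moving along [E] stays off the open carrier of [L] by [edge_offc], so the difference of
    its distances to the ends of [L] keeps its sign. *)
Lemma side_edge E L : is_edge E -> is_line L -> ~ conn L E -> ~ conn L (flip E) ->
  side (E (- 2^-1)) L = side (E 2^-1) L.
Proof.
move=> eE lL nc nr.
pose F u := d (L 2^-1) (E u) - d (L (- 2^-1)) (E u).
have lE := edge_line eE.
have Flip u v : `|F u - F v| <= 2 * `|u - v|.
  have -> : F u - F v = (d (E u) (L 2^-1) - d (E v) (L 2^-1)) -
     (d (E u) (L (- 2^-1)) - d (E v) (L (- 2^-1))).
    by rewrite /F ![d (E _) _](distC hX); ring.
  apply: le_trans (ler_normB _ _) _; rewrite mulr_natl mulr2n.
  by apply: lerD; apply: le_trans (dist_lip hX _ _ _) (line_lip hX _ _ lE).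
have F0 u : - 2^-1 <= u <= 2^-1 -> F u != 0.
  move=> /interior_cases uI; rewrite subr_eq0; apply/eqP/(ends_neq hX lL).
  case: uI => [u2|->|->]; first exact: edge_offc.
    exact/vertex_offc/edge_end/normN_half.
  exact/vertex_offc/edge_end/norm_half.
by have := Lipschitz.lipschitz_sign Flip (half_le R) F0; rewrite /F !subr_lt0.
Qed.

Lemma edge_ends_neq E : is_edge E -> E 2^-1 <> E (- 2^-1).
Proof.
move=> eE E1; have v1 := edge_end eE normN_half.
by have := ends_neq hX (edge_line eE) (vertex_offc v1); rewrite E1.
Qed.

Lemma side_self E : is_edge E -> side (E 2^-1) E /\ ~~ side (E (- 2^-1)) E.
Proof.
move=> eE; rewrite /side !(distxx hX); split; last by rewrite -leNgt (dist_ge0 hX).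
by rewrite lt_def (dist_ge0 hX) andbT; apply/eqP => /(dist_eq0 hX)/esym/(edge_ends_neq eE).
Qed.

(* If [E] were both edges of a square at [v], then its far end would be on both
   sides of the edge [F] of this square that is parallel to [E]. *)
Lemma edge_dir_uniq s (v : 'rV[R]_(cc_dim s)) j b k c : is_corner v ->
  line v j b = line v k c :> (R -> X) -> j = k.
Proof.
move=> cv jk; apply/eqP; apply: contraT => njk.
pose E : R -> X := line v j b; pose w := upd v k (- v 0 k).
have cw : is_corner w by apply: corner_upd; rewrite ?normrN ?corner_val.
pose F : R -> X := line w j b.
have eE : is_edge E by exists s, v, j, b.
have eF : is_edge F by exists s, w, j, b.
pose h := sgb R b * v 0 j.
have h2 : `|h| = 2^-1 by rewrite norm_sgb corner_val.
have Fh : F h = cc_map w.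
  by rewrite /F -(line_point j b cw.1); congr line; rewrite /h /w updE (negPf njk).
have hk : h = sgb R c * v 0 k.
  have Eh : E h = E (sgb R c * v 0 k).
    by rewrite {2}/E jk line_point ?/E ?line_point//; case: cv.
  have hk2 : `|sgb R c * v 0 k| = 2^-1 by rewrite norm_sgb corner_val.
  apply: contrapT => ne; have NE := edge_ends_neq eE.
  move/eqP: h2; move/eqP: hk2; rewrite !eqr_norml.
  move=> /andP[/orP[]/eqP E1 _] /andP[/orP[]/eqP E2 _]; rewrite E1 E2 in Eh ne => //.
  by apply: NE; rewrite Eh.
have EF : E (- h) = F h.
  rewrite Fh /E jk /line clamp_id ?normrN ?h2// hk mulrN sgbK.
  by rewrite /w.
have conEF : conn E F by apply: conn_seg; [case: cv|case: cw].
have [E1 E2] := side_self eE; have [F1 F2] := side_self eF.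
have vEh : is_vertex (E (- h)) by apply: edge_end => //; rewrite normrN.
have := side_conn hX conEF (vertex_offc vEh).
move: h2 => /eqP; rewrite eqr_norml => /andP[/orP[]/eqP hE _].
  by rewrite {2}EF hE (negPf E2) F1.
by rewrite {2}EF hE opprK E1 (negPf F2).
Qed.

(** The orientation for which the corner [v] is the start of the line, at height [- 2^-1]. *)
Definition inward n (v : 'rV[R]_n) j := v 0 j < 0.

Lemma inwardE n (v : 'rV[R]_n) j : is_corner v -> sgb R (inward v j) * v 0 j = - 2^-1.
Proof.
have h0 := inv2_gt0 R; rewrite /inward.
move=> /corner_valP - /(_ j)[]->; last by rewrite oppr_lt0 h0 /sgb mul1r.
by rewrite ltNge ltW//= /sgb mulN1r.
Qed.

Lemma corner_start s (v : 'rV[R]_(cc_dim s)) j : is_corner v ->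
  line v j (inward v j) (- 2^-1) = @cc_map R X s v.
Proof. by move=> cv; rewrite -(inwardE j cv) line_point//; case: cv. Qed.

Lemma edge_height E s (v : 'rV[R]_(cc_dim s)) j b : is_edge E -> is_corner v ->
  cc_map v = E (- 2^-1) -> line v j b = E -> sgb R b * v 0 j = - 2^-1.
Proof.
move=> eE cv vE LE; have := line_point (X := X) j b cv.1; rewrite LE vE.
have /eqP : `|sgb R b * v 0 j| = 2^-1 by rewrite norm_sgb corner_val.
rewrite eqr_norml => /andP[/orP[]/eqP-> _] // /(edge_ends_neq eE) [].
Qed.

Lemma sgb_inj b c (a : R) : `|a| = 2^-1 -> sgb R b * a = sgb R c * a -> b = c.
Proof.
have h0 := inv2_gt0 R.
move=> /eqP; rewrite eqr_norml => /andP[/orP[]/eqP-> _]; case: b c => [] []; rewrite /sgb //; lra.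
Qed.

(* [J] consists of the initial directions of the geodesic from [p] to [z].  Any other
   edge [E] makes an angle of at least [pi / 2] with the geodesic, and then [p] is
   its point closest to [z] by [stewart]. *)
Lemma toward p z : is_vertex p -> is_vertex z -> p <> z ->
  exists s (v : 'rV[R]_(cc_dim s)) (J : pred 'I_(cc_dim s)),
  [/\ is_corner v, @cc_map R X s v = p, exists j, J j,
     forall j, J j -> side z (line v j (inward v j)) &
     forall E, is_edge E -> E (- 2^-1) = p -> side z E ->
       exists2 j, J j & E = line v j (inward v j)].
Proof.
move=> vp vz pz; set D := d p z.
have D0 : 0 < D.
  by rewrite lt_def (dist_ge0 hX) andbT; apply/eqP => /(dist_eq0 hX).
(* At most [8^-1], so that the paths considered below stay in the cone at [p], which has gap 1. *)
pose T := Num.min 8^-1 D.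
have TD : T <= D by rewrite ge_min lexx orbT.
have T8 : T <= 8^-1 by rewrite ge_min lexx.
have T0 : 0 < T by rewrite lt_min D0 invr_gt0 ltr0n.
have [c [c0 c1 cd]] := geodesic_exists hX p z.
pose q := c T.
have pq : d p q = T.
  by rewrite -c0 cd ?lexx ?(ltW T0) ?(ltW D0) ?TD// sub0r normrN ger0_norm// ltW.
have qz : d q z = D - T.
  rewrite -[X in d _ X]c1 cd ?lexx ?(ltW T0) ?(ltW D0) ?TD//.
  by rewrite distrC ger0_norm// subr_ge0.
have gp : gap p 1.
  move=> t w cw wp j fj; have [_ /(_ j)] : is_corner w.
    by apply: vertex_corner => //; rewrite wp.
  by rewrite fj.
have [s [y [cy yq]]] := cc_cover q.
have [|v [cv vp' yv]] := dist_rep hX (lexx 1) gp _ cy yq; first by rewrite pq; lra.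
have kv : is_corner v by apply: vertex_corner => //; rewrite vp'.
rewrite pq in yv.
pose J := [pred j | y 0 j != v 0 j].
exists s, v, J; split=> //.
- apply: contrapT => no; move: T0; rewrite -yv.
  suff -> : y = v by rewrite edistxx ltxx.
  by apply/rowP => j; apply/eqP; apply: contraT => yj; case: no; exists j.
- move=> j /= yj; set b := inward v j.
  (* Moving from [v] in direction [j] alone, up to the coordinate of [y], already brings the point
     within less than [T] of [q], hence closer to [z] than [p]. *)
  have cw : cube (upd v j (y 0 j)) by apply: cube_upd.
  apply: (toward_of_interior hX (u := sgb R b * y 0 j)).
  + exact: is_line_line.
  + exact: vertex_offc.
  + by rewrite norm_sgb.
  rewrite corner_start// vp' -/D.
  have -> : line v j b (sgb R b * y 0 j) = @cc_map R X s (upd v j (y 0 j)).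
    by rewrite /line clamp_id ?norm_sgb// sgbK.
  apply: le_lt_trans (dist_triangle hX q _ _) _; rewrite qz -yq.
  have := dist_seg hX cw cy.
  have : edist (upd v j (y 0 j)) y < T.
    rewrite -yv -(@ltr_pXn2r _ 2) ?nnegrE ?edist_ge0// !sqr_edist.
    rewrite (bigD1 j)//= [ltRHS](bigD1 j)//= updE eqxx subrr expr0n add0r.
    rewrite (_ : \sum_(i < _ | _) _ = \sum_(i < cc_dim s | i != j) (y 0 i - v 0 i) ^+ 2).
      by rewrite ltrDr lt_def sqr_ge0 sqrf_eq0 subr_eq0 yj.
    by apply: eq_bigr => i /negPf ij; rewrite updE ij -sqrrN opprB.
  lra.
move=> E eE Ep Ez; apply: contrapT => noJ.
have lE := edge_line eE.
pose q' := E (- 2^-1 + 8^-1).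
have dp : d p q' <= 8^-1.
  rewrite -Ep; apply: le_trans (line_lip hX _ _ lE) _.
  by rewrite opprD addrA subrr sub0r normrN ger0_norm// invr_ge0.
have u8 : `|- 2^-1 + 8^-1 : R| < 2^-1 by rewrite ltr_norml; apply/andP; split; lra.
have q'z : d q' z < D by rewrite /D -Ep; apply: (interior_of_toward hX).
pose Dr := fun L : R -> X => L = E.
have height t (w : 'rV[R]_(cc_dim t)) j b : cube w -> cc_map w = p ->
    Dr (line w j b) -> sgb R b * w 0 j = - 2^-1.
  move=> cw wp LE; apply: edge_height LE => //; last by rewrite wp.
  by apply: vertex_corner; rewrite ?wp.
have uniq t (w : 'rV[R]_(cc_dim t)) j b k b' : cube w -> cc_map w = p ->
    Dr (line w j b) -> Dr (line w k b') -> (j, b) = (k, b').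
  move=> cw wp L1 L2.
  have kw : is_corner w by apply: vertex_corner; rewrite ?wp.
  have jk : j = k by apply: (edge_dir_uniq kw (etrans L1 (esym L2))).
  rewrite -jk in L2 *; congr pair; apply: (sgb_inj (corner_val j kw)).
  by rewrite (height _ _ _ _ cw wp L1) (height _ _ _ _ cw wp L2).
have base : near p (- 2^-1) Dr q' 8^-1 0.
  have [t [w [i [b [kw EL]]]]] := eE.
  pose w0 := upd w i (- (sgb R b * 2^-1)); pose y0 := upd w i (sgb R b * (- 2^-1 + 8^-1)).
  have kw0 : is_corner w0 by apply: corner_upd; rewrite ?normrN ?norm_sgb ?norm_half.
  have cy0 : cube y0 by apply: cube_upd; [case: kw|rewrite norm_sgb ltW].
  have w0p : cc_map w0 = p by rewrite -Ep EL /line clamp_id ?normN_half// mulrN.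
  have y0q' : cc_map y0 = q' by rewrite /q' EL /line clamp_id// ltW.
  rewrite -y0q'; apply: (near_rep (lexx 1) gp height uniq cy0 (v := w0)) => //.
  - have LE : line w0 i b = E by rewrite EL /w0 line_upd.
    split=> //; first by case: kw0.
    + move=> j b' L2; have [<- <-] := uniq _ _ _ _ _ _ kw0.1 w0p LE L2.
      by rewrite updE eqxx sgbK; lra.
    + by move=> /(_ i b LE).
    + rewrite edist_upd1 real_normK ?num_real// expr0n addr0.
      by rewrite -mulrN -mulrBr exprMn sqr_sgb mul1r; congr (_ ^+ 2); lra.
  - by rewrite expr0n addr0 expr1n; lra.
(* In the cone at [p], the point [q'] has height [8^-1] and radius 0, while [q] has height 0 and
   radius [T], as [E] is not a direction of [J]. *)
have low : 8^-1 ^+ 2 + T ^+ 2 <= d q' q ^+ 2.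
  have q'q : d q' q <= 4^-1.
    by have := dist_triangle hX p q' q; rewrite (distC hX q' p) pq; lra.
  have q'q0 := dist_ge0 hX q' q.
  rewrite leNgt; apply/negP => lt.
  pose g := 8^-1 ^+ 2 + T ^+ 2 - d q' q ^+ 2.
  have g0 : 0 < g by rewrite subr_gt0.
  pose k := Num.min 8^-1 (g / 2).
  have k0 : 0 < k by rewrite lt_min divr_gt0// invr_gt0 ltr0n.
  have k8 : k <= 8^-1 by rewrite ge_min lexx.
  have kg : k <= g / 2 by rewrite ge_min lexx orbT.
  have [l ql lk] := dist_approx hX q' q k0.
  have l0 := chain_ge0 ql.
  have e8 : (8^-1 : R) ^+ 2 + 0 ^+ 2 <= 8^-1 ^+ 2 by rewrite expr0n addr0.
  have e80 : 0 <= 8^-1 :> R by rewrite invr_ge0.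
  have [|e [r [[r0 nq] e1 e2]]] := near_chain (lexx 1) gp height uniq ql base e80 e8.
    by lra.
  have [v' [cv' v'p h1 h2 yv']] := nq s y cy yq.
  have v'v : v' = v.
    have yv'8 : edist y v' <= 8^-1 + l.
      by rewrite -(@ler_pXn2r _ 2) ?nnegrE ?edist_ge0 ?addr_ge0// yv'.
    apply: (gap_uniq (lexx 1) gp) => //.
    by have := edist_triangle y v' v; rewrite [edist v' y]edistC yv; lra.
  rewrite {}v'v in h1 h2 yv' *.
  have e0 : e = 0.
    have [[j [b LE]]|no] := pselect (exists j b, Dr (line v j b)); last first.
      by apply: h2 => j b LE; apply: no; exists j, b.
    have hj := height _ _ _ _ cv vp' LE.
    rewrite -(h1 j b LE); have [yj|yj] := eqVneq (y 0 j) (v 0 j).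
      by rewrite yj hj subrr.
    case: noJ; exists j => //; rewrite -LE; congr line.
    by apply: (sgb_inj (corner_val j kv)); rewrite hj inwardE.
  have rT : r ^+ 2 = T ^+ 2 by rewrite -yv yv' e0 expr0n add0r.
  move: e1; rewrite e0 sub0r sqrrN subr0 rT => e1.
  have l1 : l ^+ 2 < (d q' q + k) ^+ 2 by rewrite ltr_pXn2r ?nnegrE ?addr_ge0// ltW.
  have kc : k * d q' q <= k * 4^-1 by rewrite ler_pM2l.
  have kk : k * k <= k * 8^-1 by rewrite ler_pM2l.
  have l2 : l ^+ 2 < d q' q ^+ 2 + 2 * (k * d q' q) + k * k.
    by apply: lt_le_trans l1 _; rewrite le_eqVlt; apply/orP; left; apply/eqP; ring.
  by rewrite /g in kg g0; clear -e1 l2 kc kk kg g0; lra.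
(* Now [stewart] for [q] between [p] and [z], seen from [q']: as [d q' z < D], it gives
   [d q' q ^+ 2 < 8^-1 ^+ 2 + T ^+ 2]. *)
have lam01 : (0 <= T / D) && (T / D <= 1).
  by rewrite divr_ge0 ?(ltW T0) ?(ltW D0)//= ler_pdivrMr// mul1r.
have lamD : T / D * D = T by rewrite divfK// gt_eqF.
have d1 : d p q = T / D * d p z by rewrite pq -/D lamD.
have d2 : d q z = (1 - T / D) * d p z by rewrite qz -/D mulrBl lamD mul1r.
have := @stewart _ _ hX p q' z q _ lam01 d1 d2; rewrite -/D.
set lam := T / D in lam01 lamD *.
have lam0 : 0 < lam by rewrite divr_gt0.
have := dist_ge0 hX q' p; have := dist_ge0 hX q' z; rewrite (distC hX q' p).
have dp0 := dist_ge0 hX p q'.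
set A := d q' z in q'z *; set B := d p q' in dp dp0 *; set C := d q' q in low *.
move=> A0 _ S.
have A2 : A ^+ 2 < D ^+ 2 by rewrite ltr_pXn2r ?nnegrE ?(ltW D0).
have B2 : B ^+ 2 <= 8^-1 ^+ 2 by rewrite ler_pXn2r ?nnegrE ?invr_ge0.
have LD : lam * (1 - lam) * D ^+ 2 = T * D - T ^+ 2 by rewrite -lamD; ring.
have LD2 : lam * D ^+ 2 = T * D by rewrite -lamD; ring.
have : lam * A ^+ 2 < lam * D ^+ 2 by rewrite ltr_pM2l.
have : 0 <= lam * B ^+ 2 by rewrite mulr_ge0 ?sqr_ge0 ?(ltW lam0).
have E1 : (1 - lam) * B ^+ 2 = B ^+ 2 - lam * B ^+ 2 by ring.
by rewrite LD E1 in S; lra.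
Qed.

End Edges.

(** * The wall space of vertices *)

Section CubicalWalls.
Variables (R : realType) (X : cube_complex R).
Hypothesis hX : CAT0_cube_complex X.

Definition wall (E : R -> X) : set (R -> X) := [set L | conn E L \/ conn (flip E) L].

Definition is_wall (w : set (R -> X)) := exists2 E, is_edge E & w = wall E.

Lemma wall_conn E L : conn E L -> wall E = wall L.
Proof.
move=> EL; have LE := conn_sym EL; apply/seteqP; split=> M [H|H].
- by left; apply: conn_trans LE H.
- by right; apply: conn_trans (conn_flip LE) H.
- by left; apply: conn_trans EL H.
- by right; apply: conn_trans (conn_flip EL) H.
Qed.

Lemma wall_flip E : wall (flip E) = wall E.
Proof. by apply/seteqP; split=> M; rewrite /wall /= flipK => -[]; tauto. Qed.

Lemma wall_ref_exists w : exists E, is_wall w -> is_edge E /\ w = wall E.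
Proof.
have [[E eE wE]|nw] := pselect (is_wall w); first by exists E.
by case: (cc_nonempty X) => x; exists (fun=> x).
Qed.

(* Walls are unoriented classes of lines; this picks an orientation. *)
Definition wall_ref w := projT1 (cid (wall_ref_exists w)).

Lemma wall_refP w : is_wall w -> is_edge (wall_ref w) /\ w = wall (wall_ref w).
Proof. by rewrite /wall_ref; case: cid. Qed.

Definition orient (z : X) (w : set (R -> X)) : bool :=
  `[< is_wall w >] && side z (wall_ref w).

Lemma orient_wall E : is_edge E -> exists t : bool, forall z, is_vertex z ->
  orient z (wall E) = t (+) side z E.
Proof.
move=> eE; have wE : is_wall (wall E) by exists E.
have [eF EF] := wall_refP wE; set F := wall_ref _ in eF EF.
have : wall E F by rewrite EF; left; apply/conn_refl/edge_line.
move=> [c|c]; [exists false|exists true] => z vz; rewrite /orient -/F.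
  by rewrite asboolT//= (side_conn hX c)//; apply: vertex_offc.
rewrite asboolT//= -(side_conn hX c); last exact: vertex_offc.
by rewrite side_flip//; [exact: edge_line|exact: vertex_offc].
Qed.

Lemma orient_neq E x y : is_edge E -> is_vertex x -> is_vertex y ->
  (orient x (wall E) != orient y (wall E)) = (side x E != side y E).
Proof.
move=> /orient_wall[t H] vx vy; rewrite !H//.
by case: t {H} (side x E) (side y E) => [] [] [].
Qed.

Definition sepset x y : set {classic set (R -> X)} := [set w | orient x w != orient y w].

Lemma sepset_wall x y w : sepset x y w -> is_wall w.
Proof. by rewrite /sepset /= /orient; case: asboolP. Qed.

(** The ends of [E] are on different sides of its own wall by [side_self], and on the same side of
    any other by [side_edge]. *)
Lemma sepset_edge E : is_edge E -> sepset (E (- 2^-1)) (E 2^-1) = [set wall E].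
Proof.
move=> eE; have v1 := edge_end eE (normN_half R); have v2 := edge_end eE (norm_half R).
apply/seteqP; split=> [w sw|w ->]; last first.
  rewrite /sepset /= orient_neq//; have [-> /negPf->] := side_self hX eE.
  by [].
have [F eF wF] := sepset_wall sw; move: sw; rewrite wF /sepset /= orient_neq// => FE.
have [c|nc] := pselect (conn F E); first exact: wall_conn.
have [c|nr] := pselect (conn F (flip E)); first by rewrite (wall_conn c) wall_flip.
by rewrite (side_edge hX eE (edge_line eF) nc nr) eqxx in FE.
Qed.

Lemma sepset_triangle y x z : sepset x z `<=` sepset x y `|` sepset y z.
Proof.
move=> w sw; have [H|H] := boolP (orient x w != orient y w); first by left.
right; move: sw H; rewrite /sepset /=.
by case: (orient x w) (orient y w) (orient z w) => [] [] [].
Qed.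

Lemma sepset_xx x : sepset x x = set0.
Proof. by apply/seteqP; split=> // w; rewrite /sepset /= eqxx. Qed.

Lemma finite_sepset_trans y x z : finite_set (sepset x y) -> finite_set (sepset y z) ->
  finite_set (sepset x z).
Proof.
by move=> fxy fyz; apply: sub_finite_set (@sepset_triangle y x z) _; rewrite finite_setU.
Qed.

Lemma corner_flip s (v : 'rV[R]_(cc_dim s)) k : is_corner v ->
  line v k (inward v k) 2^-1 = @cc_map R X s (upd v k (- v 0 k)).
Proof.
move=> kv; rewrite /line clamp_id ?norm_half//; congr (cc_map (upd _ _ _)).
have h0 := inv2_gt0 R; rewrite /inward.
by case: (corner_valP k kv) => ->; rewrite ?oppr_lt0 ?h0 ?ltNge ?(ltW h0) /sgb /= ?mul1r ?mulN1r ?opprK.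
Qed.

Lemma corner_edge s (v : 'rV[R]_(cc_dim s)) k b : is_corner v -> is_edge (X := X) (line v k b).
Proof. by exists s, v, k, b. Qed.

Lemma finite_sepset_flip s (v : 'rV[R]_(cc_dim s)) k a : is_corner v -> `|a| = 2^-1 ->
  finite_set (sepset (cc_map v) (cc_map (upd v k a))).
Proof.
move=> kv a2; have [->|ne] := eqVneq a (v 0 k).
  by rewrite upd_id sepset_xx; apply: finite_set0.
have -> : a = - v 0 k.
  move/eqP: a2 ne; rewrite eqr_norml => /andP[/orP[]/eqP-> _];
  case: (corner_valP k kv) => ->; rewrite ?eqxx ?opprK//.
have := sepset_edge (corner_edge k (inward v k) kv).
by rewrite corner_start// corner_flip// => ->; apply: finite_set1.
Qed.

Lemma finite_sepset_cube s (v v' : 'rV[R]_(cc_dim s)) : is_corner v -> is_corner v' ->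
  finite_set (sepset (cc_map v) (cc_map v')).
Proof.
move=> kv kv'.
(* The coordinates of [v] are replaced by those of [v'] one at a time; each replacement is trivial
   or crosses an edge. *)
pose u (ks : seq 'I_(cc_dim s)) : 'rV[R]_(cc_dim s) :=
  \row_j if j \in ks then v' 0 j else v 0 j.
have E : u (enum 'I_(cc_dim s)) = v' by apply/rowP => j; rewrite mxE mem_enum.
rewrite -E; have [] : is_corner (u (enum 'I_(cc_dim s))) /\
  finite_set (sepset (cc_map v) (cc_map (u (enum 'I_(cc_dim s))))); last by [].
elim: (enum _) => [|k ks [ku IH]].
  have -> : u [::] = v by apply/rowP => j; rewrite mxE.
  by rewrite sepset_xx; split=> //; apply: finite_set0.
have -> : u (k :: ks) = upd (u ks) k (v' 0 k).
  by apply/rowP => j; rewrite updE !mxE inE; case: eqP => // ->.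
have v'k := corner_val k kv'.
split; first exact: corner_upd.
exact: finite_sepset_trans IH (finite_sepset_flip k ku v'k).
Qed.

(** The face supporting the common point belongs to both cubes, and pushing its free coordinates to
    [2^-1] gives a corner. *)
Lemma common_corner s t (x : 'rV[R]_(cc_dim s)) (y : 'rV[R]_(cc_dim t)) :
  cube x -> cube y -> @cc_map R X s x = @cc_map R X t y ->
  exists u w, [/\ is_corner u, is_corner w & @cc_map R X s u = @cc_map R X t w].
Proof.
move=> cx cy xy; have [h [_ hf _ _ bwd]] := glue cx cy xy.
pose u := mkpt (supp x) (fun=> 2^-1 : R).
have fu : face (supp x) u by apply: mkpt_face => i; rewrite norm_half.
have ku i : `|u 0 i| = 2^-1.
  by rewrite mxE; case: (supp x i) => [[]|]; rewrite ?normrN norm_half.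
have [fhu hE] := hf u fu.
exists u, (h u); split=> //.
  by split=> [|i]; rewrite ?/free ?ku ?ltxx//; apply: face_cube fu.
split=> [|j]; first exact: face_cube fhu.
rewrite /free -leNgt; have [fj|nf] := boolP (free y j).
  by have [i [b [fi ->]]] := bwd j fj; rewrite // norm_sgb ku.
by rewrite (face_supp_fixed cy fhu nf) half_norm.
Qed.

(** The points of a path need not be vertices, so the invariant [Q p] concerns the corners of all
    cubes containing [p]. Consecutive cubes share a corner, and within a cube [finite_sepset_cube]
    applies. *)
Lemma finite_sepset x y : is_vertex x -> is_vertex y -> finite_set (sepset x y).
Proof.
move=> vx vy; have [l xy _] := dist_approx hX x y ltr01.
pose Q p := forall t (b v : 'rV[R]_(cc_dim t)), cube b -> cc_map b = p ->
  is_corner v -> finite_set (sepset x (@cc_map R X t v)).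
have Qx : Q x.
  move=> t b v cb bx kv; rewrite -bx; apply: finite_sepset_cube => //.
  by apply: vertex_corner => //; rewrite bx.
have Qstep p q k : chain p q k -> Q p -> Q q.
  elim=> // s a b r k' ca cb _ IH Qa; apply: IH => t c v cc cE kv.
  have [u [w [ku kw uw]]] := common_corner cb cc (esym cE).
  apply: finite_sepset_trans (Qa s a u ca erefl ku) _.
  by rewrite uw; apply: finite_sepset_cube.
have [s [v [kv vE]]] := vertexP vy.
by rewrite -vE; apply: (Qstep _ _ _ xy Qx s v v) => //; case: kv.
Qed.

Definition vertex := {classic {p : X | is_vertex p}}.
Definition vpt (x : vertex) : X := projT1 (x : {p : X | is_vertex p}).
Definition mkv p (vp : is_vertex p) : vertex := exist _ p vp.

Lemma vptP x : is_vertex (vpt x). Proof. exact: projT2. Qed.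
Hint Resolve vptP : core.

Lemma vpt_inj : injective vpt.
Proof. by move=> [x vx] [y vy] /= xy; apply: eq_exist. Qed.

Definition sep (x y : vertex) : {fset {classic set (R -> X)}} := fset_set (sepset (vpt x) (vpt y)).

Lemma sepP x y w : (w \in sep x y) = (orient (vpt x) w != orient (vpt y) w).
Proof.
rewrite in_fset_set; last exact: finite_sepset.
by apply/idP/idP => [/set_mem//|H]; apply/mem_set.
Qed.

Lemma sep_edge E x y : is_edge E -> vpt x = E (- 2^-1) -> vpt y = E 2^-1 ->
  sep x y = [fset (wall E : {classic set (R -> X)})]%fset.
Proof. by move=> eE xE yE; rewrite /sep xE yE sepset_edge// fset_set1. Qed.

Lemma sep_wall E x y : is_edge E ->
  ((wall E : {classic set (R -> X)}) \in sep x y) = (side (vpt x) E != side (vpt y) E).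
Proof. by move=> eE; rewrite sepP orient_neq. Qed.

Lemma edge_to x y : x != y -> exists E, [/\ is_edge E, E (- 2^-1) = vpt x,
  side (vpt y) E & (wall E : {classic set (R -> X)}) \in sep x y].
Proof.
move=> xy; have [|s [v [J [kv vx [j Jj] Jside _]]]] := toward hX (vptP x) (vptP y).
  by move=> /vpt_inj /eqP; rewrite (negPf xy).
have eE := corner_edge j (inward v j) kv.
have Ex : line v j (inward v j) (- 2^-1) = vpt x by rewrite corner_start.
exists (line v j (inward v j)); split=> //; first exact: Jside.
rewrite sep_wall// (Jside j Jj) -Ex; have [_ /negPf->] := side_self hX eE.
by [].
Qed.

Lemma walls_edge_toward x y : x != y -> exists q w, w \in sep x y /\ sep x q = [fset w]%fset.
Proof.
move=> /edge_to[E [eE Ex _ wE]]; exists (mkv (edge_end eE (norm_half R))), (wall E).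
by split=> //; apply: sep_edge.
Qed.

(** The edge from [x] towards [y] must cross [w], so no wall separates its far end from [y]. *)
Lemma edge_of_sep1 x y w : sep x y = [fset w]%fset -> exists E,
  [/\ is_edge E, E (- 2^-1) = vpt x, E 2^-1 = vpt y & w = wall E].
Proof.
move=> xy; have [|E [eE Ex _ wE]] := @edge_to x y.
  by apply/eqP => E; move: xy; rewrite E => /fsetP/(_ w); rewrite sepP inE !eqxx.
pose q := mkv (edge_end eE (norm_half R)).
have qE : sep x q = [fset (wall E : {classic set (R -> X)})]%fset by apply: sep_edge.
have wE' : w = wall E by apply/esym/eqP; move: wE; rewrite xy inE.
exists E; split=> //; suff -> : y = q by [].
apply: (sep_eq0 walls_edge_toward); apply/fsetP => u; rewrite in_fset0 sepP.
have A : (orient (vpt x) u != orient (vpt y) u) = (u == w) by rewrite -sepP xy inE.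
have B : (orient (vpt x) u != orient (vpt q) u) = (u == w).
  by rewrite -sepP qE wE' inE.
by move: A B; case: (u == w) (orient _ u) (orient _ u) (orient _ u) => [] [] [] [].
Qed.

(** By [toward] both edges belong to one cube at [p], where they span a square; the side opposite to
    [E2] is parallel to it and has the same wall. *)
Lemma walls_square p z q1 q2 w1 w2 :
  sep p q1 = [fset w1]%fset -> sep p q2 = [fset w2]%fset -> w1 != w2 ->
  w1 \in sep p z -> w2 \in sep p z -> exists v, sep q1 v = [fset w2]%fset.
Proof.
move=> /edge_of_sep1[E1 [eE1 E1p E1q ->]] /edge_of_sep1[E2 [eE2 E2p _ ->]] w12.
rewrite !sep_wall// => s1 s2.
have pz : p != z by apply: contraTneq s1 => ->; rewrite eqxx.
have [|s [v [J [kv vx _ _ Jonly]]]] := toward hX (vptP p) (vptP z).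
  by move=> /vpt_inj /eqP; rewrite (negPf pz).
have side_z E : is_edge E -> E (- 2^-1) = vpt p -> side (vpt p) E != side (vpt z) E ->
    side (vpt z) E.
  by move=> eE <-; have [_ /negPf->] := side_self hX eE; case: (side _ _).
have [j Jj E1j] := Jonly E1 eE1 E1p (side_z _ eE1 E1p s1).
have [k Jk E2k] := Jonly E2 eE2 E2p (side_z _ eE2 E2p s2).
have jk : j != k by apply: contraNneq w12 => jk; rewrite E1j E2k jk.
pose w := upd v j (- v 0 j).
have kw : is_corner w by apply: corner_upd => //; rewrite normrN corner_val.
have wk : inward w k = inward v k by rewrite /inward updE eq_sym (negPf jk).
have eF := corner_edge k (inward v k) kw.
exists (mkv (edge_end eF (norm_half R))).
rewrite (sep_edge eF)//; last by rewrite -E1q -wk corner_start// E1j corner_flip.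
by rewrite E2k (wall_conn (conn_seg k (inward v k) kv.1 kw.1)).
Qed.

(** By [toward] all edges from [p] towards [z] lie in one cube, at most one in each coordinate
    direction. *)
Lemma walls_dim_bound N : (forall s : cc_idx X, (cc_dim s <= N)%N) ->
  forall p z (ws : seq {classic set (R -> X)}), uniq ws ->
  (forall w, w \in ws -> w \in sep p z /\ exists q, sep p q = [fset w]%fset) ->
  (size ws <= N)%N.
Proof.
move=> dimN p z [//|w0 ws'] uws wsP; set ws := w0 :: ws' in uws wsP *.
have pz : p != z.
  have [+ _] := wsP w0 (mem_head _ _); rewrite sepP; apply: contraTneq => ->.
  by rewrite eqxx.
have [|s [v [J [kv vx _ _ Jonly]]]] := toward hX (vptP p) (vptP z).
  by move=> /vpt_inj /eqP; rewrite (negPf pz).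
pose f j : {classic set (R -> X)} := wall (line v j (inward v j) : R -> X).
apply: (@leq_trans (size [seq f j | j <- enum 'I_(cc_dim s)])); last first.
  by rewrite size_map size_enum_ord.
apply: uniq_leq_size => // w /wsP[+ [q /edge_of_sep1[E [eE Ep _ wE]]]].
rewrite wE sep_wall// => sE.
have Ez : side (vpt z) E.
  by move: sE; rewrite -Ep; have [_ /negPf->] := side_self hX eE; case: (side _ _).
have [j _ ->] := Jonly E eE Ep Ez; apply/mapP; exists j => //; exact: mem_enum.
Qed.

Lemma vertex_exists : inhabited vertex.
Proof.
case: (cc_nonempty X) => x; have [s [y [cy _]]] := cc_cover x.
have kv : is_corner (const_mx 2^-1 : 'rV[R]_(cc_dim s)).
  by split=> i; rewrite /free mxE norm_half ?ltxx.
by constructor; apply: (mkv (corner_vertex kv)).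
Qed.

(** Together with [cell_sep1], this describes adjacency by cells and vertices alone, which a
    cellular action preserves. The cell is the face supporting the midpoint of the edge. *)
Lemma sep1_cell x y w : sep x y = [fset w]%fset -> x <> y /\ exists C : set X,
  is_cell C /\ forall p, C p /\ is_vertex p <-> p = vpt x \/ p = vpt y.
Proof.
move=> xy; split.
  by move=> E; move: xy; rewrite E => /fsetP/(_ w); rewrite sepP inE !eqxx.
have [E [[s [v [i [b [kv ->]]]]] Ex Ey _]] := edge_of_sep1 xy.
pose x0 := upd v i 0.
have cx0 : cube x0 by apply: cube_upd; [case: kv|rewrite normr0 ltW// inv2_gt0].
have f0 k : free x0 k = (k == i).
  rewrite /free updE; case: eqP => [_|_]; first by rewrite normr0 inv2_gt0.
  by apply/negbTE; case: kv => _; apply.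
exists (@cc_map R X s @` face (supp x0)); split; first by exists s, (supp x0).
have lineE u : `|u| = 2^-1 -> line v i b u = cc_map (upd x0 i (sgb R b * u)).
  by move=> u2; rewrite /line clamp_id ?u2// /x0 upd_upd.
have hfree : free x0 i by rewrite f0.
have h u : `|u| = 2^-1 -> face (supp x0) (upd x0 i (sgb R b * u)).
  by move=> u2; apply: face_upd => //; [exact: supp_face|rewrite norm_sgb u2].
move=> p; split=> [[[y' fy <-] vy]|[->|->]].
- have ky := vertex_corner vy (face_cube fy).
  have yE : y' = upd x0 i (y' 0 i).
    apply/rowP => k; rewrite updE; case: eqP => [->//|/eqP ki].
    by rewrite (face_supp_fixed cx0 fy) ?f0.
  rewrite -Ex -Ey !lineE ?normN_half ?norm_half// yE.
  have := corner_val i ky => /eqP; rewrite eqr_norml => /andP[/orP[]/eqP-> _];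
  case: b {Ex Ey lineE h}; rewrite /sgb ?mul1r ?mulN1r ?opprK; tauto.
- split=> //; rewrite -Ex lineE ?normN_half//; eexists; last by [].
  by apply: h; rewrite normN_half.
- split=> //; rewrite -Ey lineE ?norm_half//; eexists; last by [].
  by apply: h; rewrite norm_half.
Qed.

(** Two distinct corners of a face differ in a free coordinate. The edge from [a] along it stays in
    the face and ends at a vertex other than [x], hence at [y]. *)
Lemma cell_sep1 x y (C : set X) : x <> y -> is_cell C ->
  (forall p, C p /\ is_vertex p <-> p = vpt x \/ p = vpt y) ->
  exists w, sep x y = [fset w]%fset.
Proof.
move=> xy [s [f ->]] H.
have [[a fa aE] _] := (H (vpt x)).2 (or_introl erefl).
have [[b fb bE] _] := (H (vpt y)).2 (or_intror erefl).
have ka : is_corner a by apply: vertex_corner; rewrite ?aE//; apply: face_cube fa.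
have kb : is_corner b by apply: vertex_corner; rewrite ?bE//; apply: face_cube fb.
have [i ai] : exists i, a 0 i != b 0 i.
  apply: contrapT => no; apply: xy; apply: vpt_inj; rewrite -aE -bE; congr cc_map.
  by apply/rowP => i; apply/eqP; apply: contraT => ab; case: no; exists i.
have fi : f i = None.
  by have := fa i; have := fb i; case: (f i) => // c ba aa; rewrite ba aa eqxx in ai.
pose E : R -> X := line a i (inward a i).
have eE : is_edge E by apply: corner_edge.
have Ex : E (- 2^-1) = vpt x by rewrite /E corner_start.
have Ev := edge_end eE (norm_half R).
have fE : (@cc_map R X s @` face f) (E 2^-1).
  rewrite /E corner_flip//; exists (upd a i (- a 0 i)) => //.
  move=> k; rewrite updE; case: eqP => [->|_]; last exact: fa.
  by rewrite fi normrN; apply: face_coord fa.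
have [E1|E1] := (H (E 2^-1)).1 (conj fE Ev).
  by case: (edge_ends_neq hX eE); rewrite E1 Ex.
by exists (wall E); apply: sep_edge.
Qed.

End CubicalWalls.

(** * Growth of amenable subgroups *)

Section WordLength.
Variables (R : realType) (G : groupType) (S : set G).
Hypothesis genS : generates S.
Local Notation wl := (word_length R S).

Let lengths g : set R := [set (size w)%:R | w in [set w | word S g w]].

Lemma lengths_nonempty g : lengths g !=set0.
Proof. by have [w gw] := genS g; exists (size w)%:R; exists w. Qed.

Lemma word_length_le g w : word S g w -> wl g <= (size w)%:R.
Proof.
by move=> gw; apply: ge_inf; [exists 0 => _ [v _ <-]|exists w].
Qed.

Lemma le_word_length g x : (forall w, word S g w -> x <= (size w)%:R) -> x <= wl g.
Proof.
move=> H; apply: lb_le_inf; first exact: lengths_nonempty.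
by move=> _ [w gw <-]; apply: H.
Qed.

Lemma word_cat g h w v : word S g w -> word S h v -> word S (g * h)%g (w ++ v).
Proof.
move=> [wS wg] [vS vh]; split; last by rewrite big_cat /= wg vh.
by move=> a; rewrite mem_cat => /orP[/wS|/vS].
Qed.

Lemma word_inv g w : word S g w -> word S g^-1%g (rev (map (fun a => a^-1%g) w)).
Proof.
elim: w g => [|a w IH] g [wS wg].
  by split=> //; rewrite -wg !big_nil monoid.invg1.
have [|vS vg] := IH (\prod_(b <- w) b)%g.
  by split=> // b bw; apply: wS; rewrite inE bw orbT.
rewrite map_cons rev_cons; split.
  move=> b; rewrite mem_rcons inE => /orP[/eqP->|/vS//].
  by rewrite monoid.invgK; have := wS a (mem_head _ _); tauto.
by rewrite -cats1 big_cat /= vg big_cons big_nil monoid.mulg1 -wg big_cons monoid.invgM.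
Qed.

Lemma word_length_is_length : is_length wl.
Proof.
have inv_le g : wl g^-1%g <= wl g.
  apply: le_word_length => w gw; apply: le_trans (word_length_le (word_inv gw)) _.
  by rewrite size_rev size_map.
split=> [g||g|g h].
- by apply: le_word_length.
- apply/eqP; rewrite eq_le le_word_length// andbT.
  by apply: (@word_length_le _ [::]); split=> //; rewrite big_nil.
- by apply/eqP; rewrite eq_le inv_le -{1}(monoid.invgK g) inv_le.
rewrite -lerBlDr; apply: le_word_length => w gw.
rewrite lerBlDr -lerBlDl; apply: le_word_length => v hv.
by rewrite lerBlDl -natrD -size_cat; apply: word_length_le; apply: word_cat.
Qed.

End WordLength.

(** * The action on vertices and the growth bound *)

Section Main.
Variables (R : realType) (G : groupType) (X : cube_complex R).
Variable act : G -> X -> X.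
Hypothesis hX : CAT0_cube_complex X.
Hypothesis hdim : finite_dimensional X.
Hypothesis hact : is_action act.
Hypothesis hcell : cellular act.
Hypothesis hstab : uniformly_bounded_stabilizers act.

(** The image cell is a single point, so a free coordinate of its face code would yield two interior
    points with the same image, against [cc_inj]. *)
Lemma act_vertex g v : is_vertex v -> is_vertex (act g v).
Proof.
move=> [s [f [fN E]]].
have : is_cell [set v] by exists s, f.
move=> /(hcell.2 g); rewrite image_set1 => -[t [f' E']]; exists t, f'; split=> // i f'i.
pose c (b : bool) := mkpt f' (fun k => if b && (k == i) then 4^-1 else 0 : R).
have ci b : face_interior f' (c b).
  move=> k; rewrite mxE; case: (f' k) => //; case: ifP => _.
    by rewrite ger0_norm ?invr_ge0//; lra.
  by rewrite normr0 inv2_gt0.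
have cE b : cc_map (c b) = act g v.
  have : (@cc_map R X t @` face f') (cc_map (c b)).
    by exists (c b) => //; apply: interior_face.
  by rewrite -E'.
have := cc_inj (ci true) (ci false) (etrans (cE true) (esym (cE false))).
move=> /rowP/(_ i); rewrite !mkpt_free// eqxx /= => /eqP.
by rewrite invr_eq0 pnatr_eq0.
Qed.

Definition vact g (x : vertex X) : vertex X := mkv (act_vertex g (vptP x)).

Lemma vpt_act g x : vpt (vact g x) = act g (vpt x). Proof. by []. Qed.

Lemma vact1 x : vact 1%g x = x.
Proof. by apply: vpt_inj; rewrite vpt_act hact.1. Qed.

Lemma vactM g h x : vact (g * h)%g x = vact g (vact h x).
Proof. by apply: vpt_inj; rewrite !vpt_act hact.2. Qed.

Let d (x y : vertex X) := #|` sep x y|.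

Let sP := sepP hX.
Let eT := walls_edge_toward hX.
Let sq := walls_square hX.

Lemma vact_adj g x y w : sep x y = [fset w]%fset -> exists w', sep (vact g x) (vact g y) = [fset w']%fset.
Proof.
move=> /(sep1_cell hX)[xy [C [cC CP]]].
apply: (cell_sep1 hX (C := act g @` C)).
- move=> E; apply: xy; have := congr1 (vact g^-1%g) E.
  by rewrite -!vactM monoid.mulVg !vact1.
- exact: hcell.2.
move=> p; split=> [[[q Cq <-] vq]|].
  have vq' : is_vertex q.
    by rewrite -[q]hact.1 -(monoid.mulVg g) hact.2; apply: act_vertex.
  by case: ((CP q).1 (conj Cq vq')) => ->; [left|right].
by move=> [->|->]; (split; last exact: vptP);
  [exists (vpt x)|exists (vpt y)] => //; [case: (CP (vpt x))|case: (CP (vpt y))];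
  move=> _ H; case: H; auto.
Qed.

(** An edge path from [x] to [y] of length [d x y] goes to an edge path by [vact_adj]. *)
Lemma vact_dist_le g x y : (d (vact g x) (vact g y) <= d x y)%N.
Proof.
have [n] := ubnP (d x y); elim: n x => // n IH x; rewrite ltnS => len.
have [->|/eT[q [w [wxy xq]]]] := eqVneq x y; first by rewrite /d (sepxx sP) cardfs0.
have step := card_sep_step sP xq wxy; rewrite -/(d x y) -/(d q y) in step.
have [w' gxq] := vact_adj g xq.
apply: leq_trans (card_sep_triangle sP _ (vact g q) _) _.
by rewrite gxq cardfs1 add1n step ltnS; apply: IH; rewrite -ltnS -step ltnS.
Qed.

Lemma vact_dist g x y : d (vact g x) (vact g y) = d x y.
Proof.
apply/eqP; rewrite eqn_leq vact_dist_le /=.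
by have := vact_dist_le g^-1%g (vact g x) (vact g y); rewrite -!vactM monoid.mulVg !vact1.
Qed.

Lemma dist_vC x y : d x y = d y x. Proof. by rewrite /d (sepC sP). Qed.

Lemma dist_v_triangle x y z : (d x z <= d x y + d y z)%N.
Proof. exact: (card_sep_triangle sP). Qed.

Lemma dist_vxx x : d x x = 0%N. Proof. by rewrite /d (sepxx sP) cardfs0. Qed.

Lemma stab_bound : exists c, forall (x : vertex X) (s : seq G), uniq s ->
  (forall g, g \in s -> vact g x = x) -> (size s <= c)%N.
Proof.
have [c cP] := hstab; exists c => x s us sx.
have H : ([set` s] #<= `I_c)%card.
  apply: card_le_trans (cP (vpt x) (vptP x)); apply: subset_card_le => g /sx gx.
  exact: (congr1 (fun y : vertex X => vpt y) gx).
rewrite -card_le_II; apply: card_le_trans H.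
have : ([set` [fset x in s]%fset] #= `I_(#|` [fset x in s]%fset|))%card by apply/card_eq_fsetP.
rewrite card_fseq undup_id// => E.
move: E; rewrite card_eq_le => /andP[_ E]; apply: card_le_trans E _.
by apply: subset_card_le => g /=; rewrite inE.
Qed.

Lemma subgroup_seq (H : groupClosed G) (s : seq G) : uniq s ->
  (forall g, g \in s -> g \in H) -> exists s' : seq (subgroup H),
  [/\ uniq s', size s' = size s & forall h, h \in s' -> val h \in s].
Proof.
move=> us sH; exists (pmap insub s); split.
- exact: pmap_sub_uniq.
- by rewrite size_pmap_sub; apply/eqP; rewrite -all_count; apply/allP.
- by move=> h; rewrite mem_pmap_sub.
Qed.

Variable x0 : vertex X.

Definition orbit_length (g : G) : nat := d x0 (vact g x0).

Lemma orbit_length1 : orbit_length 1%g = 0%N.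
Proof. by rewrite /orbit_length vact1 dist_vxx. Qed.

Lemma orbit_lengthV g : orbit_length g^-1%g = orbit_length g.
Proof.
by rewrite /orbit_length -(vact_dist g) -vactM monoid.mulgV vact1 dist_vC.
Qed.

Lemma orbit_lengthM g h : (orbit_length (g * h)%g <= orbit_length g + orbit_length h)%N.
Proof.
rewrite /orbit_length; apply: leq_trans (dist_v_triangle _ (vact g x0) _) _.
by rewrite vactM vact_dist.
Qed.

(** The constants come from the action alone, so one polynomial serves all amenable subgroups. The
    counting takes place in the subgroup, where the mean lives. *)
Lemma amenable_ball_bound : exists c N : nat, forall (H : groupClosed G) (r : nat),
  amenable R (subgroup H) -> forall s : seq G, uniq s ->
  (forall g, g \in s -> g \in H /\ (orbit_length g <= r)%N) ->
  (size s <= 4 * c * ((N * r).+1 ^ N) ^ 3)%N.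
Proof.
have [c cP] := stab_bound; have [N dimN] := hdim; exists c, N.
move=> H r [m [m_lin m_ge0 m1 m_inv]] s us sP'.
have sH g : g \in s -> g \in H by move=> /sP'[].
have [s' [us' <- s'P]] := @subgroup_seq H s us sH.
pose a (i : 'I_(size s')) := tnth (in_tuple s') i.
pose hact' (h : subgroup H) x := vact (val h) x.
pose dim := walls_dim_bound hX dimN.
have btwE x t y : (d x t + d t y == d x y)%N = (sep x t `<=` sep x y)%fset.
  exact: (between_card sP).
have A1 (x : vertex X) : hact' 1%g x = x by apply: vact1.
have AM g h (x : vertex X) : hact' (g * h)%g x = hact' g (hact' h x) by apply: vactM.
have med3 x y z : [/\ (d x (med sP eT sq x y z) + d (med sP eT sq x y z) y == d x y)%N,
     (d x (med sP eT sq x y z) + d (med sP eT sq x y z) z == d x z)%N &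
     (d y (med sP eT sq x y z) + d (med sP eT sq x y z) z == d y z)%N].
  rewrite !btwE; split; [exact: med_between1|exact: med_between2|].
  by rewrite (medCA sP eT sq); apply: med_between2.
have st (x : vertex X) (t : seq (subgroup H)) : uniq t ->
    (forall g, g \in t -> hact' g x = x) -> (size t <= c)%N.
  move=> ut tx; rewrite -(size_map val); apply: (cP x).
    by rewrite map_inj_uniq//; apply: val_inj.
  by move=> g /mapP[h ht ->]; apply: tx.
have int x z : exists2 t : seq (vertex X), (size t <= (N * r).+1 ^ N)%N &
    forall y, (d x y + d y z == d x z)%N -> (d x y <= r)%N -> y \in t.
  have [t tN tP] := interval_enum sP eT sq dim x z r.
  by exists t => // y; rewrite btwE; apply: tP.
have dact (g : subgroup H) x y : d (hact' g x) (hact' g y) = d x y by apply: vact_dist.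
have B0 : (0 < (N * r).+1 ^ N)%N by rewrite expn_gt0.
have ainj : injective a by apply/(tuple_uniqP (in_tuple s')).
have ar i : (d x0 (hact' (a i) x0) <= r)%N.
  by have [] := sP' (val (a i)) (s'P _ (mem_tnth i (in_tuple s'))).
rewrite -[size s']card_ord.
exact: (family_card A1 AM dist_vC dact med3 st int B0 m_lin m_ge0 m1 m_inv ainj ar).
Qed.

(** The ball of radius [r] for [l] lies in the ball of radius [k] for the orbit length, with [k] the
    integer part of [C%:R * r]; the polynomial is the bound of [amenable_ball_bound] with [C%:R * r]
    in place of [k]. *)
Lemma amenable_polynomial_growth (l : G -> R) (C : nat) :
  (forall g, (orbit_length g)%:R <= C%:R * l g) ->
  forall H : groupClosed G, amenable R (subgroup H) -> polynomial_growth H l.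
Proof.
move=> lC H amH; have [c [N bound]] := amenable_ball_bound.
pose Q : {poly R} := (N%:R * C%:R)%:P * 'X + 1.
exists ((4 * c)%:R%:P * (Q ^+ N) ^+ 3) => r r0.
pose k := Num.truncn (C%:R * r).
have Cr0 : 0 <= C%:R * r by rewrite mulr_ge0.
exists (4 * c * ((N * k).+1 ^ N) ^ 3)%N.
  have [|s sn sA] := @bounded_enum G (fun h => h \in H /\ l h <= r)
      (4 * c * ((N * k).+1 ^ N) ^ 3).
    move=> s us sH; apply: (bound H k amH s us) => g /sH[gH gr]; split=> //.
    rewrite truncn_ge_nat//; apply: le_trans (lC g) _.
    by rewrite ler_wpM2l.
  have : ([set` [fset x in s]%fset] #= `I_(#|` [fset x in s]%fset|))%card.
    by apply/card_eq_fsetP.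
  rewrite card_eq_le => /andP[E _].
  apply: (card_le_trans (B := [set` [fset x in s]%fset])).
    by apply: subset_card_le => g /sA /=; rewrite inE.
  apply: card_le_trans E _; rewrite card_le_II; apply: leq_trans sn.
  by rewrite card_fseq size_undup.
rewrite /Q !(hornerE, horner_exp) /= !natrM !natrX.
set A := _ ^+ N; set B := (_ + 1) ^+ N.
have A0 : 0 <= A by rewrite exprn_ge0.
have AB : A <= B.
  rewrite lerXn2r ?nnegrE ?addr_ge0 ?mulr_ge0//.
  by rewrite -natr1 lerD2r natrM -mulrA ler_wpM2l// truncn_le.
by rewrite !ler_pM ?mulr_ge0.
Qed.

Lemma generated_orbit_length (S : set G) : finite_set S -> generates S ->
  exists C : nat, forall g, (orbit_length g)%:R <= C%:R * word_length R S g.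
Proof.
move=> /finite_seqP[s ->] genS; pose C := \max_(a <- s) orbit_length a.
have SC a : [set` s] a \/ [set` s] (a^-1)%g -> (orbit_length a <= C)%N.
  case=> [as_|as_]; first exact: leq_bigmax_seq.
  by rewrite -orbit_lengthV; apply: (leq_bigmax_seq (F := orbit_length)).
have wC w g : word [set` s] g w -> (orbit_length g <= C.+1 * size w)%N.
  elim: w g => [|a w IH] g [wS <-]; first by rewrite big_nil orbit_length1.
  rewrite big_cons; apply: leq_trans (orbit_lengthM _ _) _.
  rewrite /= mulnS leq_add//; first by apply: leqW; apply/SC/wS/mem_head.
  by apply: IH; split=> // b bw; apply: wS; rewrite inE bw orbT.
(* The successor makes the constant positive, so that one can divide by it before passing to the
   infimum over words. *)
exists C.+1 => g; rewrite mulrC -ler_pdivrMr//.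
apply: le_word_length => // w gw.
by rewrite ler_pdivrMr// -natrM ler_nat mulnC wC.
Qed.

Lemma orbit_is_length : is_length (fun g => (orbit_length g)%:R : R).
Proof.
split=> [g||g|g h]; rewrite ?orbit_length1 ?orbit_lengthV//.
by rewrite -natrD ler_nat orbit_lengthM.
Qed.

End Main.

Theorem corollary0p5 (R : realType) (G : groupType) (X : cube_complex R)
    (act : G -> X -> X)
    (hX : CAT0_cube_complex X)
    (hdim : finite_dimensional X)
    (hact : is_action act)
    (hcell : cellular act)
    (hproper : proper_action act)
    (hstab : uniformly_bounded_stabilizers act) :
  (exists l : G -> R, is_length l /\ no_amenable_superpolynomial l) /\
  (forall S : set G, finite_set S -> generates S ->
     is_length (word_length R S) /\
     no_amenable_superpolynomial (word_length R S)).
Proof.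
have [x0] := vertex_exists X.
have growth := amenable_polynomial_growth hX hdim hact hstab (hcell := hcell) (x0 := x0).
split.
  exists (fun g => (orbit_length hcell x0 g)%:R).
  split; first exact: orbit_is_length.
  move=> [H [amH]]; apply; apply: (growth _ 1%N) amH => g.
  by rewrite mul1r.
move=> S finS genS; split; first exact: word_length_is_length.
move=> [H [amH]]; apply.
have [C SC] := generated_orbit_length hX hact hcell x0 finS genS.
exact: growth SC _ amH.
Qed.
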